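(* For any $m \ge 2$ and $n \ge 1$, there exist a lattice $\Gamma \subset \mathbb{R}^m \times \mathbb{R}^n$ such that $p_1|_{\Gamma}$ is injective and $p_2(\Gamma)$ is dense in $\mathbb{R}^n$ (where $p_1, p_2$ are the projections from $\mathbb{R}^m \times \mathbb{R}^n$ onto $\mathbb{R}^m$ and $\mathbb{R}^n$ respectively), and two parallelepipeds $W, W' \subset \mathbb{R}^n$, such that the two model sets $\Lambda(\Gamma, W)$ and $\Lambda(\Gamma, W')$ in $\mathbb{R}^m$ are bounded distance equivalent, but $W, W'$ are not equidecomposable up to measure zero with polytope pieces using translations by vectors from $p_2(\Gamma)$.
   Context: A lattice in $\mathbb{R}^m \times \mathbb{R}^n$ is a discrete subgroup of full rank $m+n$. For a bounded set $W \subset \mathbb{R}^n$, the model set is $\Lambda(\Gamma, W) = \{ p_1(\gamma) : \gamma \in \Gamma, \ p_2(\gamma) \in W \} \subset \mathbb{R}^m$. Two discrete point sets $\Lambda, \Lambda' \subset \mathbb{R}^m$ are bounded distance equivalent if there exist a constant $K > 0$ and a bijection $\chi : \Lambda \to \Lambda'$ with $|\chi(\lambda) - \lambda| \le K$ for all $\lambda \in \Lambda$. Parallelepipeds in $\mathbb{R}^n$ are nondegenerate ($n$-dimensional). A polytope in $\mathbb{R}^n$ is any finite union of $n$-dimensional simplices with disjoint interiors (so it may be non-convex or disconnected). Let $G$ be a countable subgroup of $\mathbb{R}^n$. Two measurable sets $A, B \subset \mathbb{R}^n$ are equidecomposable up to measure zero with polytope pieces, using translations by vectors from $G$, if there exist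 finitely many polytopes $A_1, \dots, A_k \subset \mathbb{R}^n$, vectors $g_1, \dots, g_k \in G$, and a set $X' \subset \mathbb{R}^n$ whose complement has Lebesgue measure zero, such that $\{A_j \cap X'\}_{j=1}^k$ is a partition of $A \cap X'$ and $\{(A_j + g_j) \cap X'\}_{j=1}^k$ is a partition of $B \cap X'$. *)

(* Defs.v *)
From HB Require Import structures.
From mathcomp Require Import all_boot all_order all_algebra.
From mathcomp Require Import all_classical all_reals.
From mathcomp Require Import ereal topology normedtype sequences.

Set Implicit Arguments.
Unset Strict Implicit.
Unset Printing Implicit Defensive.

Import Order.TTheory GRing.Theory Num.Theory.
Import numFieldNormedType.Exports.

Local Open Scope classical_set_scope.
Local Open Scope ring_scope.

(* The library norm on ['rV[R]_m] is the sup norm. *)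
Definition euclidean_norm (R : realType) (m : nat) (x : 'rV[R]_m) : R :=
  Num.sqrt (\sum_(i < m) x 0 i ^+ 2).

(* For a discrete subgroup of a real vector space, the rank is the dimension
   of the real span. *)
Definition is_lattice (R : realType) (m n : nat)
    (Gamma : set ('rV[R]_m * 'rV[R]_n)) : Prop :=
  [/\ Gamma 0,
      (forall x y, Gamma x -> Gamma y -> Gamma (x - y)),
      Gamma `<=` isolated Gamma
    & exists X : (m + n).-tuple ('rV[R]_m * 'rV[R]_n),
        free X /\ [set` X] `<=` Gamma].

Definition model_set (R : realType) (m n : nat)
    (Gamma : set ('rV[R]_m * 'rV[R]_n)) (W : set 'rV[R]_n) : set 'rV[R]_m :=
  [set gamma.1 | gamma in [set gamma | Gamma gamma /\ W gamma.2]].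

Definition bounded_distance_equivalent (R : realType) (m : nat)
    (L L' : set 'rV[R]_m) : Prop :=
  exists (K : R) (chi : 'rV[R]_m -> 'rV[R]_m),
    [/\ 0 < K, set_bij L L' chi
      & forall x, L x -> euclidean_norm (chi x - x) <= K].

(* The rows of [E] are the edge vectors issued from the vertex [v]. *)
Definition is_parallelepiped (R : realType) (n : nat)
    (W : set 'rV[R]_n) : Prop :=
  exists (v : 'rV[R]_n) (E : 'M[R]_n), E \in unitmx /\
    W = [set v + t *m E | t in [set t : 'rV[R]_n | forall i, 0 <= t 0 i <= 1]].

Definition affinely_independent (R : realType) (n k : nat)
    (p : 'I_k.+1 -> 'rV[R]_n) : Prop :=
  row_free (\matrix_(i < k) (p (lift ord0 i) - p ord0)).

Definition convex_hull (R : realType) (n k : nat)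
    (p : 'I_k -> 'rV[R]_n) : set 'rV[R]_n :=
  [set \sum_(i < k) t i *: p i
    | t in [set t : 'I_k -> R | (forall i, 0 <= t i) /\ \sum_(i < k) t i = 1]].

Definition is_simplex (R : realType) (n : nat) (S : set 'rV[R]_n) : Prop :=
  exists2 p : 'I_n.+1 -> 'rV[R]_n, affinely_independent p & S = convex_hull p.

Definition is_polytope (R : realType) (n : nat) (P : set 'rV[R]_n) : Prop :=
  exists (s : nat) (S : 'I_s -> set 'rV[R]_n),
    [/\ forall i, is_simplex (S i),
        trivIset [set: 'I_s] (fun i => interior (S i))
      & P = \bigcup_i S i].

Definition box (R : realType) (n : nat) (a b : 'rV[R]_n) : set 'rV[R]_n :=
  [set x | forall i, a 0 i <= x 0 i <= b 0 i].

Definition box_volume (R : realType) (n : nat) (a b : 'rV[R]_n) : R :=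
  \prod_(i < n) (b 0 i - a 0 i).

Definition lebesgue_outer_measure (R : realType) (n : nat)
    (A : set 'rV[R]_n) : \bar R :=
  ereal_inf
    [set (\sum_(k <oo) (box_volume (c k).1 (c k).2)%:E)%E
      | c in [set c : nat -> 'rV[R]_n * 'rV[R]_n |
               (forall k i, (c k).1 0 i <= (c k).2 0 i) /\
               A `<=` \bigcup_k box (c k).1 (c k).2]].

(* [A] is Lebesgue measurable of measure zero iff its outer measure is zero. *)
Definition lebesgue_null (R : realType) (n : nat) (A : set 'rV[R]_n) : Prop :=
  lebesgue_outer_measure A = 0%E.

(* [partition] requires nonempty parts; this is no restriction, since a
   nonempty polytope has positive measure and hence meets [X']. *)
Definition equidecomposable (R : realType) (n : nat)
    (G A B : set 'rV[R]_n) : Prop :=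
  exists (k : nat) (P : 'I_k -> set 'rV[R]_n) (g : 'I_k -> 'rV[R]_n)
      (X' : set 'rV[R]_n),
    [/\ forall j, is_polytope (P j),
        forall j, G (g j),
        lebesgue_null (~` X'),
        partition [set: 'I_k] (fun j => P j `&` X') (A `&` X')
      & partition [set: 'I_k]
          (fun j => [set x + g j | x in P j] `&` X') (B `&` X')].

(* Main.v *)
From HB Require Import structures.
Require Import Defs.
From mathcomp Require Import all_boot all_order all_algebra finmap.
From mathcomp Require Import all_classical all_reals.
From mathcomp Require Import ereal topology normedtype sequences.
From mathcomp Require Import measure measurable_realfun lebesgue_measure.
From mathcomp Require Import numfun lebesgue_integral.
From mathcomp Require Import ring lra zify.

(** Let [e] be the real root of [x^3 + 2 x - 1]; it is a unit of the cubic ring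
Z[e], its two other conjugates are complex of modulus [e^(-1/2) > 1], and
[(-1)^(v0 + v1 + v2)] is a character of the additive group of Z[e] (with
coordinates in the basis [1, e, e^2]) that is preserved by multiplication by
[e] and takes the value [-1] at [1].  The kernel of this character, of index
two, is the group of even elements.

The lattice.  Its points carry an even element [b0 + a0 e + a1 e^2], the first
internal coordinate, together with integers that are free in the remaining
directions.  The windows are [W = [0, 1] x Q] and its translate
[W' = [1, 2] x Q] along the first axis, where [Q] is a unit cube of dimension
[n - 1] in generic position.  The remaining internal coordinates are
[b_i + c_i a1] with [c] such that the multiples of [c] are dense modulo 1,
and the physical coordinates (the first projection) are the [a_i], perturbed by a linear function of
the internal coordinates.  The perturbation is bounded over the windows, and
it makes the first projection injective ([Gamma_fst_inj]).

Bounded distance.  Over each site [(a0, a1)] of Z^2 there is exactly one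
element of Z[e] in [0, 1).  The model set of [W] consists of the sites
where this element is even, the one of [W'] of the sites where it is odd, as
adding 1 changes the parity; the other physical coordinates are free, and only
the endpoints of the windows, over the origin, make an exception.  So one
needs a bijection of bounded displacement between the even and the odd sites.  By an argument of Laczkovich, which
combines Hall's marriage theorem and the Schroeder-Bernstein construction
([balanced_bijection]), it is enough that for every finite set [A] of sites
the numbers of even and of odd sites in [A] differ by at most a constant times
the perimeter of [A].  This is [discrepancy_le_perimeter].  Cut the window
[0, 1) into the levels [e^(4k+4) <= y < e^(4k)].  On each level the rotation
by [e^(4k+1)] is an exchange of two intervals whose two translations are odd
elements, hence a bijection that reverses the parity and moves the sites by
[O(8^k)] ([sgn_flip], [flip_dist]).  Replace the indicator of [A] by its
averages over blocks of side [8^k]: what the exchange at level [k] fails to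
cancel is the variation of these averages, which an L^1 Poincare inequality
([block_average_sub]) bounds by [8^-k] times the local perimeter, summed over
the sites of the strip [0 <= y < e^(4k)].  Since the norm of a nonzero element
of Z[e] is at least 1 in absolute value, two such sites are at distance at
least of order [4^k] ([strip_separation]), so that each piece of perimeter
is counted [O(4^k)] times.  The errors are [O(2^-k)] times the perimeter and
their sum converges.

Non-equidecomposability.  Let the jump of a polytope at a point be the value
of its indicator just after the point minus the value just before, along the
first axis, and sum the jumps over an orbit [x + G] of the group [G] of the
internal projections.  For generic [x] the sum is finite, because a jump needs
a hyperplane orthogonal to the first axis and because the first coordinate
leaves finitely many elements of [G] in a ball; it is invariant under [G] and
additive over partitions up to null sets ([orbit_sum_partition]).  If the
first coordinate of [x] is 0, the orbit meets the face [y_0 = 0] of [W], but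
neither the face [y_0 = 1] of [W] nor the one of [W'], since 1 is odd.  The
sum is therefore positive for [W] and nonpositive for [W']
([not_equidecomposable]). *)

Set Implicit Arguments.
Unset Strict Implicit.
Unset Printing Implicit Defensive.

Import Order.TTheory GRing.Theory Num.Theory.
Import numFieldNormedType.Exports.

(** * Matchings of locally finite graphs *)

Section Hall.
Local Open Scope fset_scope.
Variables (T : countType) (S : pred T).
Implicit Types (N : T -> {fset T}) (A B : {fset T}).

Definition nbhd N A : {fset T} := \bigcup_(x <- A) N x.

Definition hall N : Prop :=
  forall A, (forall x, x \in A -> S x) -> (#|` A| <= #|` nbhd N A|)%N.

Lemma in_nbhd N A y : reflect (exists2 x, x \in A & y \in N x) (y \in nbhd N A).
Proof.
apply: (iffP (bigfcupP _ _ _ _)) => [[x /andP[xA _] yx]|[x xA yx]]; exists x => //.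
by rewrite xA.
Qed.

Definition remove_nbr N (u x v : T) : {fset T} := if v == u then N u `\ x else N v.

(** If both removals failed, there would be two deficient sets [B] and [C], none
of which contains [u].  Counting the neighbours of [u |` (B `|` C)] and of
[B `&` C] then contradicts the condition for [N]: this is the submodularity
argument of Rado. *)
Lemma hall_remove N u x y : hall N -> S u -> x \in N u -> y \in N u -> x != y ->
  hall (remove_nbr N u x) \/ hall (remove_nbr N u y).
Proof.
move=> hN Su xu yu xy.
(* A set that violates the condition once [z] is removed contains [u]. *)
have deficient z : z \in N u -> ~ hall (remove_nbr N u z) ->
    exists B : {fset T}, [/\ (forall v, v \in B -> S v), u \notin B &
      (#|` nbhd N B `|` (N u `\ z)| <= #|` B|)%N].
  move=> zu /existsNP[A /not_implyP[AS /negP]]; rewrite -ltnNge => lt.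
  have uA : u \in A.
    apply: contraLR lt => uA; rewrite -leqNgt.
    suff -> : nbhd (remove_nbr N u z) A = nbhd N A by exact: hN.
    have same v : v \in A -> remove_nbr N u z v = N v.
      by move=> vA; rewrite /remove_nbr ifN //; apply: contraNneq uA => <-.
    by apply/fsetP => t; apply/in_nbhd/in_nbhd => -[v vA];
      rewrite ?same // => tv; exists v; rewrite ?same.
  exists (A `\ u); split.
  - by move=> v; rewrite in_fsetD1 => /andP[_ /AS].
  - by rewrite in_fsetD1 eqxx.
  - move: lt; rewrite (cardfsD1 u A) uA add1n ltnS; apply: leq_trans.
    apply: fsubset_leq_card; apply/fsubsetP => t.
    rewrite in_fsetU => /orP[/in_nbhd[v]|tz].
      rewrite in_fsetD1 => /andP[vu vA] tv.
      by apply/in_nbhd; exists v => //; rewrite /remove_nbr (negbTE vu).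
    by apply/in_nbhd; exists u => //; rewrite /remove_nbr eqxx.
have [|/(deficient x xu)[B [BS uB Bx]]] := pselect (hall (remove_nbr N u x)).
  by left.
have [|/(deficient y yu)[C [CS uC Cy]]] := pselect (hall (remove_nbr N u y)).
  by right.
exfalso.
have hU : (#|` u |` (B `|` C)| <= #|` (nbhd N B `|` (N u `\ x)) `|` (nbhd N C `|` (N u `\ y))|)%N.
  apply: (leq_trans (hN (u |` (B `|` C)) _)).
    by move=> v; rewrite in_fset1U in_fsetU => /or3P[/eqP-> | /BS | /CS].
  apply: fsubset_leq_card; apply/fsubsetP => t /in_nbhd[v].
  rewrite in_fset1U in_fsetU => /or3P[/eqP-> tu|vB tv|vC tv].
  - rewrite !(in_fsetU, in_fsetD1) tu !andbT.
    by have [->|] := eqVneq t x; rewrite ?xy ?orbT.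
  - by rewrite !in_fsetU; apply/orP; left; apply/orP; left; apply/in_nbhd; exists v.
  - by rewrite !in_fsetU; apply/orP; right; apply/orP; left; apply/in_nbhd; exists v.
have hI : (#|` B `&` C| <= #|` (nbhd N B `|` (N u `\ x)) `&` (nbhd N C `|` (N u `\ y))|)%N.
  apply: (leq_trans (hN (B `&` C) _)).
    by move=> v; rewrite in_fsetI => /andP[/BS].
  apply: fsubset_leq_card; apply/fsubsetP => t /in_nbhd[v].
  rewrite in_fsetI => /andP[vB vC] tv; rewrite in_fsetI !in_fsetU.
  by apply/andP; split; apply/orP; left; apply/in_nbhd; exists v.
have := leq_add hU hI; rewrite cardfsUI cardfsU1 in_fsetU negb_or uB uC /=.
rewrite -addnA cardfsUI => h; have := leq_trans h (leq_add Bx Cy).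
by rewrite add1n ltnn.
Qed.

Lemma hall_shrink N u : hall N -> S u ->
  exists N', [/\ hall N', (forall v, N' v `<=` N v) & exists z, N' u = [fset z]].
Proof.
have [n] := ubnP #|` N u|; elim: n N => // n IH N le_n hN Su.
have N1 : (0 < #|` N u|)%N.
  have := hN [fset u] _; rewrite cardfs1 /nbhd big_seq_fset1; apply.
  by move=> x /fset1P ->.
have [/cardfs1P[z Nu]|N2] := boolP (#|` N u| == 1%N); first by exists N; split=> //; exists z.
have [x xu] : exists x, x \in N u by apply/fset0Pn; rewrite -cardfs_gt0.
have [y] : exists y, y \in N u `\ x.
  by apply/fset0Pn; rewrite -cardfs_gt0; move: N1 N2; rewrite (cardfsD1 x) xu; lia.
rewrite in_fsetD1 => /andP[yx yu].
have small z : z \in N u -> (#|` remove_nbr N u z u| < n)%N.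
  by rewrite /remove_nbr eqxx => zu; move: le_n; rewrite (cardfsD1 z) zu.
have sub z v : remove_nbr N u z v `<=` N v.
  by rewrite /remove_nbr; case: eqP => [->|_]; rewrite ?fsubD1set.
have [H|H] : hall (remove_nbr N u y) \/ hall (remove_nbr N u x).
- exact: hall_remove.
- have [N' [h1 h2 h3]] := IH _ (small y yu) H Su.
  by exists N'; split=> // v; apply: fsubset_trans (h2 v) (sub y v).
- have [N' [h1 h2 h3]] := IH _ (small x xu) H Su.
  by exists N'; split=> // v; apply: fsubset_trans (h2 v) (sub x v).
Qed.

(** Hall's theorem for countably many vertices with finite neighbourhoods.
Following an enumeration of the vertices, each neighbourhood is shrunk in turn
to a single point, which keeps Hall's condition; the condition for pairs makes
these points distinct. *)
Lemma hall_injection N : hall N ->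
  exists f : T -> T, (forall u, S u -> f u \in N u) /\ {in S &, injective f}.
Proof.
move=> hN.
have /choice[sh shP] : forall Mu : (T -> {fset T}) * T,
    exists N', hall Mu.1 -> S Mu.2 ->
    [/\ hall N', (forall v, N' v `<=` Mu.1 v) & exists z, N' Mu.2 = [fset z]].
  move=> -[M u] /=.
  have [[hM Su]|nh] := pselect (hall M /\ S u).
    by have [N' ?] := hall_shrink hM Su; exists N'.
  by exists M => hM Su; case: nh.
pose Ns := fix Ns i := if i is j.+1 then
    (if choice.unpickle j is Some u then (if S u then sh (Ns j, u) else Ns j) else Ns j)
  else N.
have hNs i : hall (Ns i) /\ (forall v, Ns i.+1 v `<=` Ns i v).
  elim: i => [|i [IH IHs]].
    split=> // v; rewrite /=; case: choice.unpickle => // u; case: ifP => // Su.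
    by have [_] := shP (N, u) hN Su.
  have hi : hall (Ns i.+1).
    rewrite /=; case: choice.unpickle => // u; case: ifP => // Su.
    by have [] := shP (Ns i, u) IH Su.
  split=> // v; rewrite [Ns i.+2]/=; case: choice.unpickle => // u; case: ifP => // Su.
  by have [_] := shP (Ns i.+1, u) hi Su.
have Nsub i j v : (i <= j)%N -> Ns j v `<=` Ns i v.
  move=> /subnK <-; elim: (j - i)%N => // d IH.
  by rewrite addSn; apply: fsubset_trans IH; case: (hNs (d + i)%N).
have /choice[f fP] : forall u, exists z, S u -> Ns (choice.pickle u).+1 u = [fset z].
  move=> u; case: (boolP (S u)) => Su; last by exists u.
  have [_ _ [z zE]] := shP (Ns (choice.pickle u), u) (hNs (choice.pickle u)).1 Su.
  by exists z => _; rewrite /= choice.pickleK Su.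
have fix_f u j : S u -> (choice.pickle u < j)%N -> Ns j u = [fset f u].
  move=> Su lt; have := Nsub _ _ u lt; rewrite fP // fsubset1 => /orP[/eqP //|/eqP N0].
  have := (hNs j).1 [fset u] _; rewrite cardfs1 /nbhd big_seq_fset1 N0 cardfs0.
  by move=> H; suff: (1 <= 0)%N by []; apply: H => x /fset1P ->.
exists f; split=> [u Su|u v Su Sv fuv].
  have := Nsub 0%N (choice.pickle u).+1 u isT; rewrite fP // => /fsubsetP; apply.
  exact: fset11.
apply/eqP; apply: contraT => uv.
set j := (maxn (choice.pickle u) (choice.pickle v)).+1.
have := (hNs j).1 [fset u; v] _; rewrite cardfs2 uv /nbhd.
have -> : \bigcup_(x <- [fset u; v]) Ns j x = [fset f u].
  apply/fsetP => t; apply/bigfcupP/fset1P => [[x /andP[]]|->].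
    rewrite !inE => /orP[] /eqP-> _; rewrite fix_f ?ltnS ?leq_maxl ?leq_maxr //.
      by move=> /fset1P.
    by rewrite fuv => /fset1P.
  by exists u; rewrite ?fset21 // fix_f ?fset11 // ltnS leq_maxl.
rewrite cardfs1 => H; suff: (2 <= 1)%N by []; apply: H => x.
by rewrite !inE => /orP[] /eqP->.
Qed.
End Hall.

(** The bijection is made of values of [f] and of preimages by [g], so that it
inherits any bound on the displacements of [f] and [g]. *)
Lemma schroeder_bernstein_tracked (T : Type) (A B : set T) (f g : T -> T) :
  (forall x, A x -> B (f x)) -> set_inj A f ->
  (forall x, B x -> A (g x)) -> set_inj B g ->
  exists h, set_bij A B h /\
    forall x, A x -> h x = f x \/ (B (h x) /\ g (h x) = x).
Proof.
move=> fAB fI gBA gI.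
pose C := fix C n : set T := if n is m.+1 then [set g (f x) | x in C m]%classic
  else [set x | A x /\ ~ exists2 y, B y & g y = x]%classic.
pose D x := exists n, C n x.
have CA n x : C n x -> A x.
  elim: n x => [|n IH] x /=; first by case.
  by case=> y /IH Ay <-; apply/gBA/fAB.
(* [D] is the set of the forward iterates by [g \o f] of the points of [A]
   out of the image of [g]. *)
have /choice[h hP] : forall x, exists y,
    (A x -> D x -> y = f x) /\ (A x -> ~ D x -> B y /\ g y = x).
  move=> x; have [Dx|nDx] := pselect (D x).
    by exists (f x); split.
  have [[y By gy]|no] := pselect (exists2 y, B y & g y = x).
    by exists y; split.
  by exists x; split=> // Ax _; case: nDx; exists 0.
exists h; split; last first.
  move=> x Ax; have [Dx|nDx] := pselect (D x).
    by left; exact: (hP x).1.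
  by right; exact: (hP x).2.
split.
- move=> x Ax; have [Dx|nDx] := pselect (D x).
    by rewrite (hP x).1 //; exact: fAB.
  by have [] := (hP x).2 Ax nDx.
- have cross x y : A x -> A y -> D x -> ~ D y -> h x <> h y.
    move=> Ax Ay Dx nDy; rewrite (hP x).1 // => E.
    have [_] := (hP y).2 Ay nDy; rewrite -E => gf; apply: nDy.
    by case: Dx => n Cx; exists n.+1; exists x.
  move=> x y /set_mem Ax /set_mem Ay E.
  have [Dx|nDx] := pselect (D x); have [Dy|nDy] := pselect (D y).
  + by apply: fI; rewrite ?inE // -(hP x).1 // -(hP y).1.
  + by case: (cross x y).
  + by case: (cross y x).
  + by rewrite -((hP x).2 Ax nDx).2 -((hP y).2 Ay nDy).2 E.
- move=> y By; have Ag := gBA y By.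
  have [Dg|nDg] := pselect (D (g y)).
    case: Dg => -[|n] /=.
      by case=> _ []; exists y.
    case=> x Cx gE; exists x; first exact: CA Cx.
    rewrite (hP x).1; [|exact: CA Cx|by exists n].
    by apply: gI; rewrite ?inE //; apply: fAB; exact: CA Cx.
  exists (g y) => //; have [Bh gh] := (hP (g y)).2 Ag nDg.
  by apply: gI; rewrite ?inE.
Qed.

(** * The cubic ring and its norm form *)

Local Open Scope ring_scope.

(** The two bounds are all that is used about the size of [e]; they place [e^4]
between 1/64 and 1/16. *)
Lemma exists_cubic_unit (R : realType) :
  exists e : R, 2 / 5 < e < 1 / 2 /\ e ^+ 3 = 1 - 2 * e.
Proof.
pose p : {poly R} := 'X^3 + 2%:P * 'X - 1.
have pE x : p.[x] = x ^+ 3 + 2 * x - 1 by rewrite /p !hornerE.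
have le25 : (2 / 5 : R) <= 1 / 2 by lra.
have [|e /andP[e1 e2] /rootP e0] := @poly_ivt R p _ _ le25.
  by rewrite !pE; apply/andP; split; lra.
move: e0; rewrite pE => e0; exists e; split; last by lra.
rewrite !lt_neqAle e1 e2 !andbT; apply/andP; split; apply/eqP => he.
- by rewrite -he in e0; lra.
- by rewrite he in e0; lra.
Qed.

Notation pt := (int * int * int)%type.
Notation site := (int * int)%type.

(** The norm form of Z[e]: the determinant of the multiplication by
[x + y e + z e^2]. *)
Definition nform (T : pzRingType) (x y z : T) : T :=
  x * ((x - 2 * z) ^+ 2 - y * (z - 2 * y))
  - z * (y * (x - 2 * z) - z * (z - 2 * y))
  + y * (y * y - z * (x - 2 * z)).

Lemma nform_morph (A B : pzRingType) (f : {rmorphism A -> B}) x y z :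
  f (nform x y z) = nform (f x) (f y) (f z).
Proof. by rewrite /nform !(rmorphB, rmorphD, rmorphM, rmorphXn, rmorph_nat). Qed.

Section CubicRing.
Variables (R : realType) (e : R).
Hypotheses (e_gt : 2 / 5 < e) (e_lt : e < 1 / 2) (eE : e ^+ 3 = 1 - 2 * e).

Definition yval (v : pt) : R := v.1.1%:~R + e * v.1.2%:~R + e ^+ 2 * v.2%:~R.
(** Multiplication by [e] in the basis [1, e, e^2]. *)
Definition mule (v : pt) : pt := (v.2, v.1.1 - 2 * v.2, v.1.2).
Definition sgn_pt (v : pt) : R := (-1) ^ (v.1.1 + v.1.2 + v.2).
(** Four times the squared modulus of the complex conjugates of [yval v]. *)
Definition qform (v : pt) : R :=
  (2 * v.1.1%:~R - e * v.1.2%:~R - (e ^+ 2 + 4) * v.2%:~R) ^+ 2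
  + (8 + 3 * e ^+ 2) * (v.1.2%:~R - e * v.2%:~R) ^+ 2.

Lemma yvalD v w : yval (v + w) = yval v + yval w.
Proof. by rewrite /yval /= !intrD; ring. Qed.

Lemma yvalB v w : yval (v - w) = yval v - yval w.
Proof. by rewrite /yval /= !intrD !intrN; ring. Qed.

Lemma yval_mule v : yval (mule v) = e * yval v.
Proof. by rewrite /yval /= intrB intrM; ring: eE. Qed.

Lemma yval_iter_mule k v : yval (iter k mule v) = e ^+ k * yval v.
Proof. by elim: k => [|k IH]; rewrite ?mul1r //= yval_mule IH exprS mulrA. Qed.

(** The complex conjugates of [e] have squared modulus [1 / e]. *)
Lemma qform_mule v : e * qform (mule v) = qform v.
Proof. by rewrite /qform /= intrB intrM; ring: eE. Qed.

Lemma sgn_ptD v w : sgn_pt (v + w) = sgn_pt v * sgn_pt w.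
Proof.
rewrite /sgn_pt -expfzDr ?oppr_eq0 ?oner_eq0 //; congr (_ ^ _).
by rewrite /=; ring.
Qed.

Lemma sqr_sgn v : sgn_pt v * sgn_pt v = 1.
Proof.
rewrite /sgn_pt -expfzMl mulrNN mulr1 exp1rz //.
Qed.

(** Modulo 2 the equation of [e] reads [e^3 = 1], so that multiplication by [e]
permutes the coordinates cyclically and preserves the parity of their sum. *)
Lemma sgn_mule v : sgn_pt (mule v) = sgn_pt v.
Proof.
have H : (-1 : R) ^ (v.2 + v.2) = 1.
  by rewrite expfzDr ?oppr_eq0 ?oner_eq0 // -expfzMl mulrNN mulr1 exp1rz.
rewrite /sgn_pt /= -[LHS]mulr1 -[X in _ * X = _]H.
by rewrite -expfzDr ?oppr_eq0 ?oner_eq0 //; congr (_ ^ _); ring.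
Qed.

Lemma sgn_iter_mule k v : sgn_pt (iter k mule v) = sgn_pt v.
Proof. by elim: k => //= k IH; rewrite sgn_mule. Qed.

(** The norm is the product of the real value and of the two complex
conjugates. *)
Lemma nform_yq v : 4 * (nform v.1.1 v.1.2 v.2)%:~R = yval v * qform v.
Proof.
rewrite (nform_morph (intr : {rmorphism int -> R})) /nform /yval /qform.
ring: eE.
Qed.

End CubicRing.

(** The polynomial [x^3 + 2 x - 1] has no root modulo 3, so that the reduction
of Z[e] is the field with 27 elements. *)
Lemma nform_F3_eq0 (x y z : 'F_3) :
  nform x y z = 0 -> [/\ x = 0, y = 0 & z = 0].
Proof.
case: x => [[|[|[|//]]] ?]; case: y => [[|[|[|//]]] ?];
  case: z => [[|[|[|//]]] ?] => /(congr1 (@nat_of_ord _)) nf0;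
  try by exfalso; vm_compute in nf0.
by split; apply: val_inj.
Qed.

Lemma intr_F3_eq0 (x : int) : (x%:~R : 'F_3) = 0 -> exists y, x = 3 * y.
Proof.
move/eqP; rewrite -(@dvdz_pcharf 'F_3 3) ?pchar_Fp // => /dvdzP[y ->].
by exists y; rewrite mulrC.
Qed.

(** Infinite descent: modulo 3 the norm form has no nontrivial zero. *)
Lemma nform_eq0 (x y z : int) : nform x y z = 0 -> [/\ x = 0, y = 0 & z = 0].
Proof.
have [n] := ubnP (`|x| + `|y| + `|z|)%N.
elim: n x y z => // n IH x y z le_n nf0.
have := congr1 (intr : int -> 'F_3) nf0.
rewrite [LHS](nform_morph (intr : {rmorphism int -> 'F_3})) => /nform_F3_eq0.
case=> /intr_F3_eq0[x' xE] /intr_F3_eq0[y' yE] /intr_F3_eq0[z' zE].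
subst x y z.
have nf' : nform x' y' z' = 0.
  move: nf0; rewrite /nform.
  have -> : forall a b c : int, 3 * a * ((3 * a - 2 * (3 * c)) ^+ 2 -
     3 * b * (3 * c - 2 * (3 * b))) -
     3 * c * (3 * b * (3 * a - 2 * (3 * c)) - 3 * c * (3 * c - 2 * (3 * b))) +
     3 * b * (3 * b * (3 * b) - 3 * c * (3 * a - 2 * (3 * c))) = 27 * nform a b c.
    by move=> a b c; rewrite /nform; ring.
  by move/eqP; rewrite mulf_eq0 /= => /eqP.
have [/eqP|nz] := boolP ((x' == 0) && (y' == 0) && (z' == 0)).
  by move=> /eqP /andP[/andP[/eqP-> /eqP->] /eqP->]; rewrite !mulr0.
have [||-> -> ->] := IH x' y' z'; rewrite ?mulr0 //.
by move: nz le_n; clear; lia.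
Qed.

(** * Separation of the elements of small value *)

Section Separation.
Variables (R : realType) (e : R).
Hypotheses (e_gt : 2 / 5 < e) (e_lt : e < 1 / 2) (eE : e ^+ 3 = 1 - 2 * e).

Lemma qform_ge0 v : 0 <= qform e v.
Proof.
rewrite /qform addr_ge0 ?sqr_ge0 //; apply: mulr_ge0; rewrite ?sqr_ge0 //.
by have := sqr_ge0 e; lra.
Qed.

(** The norm of a nonzero element is a nonzero integer. *)
Lemma yval_qform_ge4 v : v != 0 -> 4 <= `|yval e v| * qform e v.
Proof.
move=> vN0; rewrite -[qform e v]ger0_norm ?qform_ge0 // -normrM -(nform_yq eE).
rewrite normrM (ger0_norm (_ : 0 <= 4)) // -[leLHS]mulr1 ler_pM2l //.
rewrite -intr_norm ler1z; have : nform v.1.1 v.1.2 v.2 != 0; last by case: (nform _ _ _) => [[|?]|?] //=; lia.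
apply: contra vN0 => /eqP /nform_eq0 [].
by move: v => [[a b] c] /= -> -> ->.
Qed.

Lemma yval_eq0 v : yval e v = 0 -> v = 0.
Proof.
move=> yv0; apply/eqP; apply: contraT => /yval_qform_ge4.
by rewrite yv0 normr0 mul0r lern0.
Qed.

Lemma yval_inj : injective (yval e).
Proof.
move=> v w yvw; apply/eqP; rewrite -subr_eq0; apply/eqP/yval_eq0.
by rewrite yvalB yvw subrr.
Qed.

Lemma e_gt0 : 0 < e. Proof. by move: e_gt; lra. Qed.

Lemma e2_bounds : 0 < e ^+ 2 < 1 / 4.
Proof.
have [e0 eg el] := And3 e_gt0 e_gt e_lt; move: e_lt; clear -e0 => e1; apply/andP; split; nra.
Qed.

(** Eliminating the first coordinate, the two linear forms of [qform] are
combinations of the value and of the two site coordinates. *)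
Lemma qform_le (v : pt) (r : R) : 1 <= r -> `|yval e v| <= 1 ->
  `|v.1.2%:~R| <= r -> `|v.2%:~R| <= r -> qform e v <= 90 * r ^+ 2.
Proof.
move=> r1 yv v1 v2; have /andP[e2p e2l] := e2_bounds; have [e0 eg el] := And3 e_gt0 e_gt e_lt.
have -> : qform e v = (2 * yval e v - 3 * e * v.1.2%:~R
    - (3 * e ^+ 2 + 4) * v.2%:~R) ^+ 2
    + (8 + 3 * e ^+ 2) * (v.1.2%:~R - e * v.2%:~R) ^+ 2.
  by rewrite /qform /yval; ring.
move: (yval e v) (v.1.2%:~R : R) (v.2%:~R : R) yv v1 v2 => y a b.
move=> yv v1 v2.
have H1 : `|2 * y - 3 * e * a - (3 * e ^+ 2 + 4) * b| <= 825 / 100 * r.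
  apply: (le_trans (ler_normB _ _)); rewrite normrM.
  have E2 : `|3 * e ^+ 2 + 4| <= 19 / 4 by rewrite ger0_norm; lra.
  have E1 : `|3 * e| <= 3 / 2 by rewrite ger0_norm; lra.
  have := ler_normB (2 * y) (3 * e * a); rewrite !(normrM 2) (normrM (3 * e)).
  rewrite (ger0_norm (_ : 0 <= 2)) //.
  have := ler_pM (normr_ge0 _) (normr_ge0 _) E2 v2.
  have := ler_pM (normr_ge0 _) (normr_ge0 _) E1 v1.
  by lra.
have H2 : `|a - e * b| <= 3 / 2 * r.
  apply: (le_trans (ler_normB _ _)); rewrite normrM.
  have E1 : `|e| <= 1 / 2 by rewrite ger0_norm; lra.
  have := ler_pM (normr_ge0 _) (normr_ge0 _) E1 v2; lra.
have G1 := lerXn2r 2 (normr_ge0 _) (le_trans (normr_ge0 _) H1) H1.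
have G2 := lerXn2r 2 (normr_ge0 _) (le_trans (normr_ge0 _) H2) H2.
rewrite !real_normK ?num_real // in G1 G2.
have G3 : (8 + 3 * e ^+ 2) * (a - e * b) ^+ 2 <= 9 * (3 / 2 * r) ^+ 2.
  by apply: ler_pM => //; rewrite ?sqr_ge0 //; lra.
have : 0 <= r ^+ 2 by rewrite sqr_ge0.
move: G1 G3; rewrite !exprMn; lra.
Qed.

(** The site coordinates are combinations of the value and of the two linear forms
of [qform]. *)
Lemma coord_le_qform (v : pt) (s : R) : 1 <= s -> `|yval e v| <= 1 ->
  qform e v <= s ^+ 2 -> `|v.1.2%:~R| <= s /\ `|v.2%:~R| <= s.
Proof.
move=> s1 yv qs; have /andP[e2p e2l] := e2_bounds; have [e0 eg el] := And3 e_gt0 e_gt e_lt.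
move: qs; rewrite /qform; set U := (X in X ^+ 2 + _); set u := v.1.2%:~R - e * v.2%:~R.
move=> qs.
have v2E : (3 * e ^+ 2 + 2) * v.2%:~R = yval e v - U / 2 - 3 / 2 * e * u.
  by rewrite /yval /U /u; field.
have v1E : v.1.2%:~R = u + e * v.2%:~R by rewrite /u; ring.
move: (v.1.2%:~R : R) (v.2%:~R : R) v1E v2E qs => a b v1E v2E qs.
clearbody U u.
have u2 : 0 <= u ^+ 2 by rewrite sqr_ge0.
have U2 : 0 <= U ^+ 2 by rewrite sqr_ge0.
have e2u : 0 <= e ^+ 2 * u ^+ 2 by rewrite mulr_ge0 // ltW.
have s0 : 0 <= s by lra.
have Us : `|U| <= s.
  rewrite -(@ler_pXn2r _ 2) ?nnegrE // real_normK ?num_real //; lra.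
have us : `|u| <= s / 2.
  rewrite -(@ler_pXn2r _ 2) ?nnegrE ?divr_ge0 // real_normK ?num_real // expr_div_n; lra.
have v2s : `|b| <= s.
  move: yv Us us; rewrite !ler_norml => /andP[? ?] /andP[? ?] /andP[? ?].
  by apply/andP; split; nra.
split=> //; rewrite v1E.
move: v2s us; rewrite !ler_norml => /andP[? ?] /andP[? ?].
by apply/andP; split; nra.
Qed.

Lemma qform_iter_mule j v : e ^+ j * qform e (iter j mule v) = qform e v.
Proof.
elim: j => [|j IH]; first by rewrite mul1r.
by rewrite /= exprSr -mulrA qform_mule.
Qed.

Lemma e4_bounds : 1 / 64 < e ^+ 4 < 1 / 16.
Proof.
have /andP[p l] := e2_bounds; have [e0 eg el] := And3 e_gt0 e_gt e_lt.
have g : 4 / 25 < e ^+ 2 by rewrite expr2; nra.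
have -> : e ^+ 4 = e ^+ 2 * e ^+ 2 by ring.
by apply/andP; split; nra.
Qed.

(** Multiplication by [e^(4k)] expands the conjugates by a factor
[e^(-2k) < 8^k] while it shrinks the value. *)
Lemma iter_mule_coord (v : pt) (k : nat) (c : R) :
  1 <= c -> `|yval e v| <= 1 -> qform e v <= c ^+ 2 ->
  let w := iter (4 * k) mule v in
  `|w.1.2%:~R| <= c * 8 ^+ k /\ `|w.2%:~R| <= c * 8 ^+ k.
Proof.
move=> c1 yv qv w; have [e0 eg el] := And3 e_gt0 e_gt e_lt; have /andP[l4 u4] := e4_bounds.
have e1 : e <= 1 by move: e_lt; lra.
have k8 : (1 : R) <= 8 ^+ k by rewrite exprn_ege1 // ler1n.
apply: coord_le_qform.
- by rewrite -[leLHS]mulr1 ler_pM.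
- rewrite yval_iter_mule // normrM ger0_norm ?exprn_ge0 ?(ltW e0) //.
  rewrite mulr_ile1 ?exprn_ge0 ?exprn_ile1 ?normr_ge0 ?(ltW e0) //.
have := qform_iter_mule (4 * k) v; rewrite -/w => qE.
have h : 1 <= e ^+ (4 * k) * 64 ^+ k.
  by rewrite exprM -exprMn exprn_ege1 //; lra.
rewrite exprMn -exprM mulnC exprM.
have -> : (8 : R) ^+ 2 = 64 by rewrite -natrX.
have q0 := qform_ge0 w.
apply: (@le_trans _ _ (qform e v * 64 ^+ k)).
  by rewrite -qE mulrAC ler_peMl.
by rewrite ler_wpM2r // exprn_ge0.
Qed.

(** The difference of two elements of the strip [0 <= y < e^(4k)] has value less
than [e^(4k) <= 16^-k]; if it does not vanish, its norm is at least 1 and its conjugates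
are at least of order [4^k]. *)
Lemma strip_separation (v : pt) (k : nat) : `|yval e v| < e ^+ (4 * k) ->
  (16 * `|v.1.2| < 4 ^+ k)%R -> (16 * `|v.2| < 4 ^+ k)%R -> v = 0.
Proof.
move=> yv v1 v2; have [e0 eg el] := And3 e_gt0 e_gt e_lt; have /andP[l4 u4] := e4_bounds.
have e1 : e <= 1 by move: e_lt; lra.
have yv1 : `|yval e v| < 1.
  by apply: lt_le_trans yv _; rewrite exprn_ile1 // (ltW e0).
apply/eqP; apply: contraT => vN0; have := yval_qform_ge4 vN0.
(* The estimate of the norm needs [4 ^ k >= 16]; for smaller [k] the two site
   coordinates vanish. *)
have [k1|k2] := leqP k 1.
  have p4 : (4 : int) ^+ k <= 4 by rewrite -[leRHS]expr1 ler_eXn2l.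
  have v10 : v.1.2 = 0 by move: v1 p4; clear; lia.
  have v20 : v.2 = 0 by move: v2 p4; clear; lia.
  move: v10 v20 vN0 yv1; case: v {yv v1 v2} => [[a b] c] /= -> ->.
  rewrite /yval /= !mulr0z !mulr0 !addr0 -intr_norm ltrz1 => /eqP nz a1 _.
  by exfalso; apply: nz; have -> : a = 0 by move: a1; clear; lia.
have r1 : 1 <= (4 ^+ k / 16 : R).
  have : (4 : R) ^+ 2 <= 4 ^+ k by rewrite ler_eXn2l ?ltr1n.
  by rewrite expr2; lra.
have toR (x : int) : 16 * `|x| < 4 ^+ k -> `|x%:~R| <= (4 ^+ k / 16 : R).
  move=> /ltW; rewrite -(ler_int R) intrM rmorphXn /= intr_norm; lra.
have := qform_le r1 (ltW yv1) (toR _ v1) (toR _ v2).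
have : e ^+ (4 * k) * 16 ^+ k <= 1.
  by rewrite exprM -exprMn exprn_ile1 ?mulr_ge0 ?exprn_ge0 ?(ltW e0) //; lra.
have -> : (4 ^+ k / 16 : R) ^+ 2 = 16 ^+ k / 256.
  by rewrite expr_div_n -exprM mulnC exprM -!natrX.
have := qform_ge0 v; have : (0 : R) <= 16 ^+ k by rewrite exprn_ge0.
move: yv; have := normr_ge0 (yval e v).
move: (`|yval e v|) (e ^+ _) (16 ^+ k) (qform e v) => y E S q *.
have : y * q <= E * q by rewrite ler_wpM2r // ltW.
have : E * q <= E * (90 * (S / 256)) by rewrite ler_wpM2l //; lra.
by lra.
Qed.

End Separation.

(** * Sites, levels and the parity-reversing exchange *)

Lemma pow_int_nat (b k : nat) : (b%:Z ^+ k) = (b ^ k)%N%:Z.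
Proof. by elim: k => // k IH; rewrite exprS IH expnS PoszM. Qed.

Definition site_of (v : pt) : site := (v.1.2, v.2).

Lemma site_ofD v w : site_of (v + w) = site_of v + site_of w.
Proof. by []. Qed.

Section Sites.
Variables (R : realType) (e : R).
Hypotheses (e_gt : 2 / 5 < e) (e_lt : e < 1 / 2) (eE : e ^+ 3 = 1 - 2 * e).

(** The only element of Z[e] over the site [s] whose value lies in [0, 1). *)
Definition lift_pt (s : site) : pt :=
  (- Num.floor (e * s.1%:~R + e ^+ 2 * s.2%:~R), s.1, s.2).
Definition ysite (s : site) : R := yval e (lift_pt s).
Definition sgn (s : site) : R := sgn_pt R (lift_pt s).

Lemma ysite_itv s : 0 <= ysite s < 1.
Proof.
rewrite /ysite /yval /= intrN -addrA.
have /andP[] := floor_itv (e * s.1%:~R + e ^+ 2 * s.2%:~R).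
by rewrite intrD => *; apply/andP; split; lra.
Qed.

Lemma lift_pt_unique (v : pt) : 0 <= yval e v < 1 -> lift_pt (site_of v) = v.
Proof.
case: v => [[a b] c]; rewrite /lift_pt /yval /site_of /= => /andP[H1 H2].
rewrite (@floor_def _ _ (- a)) ?opprK // intrD intrN.
by apply/andP; split; lra.
Qed.

Lemma lift_ptD s w : 0 <= ysite s + yval e w < 1 ->
  lift_pt (s + site_of w) = lift_pt s + w.
Proof.
rewrite /ysite -yvalD => /lift_pt_unique <-; congr lift_pt.
Qed.

Lemma sgn_sqr s : sgn s * sgn s = 1.
Proof. exact: sqr_sgn. Qed.

Lemma norm_sgn s : `|sgn s| = 1.
Proof.
have /eqP := sgn_sqr s; rewrite -expr2 sqrf_eq1 => /orP[] /eqP ->.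
  by rewrite normr1.
by rewrite normrN1.
Qed.

Definition in_strip (k : nat) (s : site) : bool := ysite s < e ^+ (4 * k).
Definition in_level (k : nat) (s : site) : bool :=
  e ^+ (4 * k.+1) <= ysite s < e ^+ (4 * k).

(** The product of [e^(4k)] and of [e] or [e + e^4 - 1 = -1 + 2 e - 2 e^2], both of
which are odd. *)
Definition flip_vec (k : nat) (b : bool) : pt :=
  iter (4 * k) mule (if b then (0, 1, 0) else (-1, 2, -2)).

(** On the level [e^(4k+4) <= y < e^(4k)], of length [e^(4k) - e^(4k+4)], this is
the rotation by [e^(4k+1)]: an exchange of two intervals. *)
Definition flip (k : nat) (s : site) : site :=
  s + site_of (flip_vec k (ysite s + e ^+ (4 * k) * e < e ^+ (4 * k))).
Definition unflip (k : nat) (s : site) : site :=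
  s - site_of (flip_vec k (e ^+ (4 * k) * e + e ^+ (4 * k.+1) <= ysite s)).

Lemma yval_flip_vec k b : yval e (flip_vec k b) =
  e ^+ (4 * k) * e + (if b then 0 else e ^+ (4 * k.+1) - e ^+ (4 * k)).
Proof.
rewrite /flip_vec yval_iter_mule //.
have -> : (4 * k.+1 = 4 * k + 4)%N by lia.
rewrite exprD /yval; case: b => /=; last by ring: eE.
by rewrite mulr0z; ring.
Qed.

Lemma sgn_flip_vec k b : sgn_pt R (flip_vec k b) = -1.
Proof.
rewrite /flip_vec sgn_iter_mule /sgn_pt; case: b => /=.
  by rewrite !addr0 add0r expr1z.
by rewrite /exprz /=; rewrite invrN1.
Qed.

Lemma level_bounds k : [/\ 0 < e ^+ (4 * k), 0 < e ^+ (4 * k.+1),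
   e ^+ (4 * k) <= 1 & e ^+ (4 * k.+1) + e ^+ (4 * k) * e < e ^+ (4 * k)].
Proof.
have [e0 eg el] := And3 (e_gt0 e_gt) e_gt e_lt.
have /andP[l4 u4] := e4_bounds e_gt e_lt.
have k0 : 0 < e ^+ (4 * k) by rewrite exprn_gt0.
split=> //; first by rewrite exprn_gt0.
  by rewrite exprn_ile1 ?(ltW e0) //; lra.
have -> : (4 * k.+1 = 4 * k + 4)%N by lia.
rewrite exprD -mulrDr gtr_pMr //; lra.
Qed.

Lemma flip_lift k s : in_level k s ->
  lift_pt (flip k s) =
    lift_pt s + flip_vec k (ysite s + e ^+ (4 * k) * e < e ^+ (4 * k))
  /\ in_level k (flip k s) /\ unflip k (flip k s) = s.
Proof.
have [p0 q0 p1 pq] := level_bounds k; have e0 := e_gt0 e_gt.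
have pe0 : 0 < e ^+ (4 * k) * e by rewrite mulr_gt0.
rewrite /in_level => /andP[l u]; rewrite /flip.
set b := (X in flip_vec k X).
have yb := yval_flip_vec k b.
have rng : e ^+ (4 * k.+1) <= ysite s + yval e (flip_vec k b) < e ^+ (4 * k).
  by rewrite yb /b; case: (ltP (_ + _) _) => H; apply/andP; split; lra.
have L : lift_pt (s + site_of (flip_vec k b)) = lift_pt s + flip_vec k b.
  by apply: lift_ptD; move: rng => /andP[? ?]; apply/andP; split; lra.
have Y : ysite (s + site_of (flip_vec k b)) = ysite s + yval e (flip_vec k b).
  by rewrite /ysite L yvalD.
split=> //; rewrite /unflip Y; split=> //.
suff -> : (e ^+ (4 * k) * e + e ^+ (4 * k.+1) <= ysite s + yval e (flip_vec k b)) = b.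
  by rewrite addrK.
by rewrite yb /b; case: (ltP (_ + _) _) => H; apply/idP/negP; rewrite -?ltNge; lra.
Qed.

Lemma unflip_lift k s : in_level k s -> in_level k (unflip k s) /\ flip k (unflip k s) = s.
Proof.
have [p0 q0 p1 pq] := level_bounds k; have e0 := e_gt0 e_gt.
have pe0 : 0 < e ^+ (4 * k) * e by rewrite mulr_gt0.
rewrite /in_level => /andP[l u]; rewrite /unflip.
set b := (X in flip_vec k X).
have yb := yval_flip_vec k b.
have -> : - site_of (flip_vec k b) = site_of (- flip_vec k b) by [].
have yN : yval e (- flip_vec k b) = - yval e (flip_vec k b).
  by rewrite -[- flip_vec k b]add0r yvalB /yval /= !mulr0 !addr0 add0r.
have rng : e ^+ (4 * k.+1) <= ysite s - yval e (flip_vec k b) < e ^+ (4 * k).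
  by rewrite yb /b; case: (leP (_ + _) _) => H; apply/andP; split; lra.
have L : lift_pt (s + site_of (- flip_vec k b)) = lift_pt s - flip_vec k b.
  by apply: lift_ptD; rewrite yN; move: rng => /andP[? ?]; apply/andP; split; lra.
have Y : ysite (s + site_of (- flip_vec k b)) = ysite s - yval e (flip_vec k b).
  by rewrite /ysite L yvalB.
rewrite /flip Y; split=> //.
suff -> : (ysite s - yval e (flip_vec k b) + e ^+ (4 * k) * e < e ^+ (4 * k)) = b.
  by rewrite -addrA -site_ofD addNr addr0.
by rewrite yb /b; case: (leP (_ + _) _) => H; apply/idP/negP; rewrite -?leNgt; lra.
Qed.

Lemma sgn_flip k s : in_level k s -> sgn (flip k s) = - sgn s.
Proof.
by move=> /flip_lift[L _]; rewrite /sgn L sgn_ptD sgn_flip_vec mulrN1.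
Qed.

(** The translations of the exchange are images by [e^(4k)] of two fixed
elements, which satisfy [qform <= 11^2]. *)
Lemma flip_dist k s :
  `|(flip k s - s).1| <= 11 * 8 ^+ k /\ `|(flip k s - s).2| <= 11 * 8 ^+ k.
Proof.
rewrite /flip addrC addKr.
have [e0 eg el] := And3 (e_gt0 e_gt) e_gt e_lt.
have /andP[p2 u2] := e2_bounds e_gt e_lt.
move: (X in flip_vec k X) => b; rewrite /flip_vec.
pose v b : pt := if b then (0, 1, 0) else (-1, 2, -2); rewrite -/(v b).
have yv : `|yval e (v b)| <= 1.
  rewrite /yval; case: b => /=; rewrite ?mulr0z ler_norml; apply/andP; split; lra.
have qv : qform e (v b) <= 11 ^+ 2.
  clear yv; rewrite /qform; case: b => /=; rewrite ?mulr0z; nra.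
have [h1 h2] := iter_mule_coord e_gt e_lt eE k (ler1n _ 11) yv qv.
by split; rewrite -(ler_int R) intr_norm intrM rmorphXn.
Qed.

(** Pigeonhole: by separation, a square of side [4^k / 16] contains at most one
site of the strip, and a square of side of order [8^k] is covered by a number
of them of order [(8^k / 4^k)^2 = 4^k]. *)
Lemma strip_count (F : seq site) (p : site) (k c : nat) : uniq F -> (0 < c)%N ->
  (forall s, s \in F -> [/\ in_strip k s, `|(s - p).1| <= c%:Z * 8 ^+ k
     & `|(s - p).2| <= c%:Z * 8 ^+ k]) ->
  (size F <= (33 * c) ^ 2 * 4 ^ k)%N.
Proof.
move=> F_uniq c0 HF; set n8 := (8 ^ k)%N; set n4 := (4 ^ k)%N; set n2 := (2 ^ k)%N.
have n842 : n8 = (n4 * n2)%N by rewrite /n8 /n4 /n2 -expnMn.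
have n422 : n4 = (n2 * n2)%N by rewrite /n4 /n2 -expnMn.
have n4_gt0 : (0 < n4)%N by rewrite expn_gt0.
(* [u _ %/ n4] numbers the intervals of length [4^k / 16]. *)
pose u (z : int) := (16 * absz (z + (c * n8)%:Z)%R)%N.
have u_le z : `|z| <= c%:Z * 8 ^+ k -> (u z %/ n4 < 33 * c * n2)%N.
  rewrite pow_int_nat -/n8 -PoszM => zc.
  have : (u z <= 32 * (c * n8))%N by rewrite /u; move: zc; clear; lia.
  move=> /(leq_div2r n4); rewrite n842.
  have -> : (32 * (c * (n4 * n2)) = 32 * c * n2 * n4)%N by ring.
  rewrite mulnK //.
  have : (0 < c * n2)%N by rewrite muln_gt0 c0 expn_gt0.
  move: (c * n2)%N (mulnA 32 c n2) (mulnA 33 c n2) => d <- <-; lia.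
have u_eq z z' : `|z| <= c%:Z * 8 ^+ k -> `|z'| <= c%:Z * 8 ^+ k ->
    (u z %/ n4 = u z' %/ n4)%N -> 16 * `|z - z'| < 4 ^+ k.
  rewrite !pow_int_nat -/n8 -/n4 -PoszM => zc zc' E.
  have := divn_eq (u z) n4; have := divn_eq (u z') n4; rewrite E.
  have := ltn_pmod (u z) n4_gt0; have := ltn_pmod (u z') n4_gt0.
  by rewrite /u; move: zc zc'; clear; lia.
pose ka (s : site) := (divn (u (s - p).1) n4, divn (u (s - p).2) n4).
pose tgt := [seq (i, j) | i <- iota 0 (33 * c * n2), j <- iota 0 (33 * c * n2)].
have -> : ((33 * c) ^ 2 * 4 ^ k = size tgt)%N.
  by rewrite size_allpairs !size_iota -/n4 n422; ring.
rewrite -(size_map ka); apply: uniq_leq_size.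
  rewrite map_inj_in_uniq // => s s' sF s'F [E1 E2].
  have [i1 a1 a2] := HF s sF; have [i1' b1 b2] := HF s' s'F.
  have := u_eq _ _ a1 b1 E1; have := u_eq _ _ a2 b2 E2.
  have BE (q : site) : (s - q).1 - (s' - q).1 = (s - s').1.
    by rewrite /=; ring.
  have BE2 (q : site) : (s - q).2 - (s' - q).2 = (s - s').2.
    by rewrite /=; ring.
  rewrite BE BE2 => h2 h1.
  have y1 : `|yval e (lift_pt s - lift_pt s')| < e ^+ (4 * k).
    rewrite yvalB ltr_norml; move: i1 i1'; rewrite /in_strip /ysite.
    have := ysite_itv s; have := ysite_itv s'; rewrite /ysite.
    by move=> /andP[? ?] /andP[? ?] ? ?; apply/andP; split; lra.
  have /eqP := strip_separation e_gt e_lt eE y1 h1 h2.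
  rewrite subr_eq0 => /eqP /(congr1 site_of).
  by rewrite /site_of /=; case: (s) => ? ?; case: (s') => ? ?.
move=> _ /mapP[s sF ->]; have [_ a1 a2] := HF s sF.
by apply: allpairs_f; rewrite mem_iota add0n u_le.
Qed.
End Sites.

(** * A discrete Poincare inequality *)

Section BlockAverages.
Variable R : realType.

Lemma norm_sub_le_variation (f : nat -> R) (i j N : nat) : (i < N)%N -> (j < N)%N ->
  `|f i - f j| <= \sum_(t < N) `|f t.+1 - f t|.
Proof.
wlog le_ij : i j / (i <= j)%N => [H iN jN|].
  by case/orP: (leq_total i j) => ?; [|rewrite distrC]; apply: H.
move=> iN jN; rewrite distrC -(telescope_sumr _ le_ij).
apply: (le_trans (ler_norm_sum _ _ _)).
rewrite -(big_mkord xpredT (fun t => `|f t.+1 - f t|)).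
rewrite (@big_cat_nat _ _ _ i 0 N) //=; last exact: ltnW.
rewrite (@big_cat_nat _ _ _ j i N) //=; last exact: ltnW.
by rewrite addrCA lerDl addr_ge0 // sumr_ge0.
Qed.

Lemma sum_shift_le (h : nat -> R) (x n N : nat) : (forall t, 0 <= h t) ->
  (x + n <= N)%N -> \sum_(j < n) h (x + j)%N <= \sum_(t < N) h t.
Proof.
move=> h0 xnN.
rewrite -(big_mkord xpredT h) (@big_cat_nat _ _ _ x 0 N) //=; last first.
  exact: leq_trans (leq_addr _ _) xnN.
rewrite (@big_cat_nat _ _ _ (x + n) x N) ?leq_addr //=.
have -> : \sum_(x <= t < x + n) h t = \sum_(j < n) h (x + j)%N.
  rewrite -{1}[x]add0n big_addn addKn big_mkord.
  by apply: eq_bigr => j _; rewrite addnC.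
by rewrite addrCA lerDl addr_ge0 // sumr_ge0.
Qed.

(** Average the difference of the values over all pairs of points, joining the
two points of each pair by an L-shaped path: every row is used by at most
[n1 * n2^2] pairs and every column by at most [n1^2 * n2]. *)
Lemma block_average_sub (f : nat -> nat -> R) (x1 y1 n1 x2 y2 n2 N : nat) :
  (0 < n1)%N -> (0 < n2)%N ->
  (x1 + n1 <= N)%N -> (y1 + n1 <= N)%N -> (x2 + n2 <= N)%N -> (y2 + n2 <= N)%N ->
  `|(\sum_(p : 'I_n1 * 'I_n1) f (x1 + p.1)%N (y1 + p.2)%N) / n1%:R ^+ 2 -
    (\sum_(p : 'I_n2 * 'I_n2) f (x2 + p.1)%N (y2 + p.2)%N) / n2%:R ^+ 2| <=
  n1%:R^-1 * (\sum_(p : 'I_N * 'I_N) `|f p.1.+1 p.2 - f p.1 p.2|) +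
  n2%:R^-1 * (\sum_(p : 'I_N * 'I_N) `|f p.1 p.2.+1 - f p.1 p.2|).
Proof.
move=> n1_gt0 n2_gt0 x1N y1N x2N y2N.
pose h r := \sum_(t < N) `|f t.+1 r - f t r|.
pose v c := \sum_(t < N) `|f c t.+1 - f c t|.
have h0 r : 0 <= h r by rewrite sumr_ge0.
have v0 c : 0 <= v c by rewrite sumr_ge0.
have m1 : 0 < n1%:R :> R by rewrite ltr0n.
have m2 : 0 < n2%:R :> R by rewrite ltr0n.
have -> : \sum_(p : 'I_N * 'I_N) `|f p.1.+1 p.2 - f p.1 p.2| = \sum_(r < N) h r.
  rewrite -(pair_bigA _ (fun i j : 'I_N => `|f i.+1 j - f i j|)) /=.
  by rewrite exchange_big.
have -> : \sum_(p : 'I_N * 'I_N) `|f p.1 p.2.+1 - f p.1 p.2| = \sum_(c < N) v c.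
  by rewrite -(pair_bigA _ (fun i j : 'I_N => `|f i j.+1 - f i j|)) /=.
set S1 := \sum_p _; set S2 := \sum_p _.
set H := \sum_(r < N) h r; set V := \sum_(r < N) v r.
have key : `|n2%:R ^+ 2 * S1 - n1%:R ^+ 2 * S2| <=
    n2%:R ^+ 2 * (n1%:R * H) + n1%:R ^+ 2 * (n2%:R * V).
  have c1 : n1%:R ^+ 2 = \sum_(p : 'I_n1 * 'I_n1) (1 : R).
    by rewrite sumr_const card_prod card_ord natrM expr2.
  have c2 : n2%:R ^+ 2 = \sum_(p : 'I_n2 * 'I_n2) (1 : R).
    by rewrite sumr_const card_prod card_ord natrM expr2.
  have -> : n2%:R ^+ 2 * S1 - n1%:R ^+ 2 * S2 =
      \sum_(p : 'I_n1 * 'I_n1) \sum_(q : 'I_n2 * 'I_n2)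
        (f (x1 + p.1)%N (y1 + p.2)%N - f (x2 + q.1)%N (y2 + q.2)%N).
    under eq_bigr do rewrite big_split sumrN /=.
    rewrite big_split sumrN /=; congr (_ - _).
      by rewrite c2 mulrC mulr_suml; apply: eq_bigr => p _; rewrite mulr_sumr; apply: eq_bigr => q _; rewrite mulr1.
    by rewrite c1 mulr_suml; apply: eq_bigr => p _; rewrite mul1r.
  apply: (@le_trans _ _ (\sum_(p : 'I_n1 * 'I_n1) \sum_(q : 'I_n2 * 'I_n2)
     (h (y1 + p.2)%N + v (x2 + q.1)%N))).
    apply: (le_trans (ler_norm_sum _ _ _)); apply: ler_sum => p _.
    apply: (le_trans (ler_norm_sum _ _ _)); apply: ler_sum => q _.
    have b1 : (x1 + p.1 < N)%N by apply: leq_trans x1N; rewrite ltn_add2l.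
    have b2 : (y1 + p.2 < N)%N by apply: leq_trans y1N; rewrite ltn_add2l.
    have b3 : (x2 + q.1 < N)%N by apply: leq_trans x2N; rewrite ltn_add2l.
    have b4 : (y2 + q.2 < N)%N by apply: leq_trans y2N; rewrite ltn_add2l.
    apply: (le_trans (ler_distD (f (x2 + q.1)%N (y1 + p.2)%N) _ _)).
    apply: lerD.
      by apply: (@norm_sub_le_variation (fun t => f t (y1 + p.2)%N)).
    exact: norm_sub_le_variation.
  under eq_bigr do rewrite big_split /=.
  rewrite big_split /=; apply: lerD.
    under eq_bigr do rewrite sumr_const card_prod card_ord -mulr_natl natrM -expr2.
    rewrite -mulr_sumr ler_wpM2l ?exprn_ge0 //.
    rewrite -(pair_bigA _ (fun i j : 'I_n1 => h (y1 + j)%N)) /= sumr_const card_ord.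
    by rewrite -[leLHS]mulr_natl ler_wpM2l // sum_shift_le.
  rewrite sumr_const card_prod card_ord -[leLHS]mulr_natl natrM -expr2.
  rewrite ler_wpM2l ?exprn_ge0 //.
  rewrite -(pair_bigA _ (fun i j : 'I_n2 => v (x2 + i)%N)) /=.
  under eq_bigr do rewrite sumr_const card_ord -mulr_natl.
  by rewrite -mulr_sumr ler_wpM2l // sum_shift_le.
have -> : S1 / n1%:R ^+ 2 - S2 / n2%:R ^+ 2 =
    (n2%:R ^+ 2 * S1 - n1%:R ^+ 2 * S2) / (n1%:R ^+ 2 * n2%:R ^+ 2).
  by field; rewrite !gt_eqF.
rewrite normrM [X in _ * X]ger0_norm; last by rewrite invr_ge0 mulr_ge0 ?exprn_ge0.
rewrite ler_pdivrMr ?mulr_gt0 ?exprn_gt0 //.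
apply: (le_trans key); rewrite le_eqVlt; apply/orP; left; apply/eqP.
by field; rewrite !gt_eqF.
Qed.

Definition variation (a : site -> R) (t : site) : R :=
  `|a (t + (1, 0)) - a t| + `|a (t + (0, 1)) - a t|.

Lemma variation_ge0 a t : 0 <= variation a t.
Proof. by rewrite addr_ge0. Qed.

Lemma sum_box_le (g : site -> R) (E : {fset site}) (N : nat) (q : site)
    (nr : pred site) :
  (forall t, 0 <= g t) -> (forall t, g t != 0 -> t \in E) ->
  (forall i j, (i < N)%N -> (j < N)%N -> nr (q + (i%:Z, j%:Z))) ->
  \sum_(p : 'I_N * 'I_N) g (q + (p.1%:Z, p.2%:Z)) <= \sum_(t <- E | nr t) g t.
Proof.
move=> g0 gE qnr.
apply: (@le_trans _ _ (\sum_(p : 'I_N * 'I_N) \sum_(t <- E | nr t)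
   (if t == q + (p.1%:Z, p.2%:Z) then g t else 0))).
  apply: ler_sum => p _; set t0 := q + _.
  have [/eqP ->|/gE t0E] := boolP (g t0 == 0).
    by apply: sumr_ge0 => t _; case: ifP.
  rewrite (big_rem t0) //= qnr // eqxx lerDl.
  by apply: sumr_ge0 => t _; case: ifP.
rewrite exchange_big /=; apply: ler_sum => t _; rewrite -big_mkcond /=.
have [p /eqP tp|H] := pickP (fun p : 'I_N * 'I_N => t == q + (p.1%:Z, p.2%:Z)).
  rewrite (big_pred1 p) // => p'; apply/eqP/eqP => [|->//].
  rewrite tp => /addrI [] /ord_inj E1 /ord_inj E2.
  by case: p p' E1 E2 {tp} => [? ?] [? ?] /= -> ->.
by rewrite big_pred0.
Qed.

Definition block_avg (a : site -> R) (n : nat) (s : site) : R :=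
  (\sum_(p : 'I_n * 'I_n) a (s + (p.1%:Z, p.2%:Z))) / n%:R ^+ 2.

Lemma block_avg_sub (a : site -> R) (E : {fset site}) (q : site)
    (x1 y1 n1 x2 y2 n2 d N : nat) (nr : pred site) :
  (forall t, variation a t != 0 -> t \in E) ->
  (forall i j, (i < N)%N -> (j < N)%N -> nr (q + (i%:Z, j%:Z))) ->
  (0 < d)%N -> (d <= n1)%N -> (d <= n2)%N ->
  (x1 + n1 <= N)%N -> (y1 + n1 <= N)%N -> (x2 + n2 <= N)%N -> (y2 + n2 <= N)%N ->
  `|block_avg a n1 (q + (x1%:Z, y1%:Z)) - block_avg a n2 (q + (x2%:Z, y2%:Z))| <=
  d%:R^-1 * \sum_(t <- E | nr t) variation a t.
Proof.
move=> aE qnr d0 dn1 dn2 x1N y1N x2N y2N.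
have n10 := leq_trans d0 dn1; have n20 := leq_trans d0 dn2.
pose f i j := a (q + (i%:Z, j%:Z)).
have := block_average_sub f n10 n20 x1N y1N x2N y2N.
have E1 n x y : \sum_(p : 'I_n * 'I_n) f (x + p.1)%N (y + p.2)%N =
    \sum_(p : 'I_n * 'I_n) a (q + (x%:Z, y%:Z) + (p.1%:Z, p.2%:Z)).
  by apply: eq_bigr => p _; rewrite /f -addrA.
rewrite !E1 -!/(block_avg _ _ _) => H; apply: (le_trans H).
apply: (@le_trans _ _ (d%:R^-1 * \sum_(p : 'I_N * 'I_N) variation a (q + (p.1%:Z, p.2%:Z)))).
  rewrite /variation big_split mulrDr /=.
  have F1 : \sum_(p : 'I_N * 'I_N) `|f p.1.+1 p.2 - f p.1 p.2| =
      \sum_(p : 'I_N * 'I_N) `|a (q + (p.1%:Z, p.2%:Z) + (1, 0)) - a (q + (p.1%:Z, p.2%:Z))|.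
    apply: eq_bigr => p _; rewrite /f -addrA; congr `|a (q + _) - _|.
    by congr (_, _); rewrite /=; lia.
  have F2 : \sum_(p : 'I_N * 'I_N) `|f p.1 p.2.+1 - f p.1 p.2| =
      \sum_(p : 'I_N * 'I_N) `|a (q + (p.1%:Z, p.2%:Z) + (0, 1)) - a (q + (p.1%:Z, p.2%:Z))|.
    apply: eq_bigr => p _; rewrite /f -addrA; congr `|a (q + _) - _|.
    by congr (_, _); rewrite /=; lia.
  rewrite -F1 -F2; apply: lerD; apply: ler_wpM2r; rewrite ?sumr_ge0 //.
    by rewrite lef_pV2 ?posrE ?ltr0n // ler_nat.
  by rewrite lef_pV2 ?posrE ?ltr0n // ler_nat.
rewrite ler_wpM2l ?invr_ge0 // sum_box_le // => t; exact: variation_ge0.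
Qed.

(** Exchange the two sums: an element [t] is counted once for each [s] near it. *)
Lemma double_count (S : seq site) (E : {fset site}) (P : pred site) (nr : site -> site -> bool)
    (g : site -> R) (C : nat) :
  (forall t, 0 <= g t) ->
  (forall t, t \in E -> (count (fun s => P s && nr s t) S <= C)%N) ->
  \sum_(s <- S | P s) \sum_(t <- E | nr s t) g t <= C%:R * \sum_(t <- E) g t.
Proof.
move=> g0 HC.
under eq_bigr do rewrite big_mkcond.
rewrite exchange_big /= mulr_sumr !big_seq; apply: ler_sum => t tE.
rewrite -big_mkcondr /= big_const_seq iter_addr_0 -[leLHS]mulr_natl.
by rewrite ler_wpM2r // ler_nat HC.
Qed.

End BlockAverages.

(** * Discrepancy against perimeter *)

(** The list [r] is not assumed to be stable under the bijection [f], as it is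
enough that it contains the supports of [F] and of [F \o f]. *)
Lemma sum_reindex_supported (V : nmodType) (T : choiceType) (r : seq T)
    (P : pred T) (f g : T -> T) (F : T -> V) :
  uniq r ->
  (forall s, P s -> P (f s) /\ g (f s) = s) ->
  (forall s, P s -> P (g s) /\ f (g s) = s) ->
  (forall s, P s -> F s != 0 -> s \in r) ->
  (forall s, P s -> F (f s) != 0 -> s \in r) ->
  \sum_(s <- r | P s) F s = \sum_(s <- r | P s) F (f s).
Proof.
move=> ur Pf Pg F1 F2.
have -> : \sum_(s <- r | P s) F s = \sum_(s \in [set` P]) F s.
  by apply: bigfs => // s Ps; apply: contraNeq; exact: F1.
have -> : \sum_(s <- r | P s) F (f s) = \sum_(s \in [set` P]) F (f s).
  by apply: (@bigfs _ _ _ _ r P (F \o f)) => // s Ps; apply: contraNeq; exact: F2.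
apply: reindex_fsbig; split.
- by move=> s /= /Pf[].
- move=> s t; rewrite !inE => Ps Pt E.
  by rewrite -(Pf _ Ps).2 E (Pf _ Pt).2.
- by move=> s /= Ps; exists (g s); have [] := Pg _ Ps.
Qed.

Section Perimeter.
Variable R : realType.

Definition ind (A : {fset site}) (s : site) : R := (s \in A)%:R.

Definition edge_set (A : {fset site}) : {fset site} :=
  (A `|` ([fset t - (1, 0) | t in A] `|` [fset t - (0, 1) | t in A]))%fset.

(** The number of pairs of adjacent sites separated by [A]; outside of
[edge_set A] the variation of the indicator vanishes. *)
Definition perimeter (A : {fset site}) : R :=
  \sum_(t <- edge_set A) variation (ind A) t.

Lemma variation_edge_set A t : variation (ind A) t != 0 -> t \in edge_set A.
Proof.
apply: contraNT; rewrite /edge_set !in_fsetU !negb_or => /and3P[h0 h1 h2].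
have n0 : ind A t = 0 by rewrite /ind (negbTE h0).
have n1 : ind A (t + (1, 0)) = 0.
  rewrite /ind; case: (boolP (_ \in A)) => // tA; case/negP: h1.
  by apply/imfsetP; exists (t + (1, 0)); rewrite //= addrK.
have n2 : ind A (t + (0, 1)) = 0.
  rewrite /ind; case: (boolP (_ \in A)) => // tA; case/negP: h2.
  by apply/imfsetP; exists (t + (0, 1)); rewrite //= addrK.
by rewrite /variation n0 n1 n2 subrr normr0 addr0.
Qed.

Lemma perimeter_ge0 A : 0 <= perimeter A.
Proof. by apply: sumr_ge0 => t _; exact: variation_ge0. Qed.

(** Walking to the right from a point of [A] one has to leave [A]. *)
Lemma perimeter_ge1 A : A != fset0 -> 1 <= perimeter A.
Proof.
move=> /fset0Pn[s0 s0A].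
have [t tA tmax] : exists2 t, t \in A & t + (1, 0) \notin A.
  apply: contrapT => H.
  have step n : s0 + (n%:Z, 0) \in A.
    elim: n => [|n IH]; first by rewrite [X in s0 + X](_ : _ = 0) ?addr0.
    have -> : s0 + (n.+1%:Z, 0) = s0 + (n%:Z, 0) + (1, 0).
      by rewrite -addrA; congr (s0 + (_, _)); rewrite /=; lia.
    by apply: contraT => nA; exfalso; apply: H; exists (s0 + (n%:Z, 0)).
  pose orbit := [seq s0 + (n%:Z, 0) | n <- iota 0 #|` A|.+1].
  have : (size orbit <= #|` A|)%N.
    apply: uniq_leq_size.
      rewrite map_inj_uniq ?iota_uniq // => i j /addrI[] //.
    by move=> x /mapP[n _ ->].
  by rewrite /orbit size_map size_iota ltnn.
have tE : t \in edge_set A by rewrite /edge_set !in_fsetU tA.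
rewrite /perimeter (big_rem t) //=.
rewrite -[leLHS]addr0 lerD ?sumr_ge0 //; last by move=> *; exact: variation_ge0.
rewrite /variation /ind tA (negbTE tmax) sub0r normrN1 lerDl //.
Qed.

End Perimeter.
Arguments perimeter R A : clear implicits.

Section Discrepancy.
Variables (R : realType) (e : R).
Hypotheses (e_gt : 2 / 5 < e) (e_lt : e < 1 / 2) (eE : e ^+ 3 = 1 - 2 * e).

(** The radius is the sum of the displacement [11 * 8^k] of [flip] and of the
side of a block. *)
Definition near_at (k : nat) (s t : site) : bool :=
  (`|(s - t).1| <= 12 * 8 ^+ k) && (`|(s - t).2| <= 12 * 8 ^+ k).

(** Each [t] is counted once for each site of the strip near it, hence at most
[C * 4^k] times. *)
Definition strip_count_bound (C : nat) : Prop :=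
  forall (r : seq site) (E : {fset site}) k (g : site -> R),
  uniq r -> (forall t, 0 <= g t) ->
  \sum_(s <- r | in_strip e k s) \sum_(t <- E | near_at k s t) g t
    <= (C * 4 ^ k)%:R * \sum_(t <- E) g t.

Lemma exists_strip_count_bound : exists C, strip_count_bound C.
Proof.
exists ((33 * 12) ^ 2)%N => r E k g ur g0; apply: double_count => // t _.
rewrite -size_filter.
apply: (strip_count e_gt e_lt eE (p := t)); rewrite ?filter_uniq //.
by move=> s; rewrite mem_filter => /andP[/andP[? /andP[? ?]] _]; split.
Qed.

(** The exchange preserves the level and reverses [sgn], so the sum equals half
of the sum of the terms [sgn e s * (phi s - phi (flip e k s))]. *)
Lemma level_sum_le (r : seq site) k (phi : site -> R) : uniq r ->
  (forall s, phi s != 0 -> s \in r) ->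
  (forall s, phi (flip e k s) != 0 -> s \in r) ->
  `|\sum_(s <- r | in_level e k s) sgn e s * phi s| <=
  \sum_(s <- r | in_level e k s) `|phi s - phi (flip e k s)|.
Proof.
move=> ur h1 h2.
have E : \sum_(s <- r | in_level e k s) sgn e s * phi s =
    \sum_(s <- r | in_level e k s) sgn e (flip e k s) * phi (flip e k s).
  apply: (@sum_reindex_supported _ _ r (in_level e k) (flip e k) (unflip e k)
    (fun s => sgn e s * phi s)) => // s.
  - by move=> Ps; have [_] := flip_lift e_gt e_lt eE Ps.
  - exact: unflip_lift.
  - by move=> _; rewrite mulf_eq0 negb_or => /andP[_ /h1].
  - by move=> _; rewrite mulf_eq0 negb_or => /andP[_ /h2].
move: E; set S := \sum_(s <- r | _) _ => E.
have : S + S = \sum_(s <- r | in_level e k s) sgn e s * (phi s - phi (flip e k s)).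
  rewrite {2}E -big_split; apply: eq_bigr => s Ps /=.
  by rewrite (sgn_flip e_gt e_lt eE Ps); ring.
set S' := \sum_(s <- r | _) _ => SS.
have -> : S = S' / 2 by rewrite -SS; field.
have : `|S'| <= \sum_(s <- r | in_level e k s) `|phi s - phi (flip e k s)|.
  apply: (le_trans (ler_norm_sum _ _ _)); apply: ler_sum => s _.
  by rewrite normrM norm_sgn mul1r.
rewrite normrM [ `|2^-1|]ger0_norm ?invr_ge0 //.
by have := normr_ge0 S'; lra.
Qed.

Variable A : {fset site}.

Definition phi (k : nat) (s : site) : R := block_avg (ind R A) (8 ^ k) s.

(** The blocks at [s] and at its image lie in a common box of side [23 * 8^k]. *)
Lemma phi_flip k s :
  `|phi k s - phi k (flip e k s)| <=
    (8 ^+ k)^-1 * \sum_(t <- edge_set A | near_at k s t) variation (ind R A) t.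
Proof.
have [d1 d2] := flip_dist e_gt e_lt eE k s.
set s' := flip e k s in d1 d2 *; rewrite !pow_int_nat -!PoszM in d1 d2.
set n8 := (8 ^ k)%N in d1 d2 *.
have n8_gt0 : (0 < n8)%N by rewrite expn_gt0.
(* The lower left corner of the common box. *)
pose q : site := s - ((11 * n8)%N%:Z, (11 * n8)%N%:Z).
have sE : s = q + ((11 * n8)%N%:Z, (11 * n8)%N%:Z) by rewrite subrK.
have s'E : s' = q + ((absz (s' - q).1)%:Z, (absz (s' - q).2)%:Z).
  have -> : ((absz (s' - q).1)%:Z, (absz (s' - q).2)%:Z) = s' - q.
    by rewrite [RHS]surjective_pairing /q /=; congr (_, _); move: d1 d2 => /=; lia.
  by rewrite addrC subrK.
have -> : (8 : R) ^+ k = n8%:R by rewrite natrX.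
rewrite /phi {1}sE s'E; apply: (@block_avg_sub R _ _ _ _ _ _ _ _ _ _ (23 * n8)) => //.
- exact: variation_edge_set.
- move=> i j iN jN; rewrite /near_at !pow_int_nat -/n8 -!PoszM /q.
  by rewrite /=; apply/andP; split; move: iN jN; clear; lia.
- by clear; lia.
- by clear; lia.
- by move: d1 d2; rewrite /q /=; clear; lia.
- by move: d1 d2; rewrite /q /=; clear; lia.
Qed.

Lemma phi_step k s :
  `|phi k s - phi k.+1 s| <=
    (8 ^+ k)^-1 * \sum_(t <- edge_set A | near_at k s t) variation (ind R A) t.
Proof.
set n8 := (8 ^ k)%N.
have n8_gt0 : (0 < n8)%N by rewrite expn_gt0.
have -> : (8 : R) ^+ k = n8%:R by rewrite natrX.
have E : s = s + (0%N%:Z, 0%N%:Z) by rewrite [X in _ + X](_ : _ = 0) ?addr0.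
rewrite /phi {1 2}E expnS -/n8; apply: (@block_avg_sub R _ _ _ _ _ _ _ _ _ _ (8 * n8)) => //.
- exact: variation_edge_set.
- move=> i j iN jN; rewrite /near_at !pow_int_nat -/n8 -!PoszM.
  by rewrite /=; apply/andP; split; move: iN jN; clear; lia.
- by clear; lia.
- by clear; lia.
- by clear; lia.
Qed.

Lemma phi_ge0 k s : 0 <= phi k s.
Proof. by rewrite /phi /block_avg divr_ge0 ?exprn_ge0 ?ler0n // sumr_ge0. Qed.

(** For large [k] this is much stronger than [phi k s <= 1], as the finitely
many points of [A] are diluted in a block of [64^k] sites. *)
Lemma phi_le k s :
  phi k s <= (64 ^+ k)^-1 * \sum_(t <- A | near_at k s t) ind R A t.
Proof.
rewrite /phi /block_avg.
have -> : (8 ^ k)%N%:R ^+ 2 = 64 ^+ k :> R.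
  by rewrite -natrX -expnM mulnC expnM natrX.
rewrite mulrC ler_wpM2l ?invr_ge0 ?exprn_ge0 //; apply: sum_box_le => //.
- by move=> t; rewrite /ind; case: (t \in A); rewrite // eqxx.
- move=> i j iN jN; rewrite /near_at !pow_int_nat -!PoszM.
  by rewrite /=; apply/andP; split; move: (8 ^ k)%N iN jN; clear; lia.
Qed.

Lemma phi_support k s : phi k s != 0 -> exists2 t, t \in A & near_at k s t.
Proof.
move=> ph; apply: contrapT => H.
have := phi_le k s; rewrite big1_seq ?mulr0; last first.
  by move=> t /andP[nst tA]; exfalso; apply: H; exists t.
by move=> le0; case/negP: ph; rewrite eq_le le0 phi_ge0.
Qed.

(** Let [T k] be the signed sum over the strip [0 <= y < e^(4k)] of the averages
over blocks of side [8^k], so that [T 0] is the sum to be bounded.  Passing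
from [T k] to [T k.+1] discards the level [k], where the exchange cancels the
averages up to their variation, and changes the scale of the averages on the
rest of the strip.  Both errors are at most [8^-k] times the local perimeters,
each of which is counted at most [C * 4^k] times.  After enough steps the
averages are too small for [T k] to exceed 1. *)
Lemma discrepancy_le_perimeter (C : nat) : strip_count_bound C ->
  `|\sum_(s <- A) sgn e s| <= (4 * C + 1)%:R * perimeter R A.
Proof.
move=> count_bound; have [->|A0] := eqVneq A fset0.
  by rewrite big_seq_fset0 normr0 mulr_ge0 // perimeter_ge0.
(* With this many steps, [C * 4 ^ K * #|A| <= 64 ^ K]. *)
pose K := (C * #|` A|)%N.
(* The box of half-side [Z] contains every site which has, or is mapped by
   [flip] to a site which has, a nonzero average at some scale [k <= K]. *)
pose rA := (\max_(t <- A) maxn (absz t.1) (absz t.2))%N.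
pose Z := (rA + 23 * 8 ^ K)%N.
pose zs := [seq (i%:Z - Z%:Z)%R | i <- iota 0 (2 * Z + 1)].
pose r : seq site := [seq (x, y) | x <- zs, y <- zs].
have zsP x : `|x| <= Z%:Z -> x \in zs.
  move=> xZ; apply/mapP; exists (absz (x + Z%:Z)).
    by rewrite mem_iota; move: xZ; clear; lia.
  by move: xZ; clear; lia.
have ur : uniq r.
  have uzs : uniq zs by rewrite map_inj_uniq ?iota_uniq // => i j; lia.
  by apply: allpairs_uniq => // -[? ?] [? ?] _ _ /= [-> ->].
have rP (k : nat) (s s' t : site) : (k <= K)%N -> t \in A -> near_at k s' t ->
    `|(s' - s).1| <= 11 * 8 ^+ k -> `|(s' - s).2| <= 11 * 8 ^+ k -> s \in r.
  move=> kK tA; rewrite /near_at !pow_int_nat -!PoszM => /andP[a1 a2] b1 b2.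
  have tr : (maxn (absz t.1) (absz t.2) <= rA)%N by exact: leq_bigmax_seq.
  have k8 : (8 ^ k <= 8 ^ K)%N by rewrite leq_exp2l.
  have Zge : (rA + 23 * 8 ^ k <= Z)%N by rewrite leq_add2l leq_mul2l k8 orbT.
  have [sx sy] : `|s.1| <= Z%:Z /\ `|s.2| <= Z%:Z.
    move: (8 ^ k)%N tr a1 a2 b1 b2 Zge => n.
    by case: t {tA} => t1 t2; case: s => s1 s2; case: s' => u1 u2 /=; clear; split; lia.
  by rewrite [s]surjective_pairing; apply: allpairs_f; apply: zsP.
have supp1 k s : (k <= K)%N -> phi k s != 0 -> s \in r.
  move=> kK /phi_support[t tA nst]; apply: (rP k s s t) => //; rewrite subrr normr0.
    by rewrite mulr_ge0 ?exprn_ge0.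
  by rewrite mulr_ge0 ?exprn_ge0.
have supp2 k s : (k <= K)%N -> phi k (flip e k s) != 0 -> s \in r.
  move=> kK /phi_support[t tA nst]; have [d1 d2] := flip_dist e_gt e_lt eE k s.
  exact: (rP k s (flip e k s) t).
pose T k := \sum_(s <- r | in_strip e k s) sgn e s * phi k s.
pose E := perimeter R A.
have E0 : 0 <= E by exact: perimeter_ge0.
have step k : (k < K)%N -> `|T k - T k.+1| <= 2 * C%:R * E * (1 / 2) ^+ k.
  move=> kK.
  have lev : T k = \sum_(s <- r | in_level e k s) sgn e s * phi k s +
      \sum_(s <- r | in_strip e k.+1 s) sgn e s * phi k s.
    rewrite /T (bigID (in_strip e k.+1)) /= addrC; congr (_ + _).
      by apply: eq_bigl => s; rewrite /in_strip /in_level andbC -leNgt.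
    apply: eq_bigl => s; rewrite /in_strip; case: (ltP (ysite e s) (e ^+ (4 * k.+1))) => h; rewrite ?andbF ?andbT //.
    have [p0 q0 p1 pq] := level_bounds e_gt e_lt k; have e0 := e_gt0 e_gt.
    have pe0 : 0 < e ^+ (4 * k) * e by rewrite mulr_gt0.
    by apply/idP; lra.
  have -> : T k - T k.+1 = \sum_(s <- r | in_level e k s) sgn e s * phi k s +
      \sum_(s <- r | in_strip e k.+1 s) sgn e s * (phi k s - phi k.+1 s).
    rewrite lev -addrA; congr (_ + _); rewrite -sumrB.
    by apply: eq_bigr => s _; rewrite mulrBr.
  have dc := count_bound r (edge_set A) k _ ur (variation_ge0 (ind R A)).
  have bnd (P : pred site) (F : site -> R) : (forall s, P s -> in_strip e k s) ->
      (forall s, `|F s| <= (8 ^+ k)^-1 * \sum_(t <- edge_set A | near_at k s t) variation (ind R A) t) ->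
      \sum_(s <- r | P s) `|F s| <= C%:R * E * (1 / 2) ^+ k.
    move=> Pk HF.
    apply: (@le_trans _ _ ((8 ^+ k)^-1 * \sum_(s <- r | in_strip e k s)
       \sum_(t <- edge_set A | near_at k s t) variation (ind R A) t)).
      rewrite mulr_sumr big_mkcond [leRHS]big_mkcond /=; apply: ler_sum => s _.
      case: ifP => [/Pk ->|_]; first exact: HF.
      case: ifP => // _; rewrite mulr_ge0 ?invr_ge0 ?exprn_ge0 ?sumr_ge0 //.
      by move=> *; exact: variation_ge0.
    rewrite ler_pdivrMl ?exprn_gt0 //; apply: (le_trans dc).
    rewrite -/(perimeter R A) -/E natrM natrX.
    have -> : 8 ^+ k * (C%:R * E * (1 / 2) ^+ k) = C%:R * ((8 * (1 / 2)) ^+ k) * E.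
      rewrite [(8 * (1 / 2)) ^+ k]exprMn.
      by move: (8 ^+ k) ((1 / 2) ^+ k) => x y; ring.
    by have -> : 8 * (1 / 2) = 4 :> R by field.
  apply: (le_trans (ler_normD _ _)).
  have -> : 2 * C%:R * E * (1 / 2) ^+ k =
     C%:R * E * (1 / 2) ^+ k + C%:R * E * (1 / 2) ^+ k by ring.
  apply: lerD.
    apply: (le_trans (level_sum_le ur _ _)).
    - by move=> s; apply: supp1; exact: ltnW.
    - by move=> s; apply: supp2; exact: ltnW.
    apply: bnd => [s|s]; last exact: phi_flip.
    by rewrite /in_level => /andP[].
  apply: (@le_trans _ _ (\sum_(s <- r | in_strip e k.+1 s) `|phi k s - phi k.+1 s|)).
    apply: (le_trans (ler_norm_sum _ _ _)); apply: ler_sum => s _.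
    by rewrite normrM norm_sgn mul1r.
  apply: bnd => [s|s]; last exact: phi_step.
  rewrite /in_strip => h; apply: lt_trans h _.
  have [p0 q0 p1 pq] := level_bounds e_gt e_lt k; have e0 := e_gt0 e_gt.
  have pe0 : 0 < e ^+ (4 * k) * e by rewrite mulr_gt0.
  by lra.
have T0 : T 0%N = \sum_(s <- A) sgn e s.
  rewrite /T; have -> : \sum_(s <- A) sgn e s = \sum_(s <- r | s \in A) sgn e s.
    rewrite -[RHS]big_filter; apply: perm_big; apply: uniq_perm; rewrite ?filter_uniq ?fset_uniq //.
    move=> s; rewrite mem_filter; case: (boolP (s \in A)) => //= sA.
    by apply/esym; apply: (rP 0%N s s s) => //; rewrite ?/near_at ?subrr ?normr0.
  rewrite [RHS]big_mkcond [LHS]big_mkcond; apply: eq_bigr => s _.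
  rewrite /in_strip muln0 expr0 (andP (ysite_itv e s)).2.
  rewrite /phi /block_avg expn0 expr1n divr1.
  rewrite (big_pred1 (ord0, ord0)); last first.
    by move=> [i j]; rewrite !ord1 /= eqxx.
  rewrite /= [X in s + X](_ : _ = 0) // addr0 /ind.
  by case: (s \in A); rewrite ?mulr1 ?mulr0.
have TK : `|T K| <= E.
  apply: (@le_trans _ _ 1); last exact: perimeter_ge1.
  apply: (@le_trans _ _ (\sum_(s <- r | in_strip e K s) phi K s)).
    apply: (le_trans (ler_norm_sum _ _ _)); apply: ler_sum => s _.
    by rewrite normrM norm_sgn mul1r ger0_norm // phi_ge0.
  apply: (@le_trans _ _ ((64 ^+ K)^-1 * \sum_(s <- r | in_strip e K s)
       \sum_(t <- A | near_at K s t) ind R A t)).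
    by rewrite mulr_sumr; apply: ler_sum => s _; exact: phi_le.
  rewrite ler_pdivrMl ?exprn_gt0 // mulr1.
  apply: (le_trans (count_bound r A K _ ur _)) => //.
  have -> : \sum_(t <- A) ind R A t = #|` A|%:R.
    by rewrite -sum1_size natr_sum !big_seq; apply: eq_bigr => t tA; rewrite /ind tA.
  rewrite -natrM -natrX ler_nat mulnAC -/K.
  have -> : (64 ^ K = 16 ^ K * 4 ^ K)%N by rewrite -expnMn.
  by rewrite leq_mul2r ltnW ?orbT // ltn_expl.
have tele : T 0%N = \sum_(k < K) (T k - T k.+1) + T K.
  by rewrite -(big_mkord xpredT (fun k => T k - T k.+1)) /=;
    under eq_bigr do rewrite -opprB; rewrite sumrN telescope_sumr // opprB subrK.
rewrite -T0 tele; apply: (le_trans (ler_normD _ _)).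
rewrite natrD mulrDl mul1r; apply: lerD TK.
apply: (le_trans (ler_norm_sum _ _ _)).
apply: (@le_trans _ _ (\sum_(k < K) 2 * C%:R * E * (1 / 2) ^+ k)).
  by apply: ler_sum => k _; apply: step.
rewrite -mulr_sumr.
have g : \sum_(k < K) (1 / 2 : R) ^+ k <= 2.
  have := subrX1 (1 / 2 : R) K; have : 0 <= (1 / 2 : R) ^+ K by rewrite exprn_ge0 // divr_ge0.
  set S := \sum_(i < K) _; lra.
have : 0 <= 2 * C%:R * E by rewrite !mulr_ge0.
rewrite natrM; move: (\sum_(k < K) _) g => g gl cE.
have := ler_wpM2l cE gl; rewrite -/E; lra.
Qed.

End Discrepancy.

(** * Unions of square cells *)

Section Cells.
Variables (R : realType) (L : nat).
Hypothesis L_gt0 : (0 < L)%N.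

Definition cell (s : site) : site := ((s.1 %/ L%:Z)%Z, (s.2 %/ L%:Z)%Z).

Lemma cell_eqE (s q : site) : (cell s == q) =
  (L%:Z * q.1 <= s.1 < L%:Z * q.1 + L%:Z) && (L%:Z * q.2 <= s.2 < L%:Z * q.2 + L%:Z).
Proof.
have divE (x y : int) : (((x %/ L%:Z)%Z == y) = (L%:Z * y <= x < L%:Z * y + L%:Z)).
  have L0 := L_gt0; have Lz : L%:Z != 0 by lia.
  have := divz_eq x L%:Z; have := modz_ge0 x Lz; have := @ltz_pmod x L%:Z _.
  move: (x %/ L%:Z)%Z (x %% L%:Z)%Z => d m; move: L0; clear => L0 mL m0 ->.
  have {}mL : m < L%:Z by apply: mL; lia.
  by apply/eqP/idP => [<-|/andP[h1 h2]]; [apply/andP; split; lia | nia].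
case: q => q1 q2; rewrite /cell /= -!divE.
by apply/eqP/andP => [[<- <-]|[/eqP-> /eqP->]].
Qed.

Definition offs : seq site := [seq (i%:Z, j%:Z) | i <- iota 0 L, j <- iota 0 L].
Definition base (q : site) : site := (L%:Z * q.1, L%:Z * q.2).
Definition blowseq (Q : seq site) : seq site := [seq base q + o | q <- Q, o <- offs].

Lemma cell_base q o : o \in offs -> cell (base q + o) = q.
Proof.
move=> /allpairsP[[i j] [/= iL jL ->]]; apply/eqP; rewrite cell_eqE.
move: iL jL; rewrite !mem_iota /base /=; clear; lia.
Qed.

Lemma mem_blowseq Q s : (s \in blowseq Q) = (cell s \in Q).
Proof.
apply/idP/idP => [/allpairsP[[q o] [/= qQ oL ->]]|sQ]; first by rewrite cell_base.
have := cell_eqE s (cell s); rewrite eqxx => /esym inC.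
have -> : s = base (cell s) + (s - base (cell s)) by rewrite addrC subrK.
apply: allpairs_f => //; apply/allpairsP.
exists (absz (s - base (cell s)).1, absz (s - base (cell s)).2).
have : ((base (cell s)).1 <= s.1 < (base (cell s)).1 + L%:Z) &&
       ((base (cell s)).2 <= s.2 < (base (cell s)).2 + L%:Z) by [].
rewrite !mem_iota; move: (base (cell s)) => [x y].
case: s {sQ inC} => s1 s2 /=; clear => *; split; [lia|lia|].
by rewrite [LHS]surjective_pairing /=; congr (_, _); lia.
Qed.

Lemma blowseq_uniq Q : uniq Q -> uniq (blowseq Q).
Proof.
move=> uQ; apply: allpairs_uniq => //.
  apply: allpairs_uniq; rewrite ?iota_uniq // => -[i j] [i' j'] _ _ /= [-> ->] //.
move=> [q o] [q' o'] /allpairsP[[? ?] [_ /= h1 [-> ->]]] /allpairsP[[? ?] [_ /= h2 [-> ->]]].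
move=> E; have := congr1 cell E; rewrite !cell_base // => qq.
by move: E; rewrite qq => /addrI ->.
Qed.

(** The union of the cells with index in [Q]. *)
Definition blow (Q : {fset site}) : {fset site} := seq_fset tt (blowseq Q).

Lemma mem_blow Q s : (s \in blow Q) = (cell s \in Q).
Proof. by rewrite /blow seq_fsetE mem_blowseq. Qed.

Lemma perm_blow Q : perm_eq (blow Q) (blowseq Q).
Proof.
have := seq_fset_perm tt (blowseq Q).
by rewrite undup_id ?blowseq_uniq ?fset_uniq.
Qed.

Lemma sum_blow (V : nmodType) (F : site -> V) (Q : {fset site}) :
  \sum_(s <- blow Q) F s = \sum_(q <- Q) \sum_(o <- offs) F (base q + o).
Proof. by rewrite (perm_big _ (perm_blow Q)) big_allpairs_dep. Qed.

Definition king_moves : seq site :=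
  [seq (i%:Z - 1, j%:Z - 1) | i <- iota 0 3, j <- iota 0 3].

Lemma mem_king_moves d : (d \in king_moves) = (`|d.1| <= 1) && (`|d.2| <= 1).
Proof.
apply/allpairsP/andP => [[[i j] []]|[h1 h2]].
  by rewrite !mem_iota => hi hj -> /=; move: hi hj => /=; clear; lia.
exists (absz (d.1 + 1), absz (d.2 + 1)); rewrite !mem_iota.
case: d h1 h2 => x y /=; clear => *; split; [lia|lia|congr (_, _); lia].
Qed.

Definition nbr_cells (Q : {fset site}) : {fset site} :=
  seq_fset tt [seq q + d | q <- Q, d <- king_moves].

Lemma mem_nbr_cells (Q : {fset site}) q : reflect
  (exists2 q', q' \in Q & `|(q - q').1| <= 1 /\ `|(q - q').2| <= 1) (q \in nbr_cells Q).
Proof.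
rewrite /nbr_cells seq_fsetE; apply: (iffP allpairsP) => [[[q' d] [q'Q dd ->]]|[q' q'Q [h1 h2]]].
  have E : q' + d - q' = d by rewrite addrC addKr.
  exists q' => //; change (`|(q' + d - q').1| <= 1 /\ `|(q' + d - q').2| <= 1).
  rewrite E.
  by move: dd; rewrite mem_king_moves => /andP[].
exists (q', q - q') => /=; split => //; last by rewrite addrC subrK.
by rewrite mem_king_moves h1 h2.
Qed.

Lemma sum_support_le (g : site -> R) (E E' : {fset site}) :
  (forall t, 0 <= g t) -> (forall t, g t != 0 -> t \in E') ->
  \sum_(t <- E) g t <= \sum_(t <- E') g t.
Proof.
move=> g0 gE; rewrite [leRHS](bigID (mem E)) /=.
apply: (@le_trans _ _ (\sum_(t <- E' | t \in E) g t)); last first.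
  by rewrite lerDl sumr_ge0.
rewrite (bigID (mem E')) /= [X in _ + X]big1 ?addr0; last first.
  by move=> t; apply: contraNeq; exact: gE.
rewrite le_eqVlt; apply/orP; left; apply/eqP.
rewrite -[LHS]big_filter -[RHS]big_filter; apply: perm_big.
apply: uniq_perm; rewrite ?filter_uniq ?fset_uniq // => t.
by rewrite !mem_filter andbC.
Qed.

Lemma sum_mem_le_size (E : {fset site}) (l : seq site) :
  \sum_(t <- E) (t \in l)%:R <= (size l)%:R :> R.
Proof.
have -> : \sum_(t <- E) (t \in l)%:R = (count (mem l) E)%:R :> R.
  by rewrite -sum1_count natr_sum [RHS]big_mkcond; apply: eq_bigr => t _ /=; case: (t \in l).
rewrite ler_nat -size_filter uniq_leq_size ?filter_uniq ?fset_uniq //.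
by move=> t; rewrite mem_filter => /andP[].
Qed.

Lemma ind_blow1 q s : ind R (blow [fset q]%fset) s = (cell s == q)%:R.
Proof. by rewrite /ind mem_blow inE. Qed.

Lemma perimeter_cell_le q : perimeter R (blow [fset q]%fset) <= (4 * L)%:R.
Proof.
pose lh := [seq base q + (-1, j%:Z) | j <- iota 0 L] ++ [seq base q + (L%:Z - 1, j%:Z) | j <- iota 0 L].
pose lv := [seq base q + (j%:Z, -1) | j <- iota 0 L] ++ [seq base q + (j%:Z, L%:Z - 1) | j <- iota 0 L].
have mem_l (f : nat -> site) (j : int) t : 0 <= j -> j < L%:Z -> t = f (absz j) ->
    t \in [seq f j | j <- iota 0 L].
  by move=> j0 jL ->; apply: map_f; rewrite mem_iota; move: j0 jL; clear; lia.
have leb (b c : bool) : (b -> c) -> (b <= c)%N by case: b => // ->.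
have cases (b b' : bool) : `|b%:R - b'%:R : R| <= (b != b')%:R.
  by case: b; case: b'; rewrite /= ?subrr ?subr0 ?sub0r ?normrN1 ?normr0 ?normr1.
apply: (@le_trans _ _ (\sum_(t <- edge_set (blow [fset q]%fset)) ((t \in lh)%:R + (t \in lv)%:R))).
  rewrite /perimeter; apply: ler_sum => t _; rewrite /variation !ind_blow1.
  apply: lerD; apply: (le_trans (cases _ _)); rewrite ler_nat;
    apply: leb => ne.
  - rewrite /lh mem_cat.
    have [[i0 iL] [E|E]] : (0 <= t.2 - L%:Z * q.2 /\ t.2 - L%:Z * q.2 < L%:Z) /\
        (t.1 = L%:Z * q.1 - 1 \/ t.1 = L%:Z * q.1 + L%:Z - 1).
      by move: ne; rewrite !cell_eqE /=; move: (L%:Z * q.1) (L%:Z * q.2); clear; lia.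
    + apply/orP; left; apply: (mem_l (fun j => base q + (-1, j%:Z)) _ _ i0 iL).
      by rewrite [LHS]surjective_pairing E /base /=; congr (_, _); move: (L%:Z * q.1) (L%:Z * q.2) i0 => x y /=; clear; lia.
    + apply/orP; right; apply: (mem_l (fun j => base q + (L%:Z - 1, j%:Z)) _ _ i0 iL).
      by rewrite [LHS]surjective_pairing E /base /=; congr (_, _); move: (L%:Z * q.1) (L%:Z * q.2) i0 => x y /=; clear; lia.
  - rewrite /lv mem_cat.
    have [[i0 iL] [E|E]] : (0 <= t.1 - L%:Z * q.1 /\ t.1 - L%:Z * q.1 < L%:Z) /\
        (t.2 = L%:Z * q.2 - 1 \/ t.2 = L%:Z * q.2 + L%:Z - 1).
      by move: ne; rewrite !cell_eqE /=; move: (L%:Z * q.1) (L%:Z * q.2); clear; lia.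
    + apply/orP; left; apply: (mem_l (fun j => base q + (j%:Z, -1)) _ _ i0 iL).
      by rewrite [LHS]surjective_pairing E /base /=; congr (_, _); move: (L%:Z * q.1) (L%:Z * q.2) i0 => x y /=; clear; lia.
    + apply/orP; right; apply: (mem_l (fun j => base q + (j%:Z, L%:Z - 1)) _ _ i0 iL).
      by rewrite [LHS]surjective_pairing E /base /=; congr (_, _); move: (L%:Z * q.1) (L%:Z * q.2) i0 => x y /=; clear; lia.
rewrite big_split /=.
apply: (le_trans (lerD (sum_mem_le_size _ _) (sum_mem_le_size _ _))).
by rewrite /lh /lv !size_cat !size_map !size_iota -natrD ler_nat; lia.
Qed.

(** An edge of the boundary of the union separates a cell of [Q] from an adjacent
cell out of [Q], and belongs to the boundary of the latter. *)
Lemma perimeter_blow_le (Q : {fset site}) :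
  perimeter R (blow Q) <= \sum_(q <- (nbr_cells Q `\` Q)%fset) perimeter R (blow [fset q]%fset).
Proof.
set O := (nbr_cells Q `\` Q)%fset.
pose dif (a : site -> R) t d := `|a (t + d) - a t|.
have step t d : (d == (1, 0)) || (d == (0, 1)) ->
    dif (ind R (blow Q)) t d <= \sum_(q <- O) dif (ind R (blow [fset q]%fset)) t d.
  move=> dE.
  have near_cell : `|(cell (t + d) - cell t).1| <= 1 /\ `|(cell (t + d) - cell t).2| <= 1.
    have := cell_eqE t (cell t); have := cell_eqE (t + d) (cell (t + d)).
    rewrite !eqxx => /esym /andP[/andP[a1 a2] /andP[a3 a4]] /esym /andP[/andP[b1 b2] /andP[b3 b4]].
    move: L_gt0 a1 a2 a3 a4 b1 b2 b3 b4; move: (cell (t + d)) (cell t) => [x y] [x' y'].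
    by case: t => t1 t2; move: dE => /orP[] /eqP -> /=; clear; split; nia.
  have sum0 : 0 <= \sum_(q <- O) dif (ind R (blow [fset q]%fset)) t d.
    by apply: sumr_ge0 => q _; exact: normr_ge0.
  have one (x y : site) : cell x \in Q -> cell y \notin Q ->
      `|(cell y - cell x).1| <= 1 -> `|(cell y - cell x).2| <= 1 ->
      (x = t /\ y = t + d) \/ (y = t /\ x = t + d) ->
      1 <= \sum_(q <- O) dif (ind R (blow [fset q]%fset)) t d.
    move=> xQ yQ h1 h2 xy.
    have yO : cell y \in O.
      by rewrite in_fsetD yQ; apply/mem_nbr_cells; exists (cell x).
    rewrite (big_rem (cell y)) //= -[leLHS]addr0; apply: lerD; last first.
      by apply: sumr_ge0 => q _; exact: normr_ge0.
    have nxy : (cell x == cell y) = false by apply: contraNF yQ => /eqP <-.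
    by rewrite /dif !ind_blow1; case: xy => -[<- <-]; rewrite eqxx nxy ?subr0 ?sub0r ?normrN1 ?normr1.
  rewrite {1}/dif /ind !mem_blow.
  case: (boolP (cell (t + d) \in Q)) => tdQ; case: (boolP (cell t \in Q)) => tQ;
    rewrite ?subrr ?normr0 //= ?subr0 ?sub0r ?normrN1 ?normr1.
    apply: (one (t + d) t) => //; [| |by right].
      by move: near_cell.1; rewrite /= distrC.
    by move: near_cell.2; rewrite /= distrC.
  by apply: (one t (t + d)) => //; [exact: near_cell.1|exact: near_cell.2|left].
rewrite {1}/perimeter.
apply: (@le_trans _ _ (\sum_(t <- edge_set (blow Q)) \sum_(q <- O) variation (ind R (blow [fset q]%fset)) t)).
  apply: ler_sum => t _; rewrite /variation big_split /=.
  by apply: lerD; apply: step; rewrite eqxx ?orbT.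
rewrite exchange_big /=; apply: ler_sum => q _; apply: sum_support_le.
  by move=> t; exact: variation_ge0.
by move=> t; exact: variation_edge_set.
Qed.
End Cells.

(** * Bijections of bounded displacement *)

Section Laczkovich.
Variable R : realType.

Definition balanced (C : nat) (S S' : pred site) : Prop :=
  forall A : {fset site},
  `|\sum_(s <- A) (S s)%:R - \sum_(s <- A) (S' s)%:R| <= C%:R * perimeter R A.

Lemma balanced_sym C S S' : balanced C S S' -> balanced C S' S.
Proof. by move=> h A; rewrite distrC. Qed.

Lemma sum_offs_perm L q (F : site -> R) : (0 < L)%N ->
  \sum_(o <- offs L) F (base L q + o) = \sum_(s <- blow L [fset q]%fset) F s.
Proof. by move=> L0; rewrite sum_blow // big_seq_fset1. Qed.

(** Match the elements of [S] with elements of [S'] in the same or in an adjacent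
cell.  For Hall's condition, let [Q] be the cells met by a finite subset of
[S]: their union has at most [C] times its perimeter more elements of [S] than
of [S'].  This perimeter is at most the sum of those of the adjacent cells out
of [Q], and each large enough cell contains more elements of [S'] than [C]
times its own perimeter. *)
Lemma balanced_injection (C : nat) (S S' : pred site) :
  (forall s, S s || S' s) -> balanced C S S' ->
  exists (K : nat) (f : site -> site),
    (forall s, S s -> [/\ S' (f s), `|(f s - s).1| <= K%:Z & `|(f s - s).2| <= K%:Z])
    /\ {in S &, injective f}.
Proof.
(* As [12 * C <= L], a cell contains at least [(L^2 - 4 L C) / 2 >= 4 L C]
   points of [S']. *)
move=> SS' bal; pose L := (12 * C).+1; have L0 : (0 < L)%N by [].
pose N u := seq_fset tt [seq s <- blow L (nbr_cells [fset cell L u]%fset) | S' s].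
have inN u s : (s \in N u) = S' s && (cell L s \in nbr_cells [fset cell L u]%fset).
  by rewrite /N seq_fsetE mem_filter mem_blow.
pose cR (P : pred site) (A : {fset site}) : R := \sum_(s <- A) (P s)%:R.
have cell_count q : (4 * L * C)%:R <= cR S' (blow L [fset q]%fset).
  have b := bal (blow L [fset q]%fset).
  have p := perimeter_cell_le R L0 q.
  have t : (L * L)%:R <= cR S (blow L [fset q]%fset) + cR S' (blow L [fset q]%fset).
    rewrite /cR -big_split /= -(sum_offs_perm q (fun s => (S s)%:R + (S' s)%:R)) //.
    have -> : (L * L)%:R = \sum_(o <- offs L) (1 : R).
      by rewrite big_const_seq iter_addr_0 count_predT size_allpairs !size_iota.
    apply: ler_sum => o _; rewrite -natrD ler1n.
    by case/orP: (SS' (base L q + o)) => ->; rewrite ?addn1 ?addSn.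
  have C0 : 0 <= C%:R :> R by [].
  have Lge : 12 * C%:R <= L%:R :> R by rewrite -natrM ler_nat.
  have L0R : 0 <= L%:R :> R by [].
  have := ler_wpM2l C0 p; rewrite !natrM in t *.
  have := ler_wpM2l L0R Lge.
  move: b; rewrite -/(cR S _) -/(cR S' _) ler_norml => /andP[_ b].
  move: (cR S _) (cR S' _) b t => x y b t; lra.
have hN : hall S N.
  move=> A AS; pose Q := [fset cell L u | u in A]%fset.
  pose O := (nbr_cells Q `\` Q)%fset.
  have QN : forall q, q \in Q -> q \in nbr_cells Q.
    by move=> q qQ; apply/mem_nbr_cells; exists q => //; rewrite subrr normr0.
  pose B := [seq s <- blow L (nbr_cells Q) | S' s].
  have B_uniq : uniq B by rewrite filter_uniq // fset_uniq.
  apply: (@leq_trans (size B)); last first.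
    apply: uniq_leq_size => // s; rewrite mem_filter mem_blow // => /andP[S's].
    move=> /mem_nbr_cells[_ /imfsetP[u /= uA ->] d]; apply/in_nbhd; exists u => //.
    by rewrite inN S's; apply/mem_nbr_cells; exists (cell L u); rewrite ?inE.
  have cB : (size B)%:R = cR S' (blow L (nbr_cells Q)).
    rewrite /B size_filter -sum1_count natr_sum big_mkcond /=.
    by apply: eq_bigr => s _; case: (S' s).
  have cA : #|` A|%:R <= cR S (blow L Q).
    have -> : cR S (blow L Q) = (size [seq s <- blow L Q | S s])%:R.
      rewrite size_filter -sum1_count natr_sum [RHS]big_mkcond /=.
      by apply: eq_bigr => s _; case: (S s).
    rewrite ler_nat; apply: uniq_leq_size; first exact: fset_uniq.
    move=> s sA; rewrite mem_filter AS //= mem_blow //.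
    by apply/imfsetP; exists s.
  rewrite -(ler_nat R) cB; apply: (le_trans cA).
  have nbrE : cR S' (blow L (nbr_cells Q)) =
      cR S' (blow L Q) + \sum_(q <- O) cR S' (blow L [fset q]%fset).
    have sE (P : {fset site}) : cR S' (blow L P) = \sum_(q <- P) cR S' (blow L [fset q]%fset).
      rewrite /cR sum_blow //; apply: eq_bigr => q _.
      by rewrite (sum_offs_perm q (fun s => (S' s)%:R)).
    rewrite !sE -big_cat; apply: perm_big; apply: uniq_perm; rewrite ?fset_uniq //.
      rewrite cat_uniq !fset_uniq andbT /=; apply/hasPn => q.
      by rewrite in_fsetD => /andP[].
    move=> q; rewrite mem_cat in_fsetD; case: (boolP (q \in Q)) => qQ //=.
    by rewrite QN.
  have b := bal (blow L Q); rewrite -/(cR S _) -/(cR S' _) in b.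
  have pQ := perimeter_blow_le R L0 Q; rewrite -/O in pQ.
  have C0 : 0 <= C%:R :> R by [].
  have pO : C%:R * perimeter R (blow L Q) <= \sum_(q <- O) cR S' (blow L [fset q]%fset).
    apply: (le_trans (ler_wpM2l C0 pQ)); rewrite mulr_sumr; apply: ler_sum => q _.
    apply: le_trans (cell_count q); rewrite mulnC natrM ler_wpM2l //.
    exact: perimeter_cell_le.
  move: b; rewrite nbrE ler_norml => /andP[_ b].
  by move: (cR S _) (cR S' _) b pO => x y b pO; lra.
have [f [fN f_inj]] := hall_injection hN.
exists (2 * L)%N, f; split=> // s Ss.
have := fN s Ss; rewrite inN => /andP[-> /mem_nbr_cells[q /fset1P ->]] [d1 d2].
have := cell_eqE L0 s (cell L s); have := cell_eqE L0 (f s) (cell L (f s)).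
rewrite !eqxx => /esym /andP[/andP[a1 a2] /andP[a3 a4]] /esym /andP[/andP[b1 b2] /andP[b3 b4]].
split=> //.
  move: d1 a1 a2 b1 b2; rewrite /=; move: (cell L (f s)).1 (cell L s).1 (f s).1 s.1 L0.
  by clear; nia.
move: d2 a3 a4 b3 b4; rewrite /=; move: (cell L (f s)).2 (cell L s).2 (f s).2 s.2 L0.
by clear; nia.
Qed.

Lemma balanced_bijection (C : nat) (S S' : pred site) :
  (forall s, S s || S' s) -> balanced C S S' ->
  exists (K : nat) (h : site -> site), set_bij [set s | S s]%classic [set s | S' s]%classic h /\
    forall s, S s -> `|(h s - s).1| <= K%:Z /\ `|(h s - s).2| <= K%:Z.
Proof.
move=> SS' bal; have S'S s : S' s || S s by rewrite orbC.
have [K [f [fP fI]]] := balanced_injection SS' bal.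
have [K' [g [gP gI]]] := balanced_injection S'S (balanced_sym bal).
have [||||h [hb hP]] := @schroeder_bernstein_tracked site [set s | S s]%classic
   [set s | S' s]%classic f g.
- by move=> s /fP[].
- by move=> s t /set_mem /= Ss /set_mem /= St; apply: fI.
- by move=> s /gP[].
- by move=> s t /set_mem /= Ss /set_mem /= St; apply: gI.
exists (K + K')%N, h; split=> // s Ss; have [->|[S'h gh]] := hP s Ss.
  by have [_ h1 h2] := fP s Ss; move: h1 h2; clear; lia.
have [_] := gP (h s) S'h; rewrite gh.
have sw (x y : site) : (x - y).1 = - (y - x).1 /\ (x - y).2 = - (y - x).2.
  by split; rewrite /= opprB.
by rewrite (sw s (h s)).1 (sw s (h s)).2 !normrN; lia.
Qed.
End Laczkovich.

Section EvenOdd.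
Variables (R : realType) (e : R).
Hypotheses (e_gt : 2 / 5 < e) (e_lt : e < 1 / 2) (eE : e ^+ 3 = 1 - 2 * e).

(** The origin is the only site over which both endpoints 0 and 1 of the window
[0, 1] are attained; this is why it belongs to the two sets. *)
Lemma even_odd_bijection : exists (K : nat) (h : site -> site),
  set_bij [set s | sgn e s == 1]%classic [set s | (sgn e s != 1) || (s == 0)]%classic h /\
  forall s, sgn e s == 1 -> `|(h s - s).1| <= K%:Z /\ `|(h s - s).2| <= K%:Z.
Proof.
have [C HC] := exists_strip_count_bound e_gt e_lt eE.
apply: (@balanced_bijection R (4 * C + 2) (fun s => sgn e s == 1)
   (fun s => (sgn e s != 1) || (s == 0))).
  by move=> s; case: (sgn e s == 1).
move=> A; have [->|A0] := eqVneq A fset0.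
  by rewrite !big_seq_fset0 subrr normr0 mulr_ge0 // perimeter_ge0.
have d := discrepancy_le_perimeter e_gt e_lt eE A HC.
have p1 := perimeter_ge1 R A0.
have N11 : (-1 == 1 :> R) = false by apply/eqP; lra.
have sgnE s : sgn e s = (sgn e s == 1)%:R - (sgn e s != 1)%:R.
  have /eqP := sgn_sqr e s; rewrite -expr2 sqrf_eq1 => /orP[] /eqP ->.
    by rewrite eqxx subr0.
  by rewrite N11 sub0r.
have sgn0 : sgn e 0 = 1.
  have -> : sgn e 0 = sgn_pt R 0.
    rewrite /sgn (_ : (0 : site) = site_of 0) // lift_pt_unique //.
    by rewrite /yval /= mulr0z !mulr0 !addr0 lexx ltr01.
  by rewrite /sgn_pt /= !addr0 expr0z.
have E : \sum_(s <- A) (sgn e s == 1)%:R - \sum_(s <- A) ((sgn e s != 1) || (s == 0))%:R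
   = \sum_(s <- A) sgn e s - (0 \in A)%:R.
  have -> : (0 \in A)%:R = \sum_(s <- A) (s == 0)%:R :> R.
    case: (boolP (0 \in A)) => [A0'|nA].
      rewrite (big_rem (0 : site)) //= big1_seq ?addr0 // => s /andP[_].
      by rewrite mem_rem_uniq ?fset_uniq // inE => /andP[/negbTE ->].
    rewrite big1_seq // => s /andP[_ sA]; case: eqP => // s0.
    by rewrite -s0 sA in nA.
  rewrite -!sumrB; apply: eq_bigr => s _; rewrite [in RHS]sgnE.
  have [->|s0] := eqVneq s 0; first by rewrite sgn0 !eqxx /= subrr subr0 subrr.
  by rewrite orbF subr0.
rewrite E; apply: (le_trans (ler_normB _ _)).
have -> : (4 * C + 2)%:R * perimeter R A =
   (4 * C + 1)%:R * perimeter R A + perimeter R A.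
  by rewrite !natrD; ring.
apply: lerD => //; apply: le_trans p1.
by case: (0 \in A); rewrite ?normr1 ?normr0.
Qed.
End EvenOdd.

(** * Null sets have empty interior *)

Local Open Scope classical_set_scope.
Local Open Scope ring_scope.

Section NullSets.
Variable R : realType.

Lemma measure_segment (c d : R) : c <= d ->
  (lebesgue_measure `[c, d]%classic = (d - c)%:E)%E.
Proof.
move=> cd; rewrite lebesgue_measure_itv /=; case: ifPn; rewrite lte_fin => //.
by rewrite -leNgt => dc; rewrite (@le_anti _ _ c d) ?subrr // cd dc.
Qed.

(** Induction on the dimension: the boxes [k] met by a slice orthogonal to the
last axis cover this slice, and it remains to integrate the inequalities for
the slices.  The predicate [P] selects these boxes. *)
Lemma box_cover_le (n : nat) (a b : nat -> R) (c d : nat -> nat -> R) (P : pred nat) :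
  (forall i, (i < n)%N -> a i <= b i) ->
  (forall k i, (i < n)%N -> c k i <= d k i) ->
  (forall x : nat -> R, (forall i, (i < n)%N -> a i <= x i <= b i) ->
     exists2 k, P k & forall i, (i < n)%N -> c k i <= x i <= d k i) ->
  ((\prod_(i < n) (b i - a i))%:E <=
    \sum_(k <oo) ((P k)%:R * \prod_(i < n) (d k i - c k i))%:E)%E.
Proof.
have vol0 m (u v : nat -> R) : (forall i, (i < m)%N -> u i <= v i) ->
    0 <= \prod_(i < m) (v i - u i).
  by move=> uv; apply: prodr_ge0 => i _; rewrite subr_ge0 uv.
elim: n P => [|n IH] P ab cd cov.
  have [//|k Pk _] := cov (fun=> 0); rewrite big_ord0.
  under eq_eseriesr do rewrite big_ord0 mulr1.
  rewrite (@nneseriesD1 _ _ k xpredT) //.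
  by rewrite Pk leeDl // nneseries_ge0.
have ab' i : (i < n)%N -> a i <= b i by move=> ni; apply: ab; rewrite ltnS ltnW.
have cd' k i : (i < n)%N -> c k i <= d k i by move=> ni; apply: cd; rewrite ltnS ltnW.
pose V := \prod_(i < n) (b i - a i); pose v k := \prod_(i < n) (d k i - c k i).
have v0 k : 0 <= (P k)%:R * v k by rewrite mulr_ge0 // vol0 // => i; exact: cd'.
pose J k : set R := `[c k n, d k n]%classic.
pose g k s : \bar R := ((P k)%:R * v k * \1_(J k) s)%:E.
have slice s : `[a n, b n]%classic s -> (V%:E <= \sum_(k <oo) g k s)%E.
  rewrite /= in_itv /= => sab.
  apply: (le_trans (IH (fun k => P k && (c k n <= s <= d k n)) ab' cd' _)).
    move=> x xab.
    have [|k Pk xk] := cov (fun i => if i == n then s else x i).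
      move=> i; rewrite ltnS leq_eqVlt; case: eqVneq => [->|_] //= /xab //.
    exists k; first by have := xk n (ltnSn n); rewrite eqxx Pk.
    by move=> i ni; have := xk i (ltnW ni); rewrite ltn_eqF.
  apply: lee_nneseries => [k _ _|k _].
    by rewrite lee_fin mulr_ge0 // vol0 // => i; exact: cd'.
  rewrite lee_fin /J indicE mem_setE in_itv /=.
  by case: (P k) => /=; rewrite ?mul0r // mul1r mulrC.
have mJ k : measurable (J k) by exact: measurable_itv.
have g0 k s : (0 <= g k s)%E by rewrite lee_fin mulr_ge0.
have mg k : measurable_fun `[a n, b n]%classic (g k).
  apply/measurable_EFinP; apply: measurable_funM => //.
rewrite big_ord_recr /= -/V EFinM.
have -> : (V%:E * (b n - a n)%:E = \int[lebesgue_measure]_(s in `[a n, b n]%classic) V%:E)%E.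
  rewrite integral_cst //; congr (_ * _)%E; apply/esym/measure_segment.
  exact: ab.
apply: (@le_trans _ _ (\int[lebesgue_measure]_(s in `[a n, b n]%classic) \sum_(k <oo) g k s)%E).
  apply: ge0_le_integral => //.
  - by move=> s _; rewrite lee_fin vol0.
  - exact: (ge0_emeasurable_sum (fun k x _ _ => g0 k x) (fun k _ => mg k)).
rewrite integral_nneseries //; apply: lee_nneseries => [k _ _|k _].
  by apply: integral_ge0.
have neg0 : (P k)%:R * v k < 0 -> J k = set0.
  by move=> neg; exfalso; move: (v0 k); rewrite leNgt neg.
rewrite (@integralZl_indic _ _ _ lebesgue_measure _ _ (fun=> J k)) //; last exact: measurable_itv.
rewrite integral_indic; try exact: measurable_itv.
rewrite big_ord_recr /= mulrA [leRHS]EFinM -/(v k).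
apply: lee_wpmul2l; first by rewrite lee_fin.
rewrite -(measure_segment (cd k n (ltnSn n))).
apply: le_measure; rewrite ?inE.
- by apply: measurableI; exact: measurable_itv.
- exact: measurable_itv.
- by move=> x [].
Qed.

Lemma box_volume_le (n : nat) (A : set 'rV[R]_n) (a b : 'rV[R]_n) :
  (forall i, a 0 i <= b 0 i) -> box a b `<=` A ->
  ((box_volume a b)%:E <= lebesgue_outer_measure A)%E.
Proof.
move=> ab abA; apply: le_ereal_inf_tmp => _ [c [cle Ac] <-].
pose ext (x : 'rV[R]_n) (i : nat) : R := if insub i is Some j then x 0 j else 0.
have extE (x : 'rV[R]_n) (i : 'I_n) : ext x i = x 0 i by rewrite /ext valK.
have extP (p : R -> R -> Prop) (x y : 'rV[R]_n) : (forall i, p (x 0 i) (y 0 i)) ->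
    forall i, (i < n)%N -> p (ext x i) (ext y i).
  by move=> H i ni; rewrite -[i]/(nat_of_ord (Ordinal ni)) !extE.
have -> : box_volume a b = \prod_(i < n) (ext b i - ext a i).
  by apply: eq_bigr => i _; rewrite !extE.
have -> : (\sum_(k <oo) (box_volume (c k).1 (c k).2)%:E =
  \sum_(k <oo) ((xpredT k)%:R * \prod_(i < n) (ext (c k).2 i - ext (c k).1 i))%:E)%E.
  apply: eq_eseriesr => k _; rewrite mul1r; congr (_%:E).
  by apply: eq_bigr => i _; rewrite !extE.
apply: (@box_cover_le n (ext a) (ext b) (fun k => ext (c k).1) (fun k => ext (c k).2) xpredT).
- exact: (extP (fun x y => x <= y)).
- by move=> k; exact: (extP (fun x y => x <= y)).
- move=> x xab; pose x' : 'rV[R]_n := \row_i x i.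
  have /abA /Ac[k _ xk] : box a b x'.
    by move=> i; rewrite mxE; have := xab i (ltn_ord i); rewrite !extE.
  exists k => // i ni; have := xk (Ordinal ni).
  by rewrite mxE -!extE.
Qed.

Lemma null_set_no_interior (n : nat) (A : set 'rV[R]_n) (x : 'rV[R]_n) (r : R) :
  lebesgue_null A -> 0 < r -> (forall y : 'rV[R]_n, (forall i, `|y 0 i - x 0 i| <= r) -> A y) -> False.
Proof.
move=> A0 r0 xA.
pose a : 'rV[R]_n := \row_i (x 0 i - r); pose b : 'rV[R]_n := \row_i (x 0 i + r).
have := @box_volume_le n A a b; rewrite A0 lee_fin.
have -> : box_volume a b = (r + r) ^+ n.
  rewrite /box_volume; under eq_bigr do rewrite !mxE.
  have E i : x 0 i + r - (x 0 i - r) = r + r by ring.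
  by under eq_bigr do rewrite E; rewrite prodr_const card_ord.
rewrite leNgt exprn_gt0 ?addr_gt0 // => H; suff: false by []; apply: H.
  by move=> i; rewrite !mxE; lra.
move=> y yab; apply: xA => i; have := yab i; rewrite !mxE ler_norml.
by move=> /andP[? ?]; apply/andP; split; lra.
Qed.
End NullSets.

(** * Sets cut out by finitely many half-spaces *)

Section SemilinearSets.
Variables (R : realType) (n : nat).
Implicit Types (l : 'rV[R]_n * R) (ls : seq ('rV[R]_n * R)) (P : set 'rV[R]_n)
  (x y z : 'rV[R]_n).

Definition aff l x : R := \sum_i x 0 i * l.1 0 i + l.2.

Definition same_signs ls x y : Prop :=
  forall l, l \in ls -> (0 <= aff l x) = (0 <= aff l y).

(** The set is a union of cells of the arrangement of the hyperplanes
[aff l = 0], the sign 0 being counted as positive. *)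
Definition determined ls P : Prop := forall x y, same_signs ls x y -> P x -> P y.

Definition bounded_by (B : R) P : Prop := forall x, P x -> forall i, `|x 0 i| <= B.

Lemma same_signs_sym ls x y : same_signs ls x y -> same_signs ls y x.
Proof. by move=> h l /h ->. Qed.

Lemma same_signs_sub ls ls' x y : {subset ls <= ls'} ->
  same_signs ls' x y -> same_signs ls x y.
Proof. by move=> sub h l /sub /h. Qed.

Lemma determined_sub ls ls' P : {subset ls <= ls'} -> determined ls P -> determined ls' P.
Proof. by move=> sub d x y /(same_signs_sub sub); exact: d. Qed.

Lemma affD l x y : aff l (x + y) = aff l x + \sum_i y 0 i * l.1 0 i.
Proof.
rewrite /aff addrAC -big_split /=; congr (_ + _).
by apply: eq_bigr => i _; rewrite mxE mulrDl.
Qed.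

(** The barycentric coordinates are affine functions. *)
Lemma simplex_determined (S : set 'rV[R]_n) : is_simplex S ->
  (exists ls, determined ls S) /\ (exists B, bounded_by B S).
Proof.
move=> [p]; rewrite /affinely_independent; set M := \matrix_(i < n) _ => pfree ->.
have Mu : M \in unitmx by rewrite -row_free_unit.
pose t0 (x : 'rV[R]_n) := (x - p ord0) *m invmx M.
have hullP x : convex_hull p x <-> (forall i, 0 <= t0 x 0 i) /\ \sum_i t0 x 0 i <= 1.
  split.
    move=> [t [t_ge0 t1] <-].
    have E : t0 (\sum_(i < n.+1) t i *: p i) = \row_i t (lift ord0 i).
      rewrite /t0; apply: (canLR (mulmxK Mu)); rewrite mulmx_sum_row.
      have tp : p ord0 = \sum_(i < n.+1) t i *: p ord0 by rewrite -scaler_suml t1 scale1r.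
      rewrite {1}tp -sumrB big_ord_recl subrr add0r; apply: eq_bigr => i _.
      by rewrite rowK !mxE scalerBr.
    rewrite E; split=> [i|]; first by rewrite mxE.
    under eq_bigr do rewrite mxE.
    by rewrite -t1 big_ord_recl lerDr.
  move=> [h0 h1]; pose t (i : 'I_n.+1) :=
    if unlift ord0 i is Some j then t0 x 0 j else 1 - \sum_j t0 x 0 j.
  have tl j : t (lift ord0 j) = t0 x 0 j by rewrite /t liftK.
  have tz : t ord0 = 1 - \sum_j t0 x 0 j by rewrite /t unlift_none.
  exists t; first split.
  - move=> i; rewrite /t; case: unlift => [j|] //; by rewrite subr_ge0.
  - rewrite big_ord_recl tz; under [X in _ + X]eq_bigr do rewrite tl.
    by rewrite subrK.
  - have xE : x = p ord0 + t0 x *m M by rewrite /t0 mulmxKV // addrC subrK.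
    rewrite [RHS]xE mulmx_sum_row big_ord_recl tz scalerBl scale1r -addrA; congr (_ + _).
    rewrite scaler_suml addrC -sumrB; apply: eq_bigr => i _.
    by rewrite tl rowK scalerBr.
pose lf (i : 'I_n) : 'rV[R]_n * R := (\row_j invmx M j i, - (p ord0 *m invmx M) 0 i).
pose l0 : 'rV[R]_n * R := (\row_j - \sum_i invmx M j i, 1 + \sum_i (p ord0 *m invmx M) 0 i).
have lfE i x : aff (lf i) x = t0 x 0 i.
  rewrite /aff /lf /= /t0 mulmxBl !mxE; congr (_ + _).
  by apply: eq_bigr => j _; rewrite mxE.
have l0E x : aff l0 x = 1 - \sum_i t0 x 0 i.
  have -> : \sum_i t0 x 0 i = \sum_j \sum_i x 0 j * (lf i).1 0 j - \sum_i (p ord0 *m invmx M) 0 i.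
    rewrite exchange_big -sumrB /=; apply: eq_bigr => i _.
    by rewrite -lfE /aff.
  have A : \sum_j x 0 j * l0.1 0 j = - \sum_j \sum_i x 0 j * (lf i).1 0 j.
    rewrite -sumrN; apply: eq_bigr => j _; rewrite mxE mulrN mulr_sumr.
    by congr (- _); apply: eq_bigr => i _; rewrite mxE.
  by rewrite /aff A /l0 /=; ring.
split.
  exists (l0 :: [seq lf i | i <- enum 'I_n]) => x y sxy /hullP[h0 h1]; apply/hullP; split.
    by move=> i; rewrite -lfE -sxy ?lfE // inE map_f ?orbT // mem_enum.
  have := sxy l0 (mem_head _ _); rewrite !l0E !subr_ge0 h1 => /esym; exact.
exists (\sum_(i < n.+1) \sum_j `|p i 0 j|) => x [t [t_ge0 t1] <-] j.
rewrite summxE; apply: (le_trans (ler_norm_sum _ _ _)); apply: ler_sum => i _.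
rewrite mxE normrM ger0_norm //; apply: (@le_trans _ _ (1 * `|p i 0 j|)).
  rewrite ler_wpM2r // -t1 (bigD1 i) //= lerDl sumr_ge0 //.
by rewrite mul1r (bigD1 j) //= lerDl sumr_ge0.
Qed.

Lemma bigcup_determined (s : nat) (S : 'I_s -> set 'rV[R]_n) :
  (forall i, (exists ls, determined ls (S i)) /\ (exists B, bounded_by B (S i))) ->
  (exists ls, determined ls (\bigcup_i S i)) /\ (exists B, bounded_by B (\bigcup_i S i)).
Proof.
move=> H; have /choice[L LP] i := (H i).1; have /choice[B BP] i := (H i).2.
split.
  exists (flatten [seq L i | i <- enum 'I_s]) => x y sxy [i _ Six]; exists i => //.
  apply: LP Six => l lL; apply: sxy; apply/flattenP; exists (L i) => //.
  by apply: map_f; rewrite mem_enum.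
exists (\sum_i `|B i|) => x [i _ /BP Bi] j; apply: (le_trans (Bi j)).
by apply: (le_trans (ler_norm _)); rewrite (bigD1 i) //= lerDl sumr_ge0.
Qed.

Lemma polytope_determined P : is_polytope P ->
  (exists ls, determined ls P) /\ (exists B, bounded_by B P).
Proof.
by move=> [s [S [hS _ ->]]]; apply: bigcup_determined => i; exact: simplex_determined.
Qed.

Lemma translate_determined P (g : 'rV[R]_n) :
  (exists ls, determined ls P) /\ (exists B, bounded_by B P) ->
  (exists ls, determined ls [set x + g | x in P]) /\
  (exists B, bounded_by B [set x + g | x in P]).
Proof.
move=> [[ls dP] [B bP]]; split.
  exists [seq (l.1, l.2 - \sum_i g 0 i * l.1 0 i) | l <- ls] => x y sxy [z Pz zx].
  exists (y - g); last by rewrite subrK.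
  apply: dP Pz => l ll; have := sxy _ (map_f _ ll).
  have E w : aff (l.1, l.2 - \sum_i g 0 i * l.1 0 i) w = aff l (w - g).
    rewrite affD /aff /= addrA; congr (_ + _); rewrite -sumrN.
    by apply: eq_bigr => i _; rewrite mxE mulNr.
  by rewrite !E -zx addrK.
exists (B + \sum_i `|g 0 i|) => _ [x Px <-] i; rewrite mxE.
apply: (le_trans (ler_normD _ _)); apply: lerD; first exact: bP.
by rewrite (bigD1 i) //= lerDl sumr_ge0.
Qed.

Lemma box_determined (a b : 'rV[R]_n) :
  (exists ls, determined ls (box a b)) /\ (exists B, bounded_by B (box a b)).
Proof.
split.
  pose lo i : 'rV[R]_n * R := (delta_mx 0 i, - a 0 i).
  pose hi i : 'rV[R]_n * R := (- delta_mx 0 i, b 0 i).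
  have sumd x i : \sum_j x 0 j * (delta_mx 0 i : 'rV[R]_n) 0 j = x 0 i.
    rewrite (bigD1 i) //= big1 ?addr0; first by rewrite mxE !eqxx mulr1.
    by move=> j ji; rewrite mxE eqxx (negbTE ji) mulr0.
  have loE x i : aff (lo i) x = x 0 i - a 0 i by rewrite /aff /lo /= sumd.
  have hiE x i : aff (hi i) x = b 0 i - x 0 i.
    rewrite /aff /hi /= addrC; congr (_ + _); rewrite -(sumd x i) -sumrN.
    by apply: eq_bigr => j _; rewrite mxE mulrN.
  exists ([seq lo i | i <- enum 'I_n] ++ [seq hi i | i <- enum 'I_n]) => x y sxy xab i.
  have := sxy (lo i); have := sxy (hi i).
  rewrite !mem_cat !map_f ?orbT ?mem_enum // !loE !hiE !subr_ge0.
  by have /andP[-> ->] := xab i => <- // <-.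
exists (\sum_i (`|a 0 i| + `|b 0 i|)) => x xab i; have /andP[h1 h2] := xab i.
apply: (@le_trans _ _ (`|a 0 i| + `|b 0 i|)).
  have := ler_norm (b 0 i); have := ler_norm (- a 0 i); rewrite normrN => ha hb.
  rewrite ler_norml; have := normr_ge0 (a 0 i); have := normr_ge0 (b 0 i).
  by move=> *; apply/andP; split; lra.
by rewrite (bigD1 i) //= lerDl sumr_ge0 // => j _; rewrite addr_ge0.
Qed.
End SemilinearSets.

(** * Germs along the first axis and jumps *)

Section Germs.
Variables (R : realType) (n : nat).
Implicit Types (l : 'rV[R]_n.+1 * R) (ls : seq ('rV[R]_n.+1 * R))
  (P : set 'rV[R]_n.+1) (x y z : 'rV[R]_n.+1) (sg : R).

(** The filter of the positive neighbourhoods of 0, with explicit radii. *)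
Definition small (Q : R -> Prop) : Prop := exists2 d, 0 < d & forall t, 0 < t < d -> Q t.

Lemma small_and (Q1 Q2 : R -> Prop) : small Q1 -> small Q2 -> small (fun t => Q1 t /\ Q2 t).
Proof.
move=> [d1 p1 h1] [d2 p2 h2]; exists (Num.min d1 d2); first by rewrite lt_min p1.
by move=> t; rewrite lt_min => /andP[t0 /andP[t1 t2]]; split; [apply: h1|apply: h2]; apply/andP.
Qed.

Lemma small_all (T : eqType) (r : seq T) (Q : T -> R -> Prop) :
  (forall i, i \in r -> small (Q i)) -> small (fun t => forall i, i \in r -> Q i t).
Proof.
elim: r => [|a r IH] H; first by exists 1.
have [d d0 hd] := small_and (H a (mem_head _ _))
  (IH (fun i ir => H i (mem_behead (s := a :: r) ir))).
exists d => // t /hd[h1 h2] i; rewrite inE => /orP[/eqP-> //|]; exact: h2.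
Qed.

Lemma small_imply (Q1 Q2 : R -> Prop) : (forall t, 0 < t -> Q1 t -> Q2 t) -> small Q1 -> small Q2.
Proof. by move=> h [d d0 hd]; exists d => // t td; apply: h; [case/andP: td|exact: hd]. Qed.

Lemma small_ex (Q : R -> Prop) : small Q -> exists2 t, 0 < t & Q t.
Proof. by move=> [d d0 h]; exists (d / 2); [|apply: h]; lra. Qed.

Lemma small_lt (d : R) : 0 < d -> small (fun t => t < d).
Proof. by move=> d0; exists d => // t /andP[]. Qed.

Definition axis0 : 'rV[R]_n.+1 := delta_mx 0 ord0.

Lemma aff_axis0 l y (t : R) : aff l (y + t *: axis0) = aff l y + t * l.1 0 ord0.
Proof.
rewrite affD; congr (_ + _); rewrite (bigD1 ord0) //= big1 ?addr0.
  by rewrite !mxE eqxx mulr1.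
by move=> i i0; rewrite !mxE eqxx (negbTE i0) !mulr0 mul0r.
Qed.

Lemma small_sign l y sg : exists b : bool,
  small (fun t => (0 <= aff l (y + (sg * t) *: axis0)) = b).
Proof.
set v := aff l y; set u := sg * l.1 0 ord0.
have u1 : 0 < `|u| + 1 by rewrite ltr_wpDl.
have E t : aff l (y + (sg * t) *: axis0) = v + t * u.
  by rewrite aff_axis0 /u /v; ring.
have [v0|v0|v0] := ltgtP v 0.
- exists false; exists (- v / (`|u| + 1)).
    by rewrite divr_gt0 ?oppr_gt0.
  move=> t /andP[t0]; rewrite ltr_pdivlMr // => tv; rewrite E.
  apply/negbTE; rewrite -ltNge.
  by have := ler_wpM2l (ltW t0) (ler_norm u); lra.
- exists true; exists (v / (`|u| + 1)).
    by rewrite divr_gt0.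
  move=> t /andP[t0]; rewrite ltr_pdivlMr // => tv; rewrite E.
  suff : 0 <= v + t * u by [].
  have := ler_wpM2l (ltW t0) (ler_norm (- u)); rewrite normrN; lra.
- exists (0 <= u); exists 1 => // t /andP[t0 _].
  by rewrite E v0 add0r pmulr_rge0.
Qed.

Definition germ P y sg : Prop := small (fun t => P (y + (sg * t) *: axis0)).

(** The sign of an affine function is constant on the beginning of a half-line,
so that a set determined by finitely many signs contains either all points of
the beginning of the half-line or none. *)
Lemma germ_const ls y sg :
  small (fun t => forall P, determined ls P -> (P (y + (sg * t) *: axis0) <-> germ P y sg)).
Proof.
have /choice[b bP] l := small_sign l y sg.
have [d d0 hd] := small_all (fun l (_ : l \in ls) => bP l).
exists d => // t td P dP; split=> [Pt|[d' d'0 h]].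
  exists d => // t' t'd; apply: dP Pt => l ll.
  by rewrite (hd t td l ll) (hd t' t'd l ll).
pose t' := Num.min d d' / 2.
have m0 : 0 < Num.min d d' by rewrite lt_min d0.
have m1 : Num.min d d' <= d by rewrite ge_min lexx.
have m2 : Num.min d d' <= d' by rewrite ge_min lexx orbT.
have t'd : 0 < t' < d by rewrite /t'; apply/andP; split; lra.
have /h : 0 < t' < d' by rewrite /t'; apply/andP; split; lra.
by apply: dP => l ll; rewrite (hd t td l ll) (hd t' t'd l ll).
Qed.

(** Only the hyperplanes orthogonal to the first axis may pass through [y]. *)
Definition generic ls y : Prop := forall l, l \in ls ->
  (exists2 i, i != ord0 & l.1 0 i != 0) -> aff l y != 0.

Lemma aff_open l z : aff l z != 0 -> exists2 r, 0 < r &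
  forall w : 'rV[R]_n.+1, (forall i, `|w 0 i - z 0 i| <= r) -> (0 <= aff l w) = (0 <= aff l z).
Proof.
move=> vN0; set v := aff l z in vN0 *; pose s := \sum_i `|l.1 0 i|.
have s0 : 0 <= s by rewrite sumr_ge0.
have av : 0 < `|v| by rewrite normr_gt0.
exists (`|v| / (2 * (s + 1))); first by rewrite divr_gt0 // mulr_gt0 // ltr_wpDl.
move=> w wz; have -> : w = z + (w - z) by rewrite addrC subrK.
rewrite affD -/v; set q := \sum_i _.
have : `|q| <= `|v| / 2.
  apply: (@le_trans _ _ (`|v| / (2 * (s + 1)) * s)).
    apply: (le_trans (ler_norm_sum _ _ _)); rewrite mulr_sumr; apply: ler_sum => i _.
    by rewrite normrM ler_wpM2r // !mxE.
  have -> : `|v| / (2 * (s + 1)) * s = `|v| / 2 * (s / (s + 1)).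
    by field; rewrite gt_eqF // ltr_wpDl.
  by rewrite ler_piMr ?divr_ge0 // ler_pdivrMr ?ltr_wpDl // mul1r lerDl.
rewrite ler_norml => /andP[q1 q2]; move: av q1 q2.
have [v0|v0] := ltP v 0; first by rewrite ltr0_norm // => *; apply/idP/idP; lra.
by rewrite ger0_norm // => *; apply/idP/idP; lra.
Qed.

(** From a generic point, a small move along the first axis leaves all the
hyperplanes, including those that are orthogonal to this axis. *)
Lemma generic_open ls y sg : sg != 0 -> generic ls y ->
  small (fun t => exists2 r, 0 < r & forall w : 'rV[R]_n.+1,
     (forall i, `|w 0 i - (y + (sg * t) *: axis0) 0 i| <= r) ->
     same_signs ls w (y + (sg * t) *: axis0)).
Proof.
move=> sg0 gen.
have one l : l \in ls -> small (fun t => exists2 r, 0 < r & forall w : 'rV[R]_n.+1,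
     (forall i, `|w 0 i - (y + (sg * t) *: axis0) 0 i| <= r) ->
     (0 <= aff l w) = (0 <= aff l (y + (sg * t) *: axis0))).
  move=> ll; have [ex|nex] := pselect (exists2 i, i != ord0 & l.1 0 i != 0).
    have vN0 := gen l ll ex; have [r r0 hr] := aff_open vN0.
    have s1 : 0 < `|sg| + 1 by rewrite ltr_wpDl.
    exists (r / 2 / (`|sg| + 1)); first by rewrite !divr_gt0.
    move=> t /andP[t0]; rewrite ltr_pdivlMr // => tr.
    have close i : `|(y + (sg * t) *: axis0) 0 i - y 0 i| <= r / 2.
      rewrite !mxE eqxx addrAC subrr add0r normrM.
      apply: (@le_trans _ _ (`|sg * t| * 1)).
        by rewrite ler_wpM2l //; case: (i == ord0); rewrite ?normr1 ?normr0.
      by rewrite mulr1 normrM (gtr0_norm t0); have := normr_ge0 sg; nra.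
    exists (r / 2) => [|w wr]; first by rewrite divr_gt0.
    rewrite !hr // => i; first by apply: (le_trans (close i)); lra.
    apply: (le_trans (ler_distD ((y + (sg * t) *: axis0) 0 i) _ _)).
    have := wr i; have := close i; lra.
  have l0 i : i != ord0 -> l.1 0 i = 0.
    by move=> i0; apply/eqP; apply: contraT => li; case: nex; exists i.
  have [u0|uN0] := eqVneq (l.1 0 ord0) 0.
    have lc w : aff l w = l.2.
      rewrite /aff big1 ?add0r // => i _.
      by have [->|/l0 ->] := eqVneq i ord0; rewrite ?u0 mulr0.
    by exists 1 => // t _; exists 1 => // w _; rewrite !lc.
  have su : sg * l.1 0 ord0 != 0 by rewrite mulf_neq0.
  have [d d0 hd] : small (fun t => aff l (y + (sg * t) *: axis0) != 0).
    pose d := `|aff l y| / `|sg * l.1 0 ord0|.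
    have E t : aff l (y + (sg * t) *: axis0) = aff l y + t * (sg * l.1 0 ord0).
      by rewrite aff_axis0; ring.
    have [a0|a0] := eqVneq (aff l y) 0.
      by exists 1 => // t /andP[t0 _]; rewrite E a0 add0r mulf_neq0 // gt_eqF.
    exists d; first by rewrite divr_gt0 // normr_gt0.
    move=> t /andP[t0 td]; rewrite E; apply/eqP => /eqP.
    rewrite addr_eq0 => /eqP av; move: td; rewrite /d av normrN normrM.
    by rewrite mulfK ?normr_eq0 // gtr0_norm // ltxx.
  by exists d => // t /hd /aff_open.
have [d d0 hd] := small_all one.
exists d => // t td; have {}hd := hd t td; elim: ls {gen one} hd => [|a ls IH] hd.
  by exists 1.
have [r1 r10 h1] := hd a (mem_head _ _).
have [|r2 r20 h2] := IH _; first by move=> l ll; apply: hd; rewrite inE ll orbT.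
exists (Num.min r1 r2); first by rewrite lt_min r10.
move=> w wr l; rewrite inE => /orP[/eqP->|ll].
  by apply: h1 => i; apply: (le_trans (wr i)); rewrite ge_min lexx.
by apply: h2 => // i; apply: (le_trans (wr i)); rewrite ge_min lexx orbT.
Qed.

Definition germ_ind P y sg : int := (`[< germ P y sg >] : nat)%:Z.
Definition jump P y : int := germ_ind P y 1 - germ_ind P y (-1).

(** A partition up to a null set says nothing at a given point, but the complement
of [X] has no interior: close to the half-line issued from [y] there is a
point of [X] with the same signs as the germ. *)
Lemma germ_ind_partition ls k (P : 'I_k -> set 'rV[R]_n.+1) (A X : set 'rV[R]_n.+1) y sg :
  sg != 0 -> lebesgue_null (~` X) -> generic ls y ->
  determined ls A -> (forall j, determined ls (P j)) ->
  partition [set: 'I_k] (fun j => P j `&` X) (A `&` X) ->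
  germ_ind A y sg = \sum_j germ_ind (P j) y sg.
Proof.
move=> sg0 X0 gen dA dP [cov triv _].
have [t t0 [gc [r r0 hr]]] := small_ex (small_and (germ_const ls y sg) (generic_open sg0 gen)).
set z := y + _ in gc hr.
have [w Xw wr] : exists2 w, X w & forall i, `|w 0 i - z 0 i| <= r.
  apply: contrapT => no; apply: (@null_set_no_interior R n.+1 (~` X) z r X0 r0) => w wr Xw.
  by apply: no; exists w.
have sw := hr w wr.
have tr Q : determined ls Q -> `[< germ Q y sg >] = `[< Q w >].
  move=> dQ; apply: asbool_equiv_eq; rewrite -(gc Q dQ); split.
    by apply: dQ; apply: same_signs_sym.
  exact: dQ.
rewrite /germ_ind (tr A dA); under eq_bigr do rewrite (tr _ (dP _)).
case: (asboolP (A w)) => [Aw|nAw].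
  have [j _ [Pjw _]] : cover [set: 'I_k] (fun j => P j `&` X) w by rewrite cov.
  rewrite (bigD1 j) //= (asboolT Pjw) big1 ?addr0 // => i ij.
  rewrite asboolF // => Piw; case/eqP: ij.
  by apply: (triv i j) => //; exists w.
rewrite big1 // => j _; rewrite asboolF // => Pjw; apply: nAw.
have : cover [set: 'I_k] (fun j => P j `&` X) w by exists j.
by rewrite cov => -[].
Qed.

Lemma jump_partition ls k (P : 'I_k -> set 'rV[R]_n.+1) (A X : set 'rV[R]_n.+1) y :
  lebesgue_null (~` X) -> generic ls y ->
  determined ls A -> (forall j, determined ls (P j)) ->
  partition [set: 'I_k] (fun j => P j `&` X) (A `&` X) ->
  jump A y = \sum_j jump (P j) y.
Proof.
move=> X0 gen dA dP part.
by rewrite /jump !(germ_ind_partition _ X0 gen dA dP part) ?oppr_eq0 ?oner_eq0 // sumrB.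
Qed.

Lemma jump_translate P g y : jump [set x + g | x in P] y = jump P (y - g).
Proof.
have E sg : germ [set x + g | x in P] y sg <-> germ P (y - g) sg.
  have eqt (t : R) : y - g + (sg * t) *: axis0 = y + (sg * t) *: axis0 - g by rewrite addrAC.
  split; apply: small_imply => t _; rewrite eqt.
    by move=> [x Px <-]; rewrite addrK.
  by move=> Pt; exists (y + (sg * t) *: axis0 - g); rewrite ?subrK.
by rewrite /jump /germ_ind !(asbool_equiv_eq (E _)).
Qed.

(** A jump at [y] requires a hyperplane of the arrangement through [y], which is
orthogonal to the first axis when [y] is generic. *)
Lemma jump_support ls P B y : determined ls P -> bounded_by B P -> generic ls y ->
  jump P y != 0 ->
  (exists2 l, l \in ls & y 0 ord0 = - l.2 / l.1 0 ord0) /\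
  forall i, `|y 0 i| <= B + 1.
Proof.
move=> dP bP gen J0; split.
  have [l ll [u0 a0]] : exists2 l, l \in ls & l.1 0 ord0 != 0 /\ aff l y = 0.
    apply: contrapT => no; case/eqP: J0.
    have one l : l \in ls -> small (fun t =>
        (0 <= aff l (y + (1 * t) *: axis0)) = (0 <= aff l (y + (-1 * t) *: axis0))).
      move=> ll; have [u0|uN0] := eqVneq (l.1 0 ord0) 0.
        by exists 1 => // t _; rewrite !aff_axis0 u0 !mulr0.
      have a0 : aff l y != 0 by apply/eqP => a0; apply: no; exists l.
      have [r r0 hr] := aff_open a0.
      exists r => // t /andP[t0 tr]; rewrite !hr // => i.
        rewrite !mxE eqxx addrAC subrr add0r mulN1r mulNr normrN normrM.
        rewrite gtr0_norm //; apply: (@le_trans _ _ (t * 1)); last by lra.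
        by rewrite ler_wpM2l ?(ltW t0) //; case: (i == ord0); rewrite ?normr1 ?normr0.
      rewrite !mxE eqxx addrAC subrr add0r mul1r normrM.
      rewrite gtr0_norm //; apply: (@le_trans _ _ (t * 1)); last by lra.
      by rewrite ler_wpM2l ?(ltW t0) //; case: (i == ord0); rewrite ?normr1 ?normr0.
    have [t t0 [sm [g1 g2]]] := small_ex (small_and (small_all one)
      (small_and (germ_const ls y 1) (germ_const ls y (-1)))).
    suff E : germ P y 1 <-> germ P y (-1) by rewrite /jump /germ_ind (asbool_equiv_eq E) subrr.
    rewrite -(g1 P dP) -(g2 P dP); split; apply: dP => l /sm -> //.
  exists l => //.
  have other i : i != ord0 -> l.1 0 i = 0.
    move=> i0; apply/eqP; apply: contraT => li.
    by have := gen l ll (ex_intro2 _ _ i i0 li); rewrite a0 eqxx.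
  move: a0; rewrite /aff (bigD1 ord0) //= big1 ?addr0; last first.
    by move=> i /other ->; rewrite mulr0.
  by move=> /eqP; rewrite addr_eq0 => /eqP <-; rewrite mulfK.
move=> i.
have [sg [sg1 gsg]] : exists sg, `|sg| = 1 /\ germ P y sg.
  apply: contrapT => no; case/eqP: J0.
  have nog sg : `|sg| = 1 -> `[< germ P y sg >] = false.
    by move=> s1; apply/asboolPn => g; apply: no; exists sg.
  by rewrite /jump /germ_ind !nog ?normrN ?normr1.
have [t t0 [Pt t1]] := small_ex (small_and gsg (small_lt ltr01)).
have := bP _ Pt i; rewrite !mxE eqxx /= => h.
have h2 : `|sg * t * (i == ord0)%:R| <= 1.
  rewrite !normrM sg1 mul1r gtr0_norm //; apply: (@le_trans _ _ (t * 1)); last by lra.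
  by rewrite ler_wpM2l ?(ltW t0) //; case: (i == ord0); rewrite ?normr1 ?normr0.
have -> : y 0 i = y 0 i + sg * t * (i == ord0)%:R - sg * t * (i == ord0)%:R by ring.
by apply: (le_trans (ler_normB _ _)); apply: lerD.
Qed.
End Germs.

(** * The orbit sum of the jumps *)

Section Countable.
Variable R : realType.

Lemma countable_avoid (A : set R) : countable A -> exists x, ~ A x.
Proof.
move=> cA; apply: contrapT => no.
have sub : `[0, 1]%classic `<=` A.
  by move=> x _; apply: contrapT => nA; apply: no; exists x.
have c01 : countable (`[0, 1]%classic : set R).
  by apply: sub_countable cA; exact: subset_card_le.
have := countable_lebesgue_measure0 c01.
rewrite (measure_segment (@ler01 R)) subr0 => -[] /eqP.
by rewrite oner_eq0.
Qed.

Lemma finite_roots (p : {poly R}) : p != 0 -> finite_set [set x | root p x].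
Proof.
move=> p0; apply: contrapT => inf.
have [B BA sB] := infinite_set_fset (size p) inf.
have := @max_poly_roots _ p (enum_fset B) p0 _ (fset_uniq B).
rewrite ltnNge sB => H; suff: false by []; apply: H.
by apply/allP => x xB; exact: BA.
Qed.
End Countable.

Section Invariant.
Variables (R : realType) (n : nat) (G : set 'rV[R]_n.+1).
Hypothesis G0 : G 0.
Hypothesis GB : forall g h, G g -> G h -> G (g - h).
Hypothesis G_countable : countable G.
Hypothesis G_slice : forall (c B : R),
  finite_set [set g | G g /\ g 0 ord0 = c /\ forall i, `|g 0 i| <= B].
Hypothesis G_one : forall g, G g -> g 0 ord0 != 1.
Hypothesis G_int : forall j : 'rV[int]_n.+1, j 0 ord0 = 0 -> G (map_mx intr j).

Implicit Types (l : 'rV[R]_n.+1 * R) (ls : seq ('rV[R]_n.+1 * R)) (x y : 'rV[R]_n.+1).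

(** On the curve [(0, d, d^2, ...)] each affine condition to be avoided is a
nonzero polynomial in [d], and there are countably many conditions. *)
Lemma exists_generic ls : exists2 x : 'rV[R]_n.+1, x 0 ord0 = 0 & forall g, G g -> generic ls (x + g).
Proof.
pose xd (d : R) : 'rV[R]_n.+1 := \row_i (if i == ord0 then 0 else d ^+ i).
pose pl l (g : 'rV[R]_n.+1) : {poly R} :=
  \poly_(i < n.+1) (if i == 0%N then aff l g else l.1 0 (inord i)).
have plE l g d : (pl l g).[d] = aff l (xd d + g).
  rewrite addrC affD /pl horner_poly !big_ord_recl /= expr0 mulr1 mxE eqxx mul0r add0r.
  congr (_ + _); apply: eq_bigr => i _; rewrite !mxE /= mulrC; congr (_ * _).
  by congr (l.1 0 _); apply: val_inj; rewrite /= inordK // ltnS ltn_ord.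
pose bad := \bigcup_(l in [set l | l \in ls /\ exists2 i, i != ord0 & l.1 0 i != 0])
   \bigcup_(g in G) [set d | root (pl l g) d].
have [d nbad] : exists d, ~ bad d.
  apply: countable_avoid; apply: bigcup_countable.
    apply: finite_set_countable; apply: (@sub_finite_set _ _ [set` ls]).
      by move=> l [].
    exact: finite_seq.
  move=> l [ll [i i0 li]]; apply: bigcup_countable => // g Gg.
  apply: finite_set_countable; apply: finite_roots.
  apply/eqP => /polyP /(_ i); rewrite coef_poly ltn_ord coef0.
  have -> : (i == 0%N :> nat) = false by apply/negbTE.
  by rewrite inord_val => /eqP; apply/negP.
exists (xd d); first by rewrite mxE eqxx.
move=> g Gg l ll ex; apply/eqP => a0; apply: nbad.
by exists l => //; exists g => //; rewrite /= /root plE a0.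
Qed.

Section Orbit.
Variables (ls : seq ('rV[R]_n.+1 * R)) (x : 'rV[R]_n.+1).
Hypothesis x_gen : forall g, G g -> generic ls (x + g).

Definition orbit_set : set 'rV[R]_n.+1 := [set y | G (y - x)].

Lemma orbit_generic y : orbit_set y -> generic ls y.
Proof. by rewrite -{2}[y](subrK x) addrC => /x_gen. Qed.

(** The first coordinate of a point with a jump takes finitely many values, and
finitely many points of the orbit in a ball have a given first coordinate. *)
Lemma finite_jump P : determined ls P -> (exists B, bounded_by B P) ->
  finite_set (orbit_set `&` [set y | jump P y != 0]).
Proof.
move=> dP [B bP].
pose S c : set 'rV[R]_n.+1 := [set g | G g /\ g 0 ord0 = c /\
   forall i, `|g 0 i| <= B + 1 + \sum_i `|x 0 i|].
apply: (@sub_finite_set _ _ (\bigcup_(l in [set` ls])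
   [set g + x | g in S (- l.2 / l.1 0 ord0 - x 0 ord0)])); last first.
  apply: bigcup_finite; first exact: finite_seq.
  by move=> l _; apply: finite_image; exact: G_slice.
move=> y [Oy Jy]; have [[l ll y0] yB] := jump_support dP bP (orbit_generic Oy) Jy.
exists l => //; exists (y - x); last by rewrite subrK.
split=> //; split=> [|i]; rewrite !mxE; first by rewrite y0.
apply: (le_trans (ler_normB _ _)); apply: lerD; first exact: yB.
by rewrite (bigD1 i) //= lerDl sumr_ge0.
Qed.

Definition orbit_sum P : int := \sum_(y \in orbit_set) jump P y.

Lemma orbit_sum_translate P g : G g -> orbit_sum [set z + g | z in P] = orbit_sum P.
Proof.
move=> Gg; rewrite /orbit_sum (eq_fsbigr (fun y => jump P (y - g))); last first.
  by move=> y _; rewrite jump_translate.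
apply/esym; apply: (@reindex_fsbig _ _ _ _ _ (fun y => y - g)); split.
- by move=> y Oy; rewrite /orbit_set /= addrAC; exact: GB.
- by move=> y z _ _ /addIr.
- move=> y Oy; exists (y + g); last by rewrite addrK.
  have GN : G (- g) by rewrite -[- g]add0r; exact: GB.
  by rewrite /orbit_set /= addrAC -[g]opprK; exact: GB.
Qed.

Lemma orbit_sum_partition k (P : 'I_k -> set 'rV[R]_n.+1) (A X : set 'rV[R]_n.+1) :
  lebesgue_null (~` X) -> determined ls A ->
  (forall j, determined ls (P j) /\ exists B, bounded_by B (P j)) ->
  partition [set: 'I_k] (fun j => P j `&` X) (A `&` X) ->
  orbit_sum A = \sum_j orbit_sum (P j).
Proof.
move=> X0 dA dP part.
pose Z := \bigcup_(j in [set: 'I_k]) (orbit_set `&` [set y | jump (P j) y != 0]).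
have ZO : Z `<=` orbit_set by move=> y [j _ []].
have Zfin : finite_set Z.
  apply: bigcup_finite; first exact: finite_finset.
  by move=> j _; apply: finite_jump; [exact: (dP j).1|exact: (dP j).2].
have jA y : orbit_set y -> jump A y = \sum_j jump (P j) y.
  by move=> Oy; apply: (jump_partition X0 (orbit_generic Oy) dA (fun j => (dP j).1) part).
have offZ j y : (orbit_set `\` Z) y -> jump (P j) y = 0.
  by move=> [Oy nZ]; apply/eqP; apply: contrapT => /negP Jy; apply: nZ; exists j.
rewrite /orbit_sum -(fsbig_widen Z) //; last first.
  by move=> y yZ /=; rewrite jA; [rewrite big1 // => j _; exact: offZ|case: yZ].
rewrite fsbig_finite //.
under [RHS]eq_bigr => j _.
  rewrite -(fsbig_widen Z) //; last by move=> y yZ /=; exact: offZ.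
  rewrite fsbig_finite //.
  over.
rewrite exchange_big /= !big_seq; apply: eq_bigr => y.
by rewrite in_fset_set // inE => /ZO; exact: jA.
Qed.
End Orbit.

Lemma jump_box (a b y : 'rV[R]_n.+1) : a 0 ord0 < b 0 ord0 ->
  jump (box a b) y =
  ((`[< forall i, i != ord0 -> a 0 i <= y 0 i <= b 0 i >] : nat)%:Z *
   (((y 0 ord0 == a 0 ord0) : nat)%:Z - ((y 0 ord0 == b 0 ord0) : nat)%:Z)).
Proof.
move=> ab.
have mem t : box a b (y + t *: axis0 R n) <->
    (forall i, i != ord0 -> a 0 i <= y 0 i <= b 0 i) /\ a 0 ord0 <= y 0 ord0 + t <= b 0 ord0.
  split=> [h|[h h0] i].
    split=> [i i0|]; first by have := h i; rewrite !mxE (negbTE i0) andbF mulr0 addr0.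
    by have := h ord0; rewrite !mxE eqxx mulr1.
  have [->|i0] := eqVneq i ord0; rewrite !mxE ?eqxx ?mulr1 //.
  by rewrite (negbTE i0) mulr0 addr0; exact: h.
set H := forall i, _ -> _ in mem *.
have gp : germ (box a b) y 1 <-> H /\ a 0 ord0 <= y 0 ord0 < b 0 ord0.
  split=> [g|[h /andP[h1 h2]]].
    have [t t0 [/mem[h /andP[h1 h2]] _]] := small_ex (small_and g (small_lt (@ltr01 R))).
    split=> //; apply/andP; split; last by move: h2; rewrite mul1r; lra.
    rewrite leNgt; apply/negP => lt.
    have d0 : 0 < a 0 ord0 - y 0 ord0 by rewrite subr_gt0.
    have [t' t'0 [/mem[_ /andP[h1' _]] t'd]] := small_ex (small_and g (small_lt d0)).
    by move: h1'; rewrite mul1r; lra.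
  have d0 : 0 < b 0 ord0 - y 0 ord0 by rewrite subr_gt0.
  exists (b 0 ord0 - y 0 ord0) => // t /andP[t0 tb]; apply/mem; split=> //.
  by rewrite mul1r; apply/andP; split; lra.
have gm : germ (box a b) y (-1) <-> H /\ a 0 ord0 < y 0 ord0 <= b 0 ord0.
  split=> [g|[h /andP[h1 h2]]].
    have [t t0 [/mem[h /andP[h1 h2]] _]] := small_ex (small_and g (small_lt (@ltr01 R))).
    split=> //; apply/andP; split; first by move: h1; rewrite mulN1r; lra.
    rewrite leNgt; apply/negP => lt.
    have d0 : 0 < y 0 ord0 - b 0 ord0 by rewrite subr_gt0.
    have [t' t'0 [/mem[_ /andP[_ h2']] t'd]] := small_ex (small_and g (small_lt d0)).
    by move: h2'; rewrite mulN1r; lra.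
  have d0 : 0 < y 0 ord0 - a 0 ord0 by rewrite subr_gt0.
  exists (y 0 ord0 - a 0 ord0) => // t /andP[t0 tb]; apply/mem; split=> //.
  by rewrite mulN1r; apply/andP; split; lra.
rewrite /jump /germ_ind (asbool_equiv_eq gp) (asbool_equiv_eq gm) !asbool_and !asboolb.
case: asboolP => [h|h] /=; last by rewrite mul0r.
rewrite mul1r; case: (ltgtP (y 0 ord0) (a 0 ord0)) => ya /=.
- by rewrite lt_eqF // (lt_trans ya).
- case: (ltgtP (y 0 ord0) (b 0 ord0)) => yb //=.
- by rewrite ya ab lt_eqF.
Qed.

Definition cube_box (u c : R) : set 'rV[R]_n.+1 :=
  box (\row_i (if i == ord0 then u else c)) (\row_i (if i == ord0 then u + 1 else c + 1)).

(** The orbit of a generic point with first coordinate 0 meets the face [y_0 = 0]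
of the first cube, by integer translations of the other coordinates, and none
of the faces [y_0 = 1]: the first cube has a positive sum of jumps, and the
second one, which can only jump downwards, a nonpositive one. *)
Lemma not_equidecomposable (c : R) : ~ equidecomposable G (cube_box 0 c) (cube_box 1 c).
Proof.
move=> [k [P [g [X [Ppoly Gg X0 part1 part2]]]]].
have dP j := polytope_determined (Ppoly j).
have dPg j := translate_determined (g j) (dP j).
have [[lA dA] _] := box_determined (\row_i (if i == ord0 then 0 else c) : 'rV[R]_n.+1)
  (\row_i (if i == ord0 then 0 + 1 else c + 1)).
have [[lB dB] _] := box_determined (\row_i (if i == ord0 then 1 else c) : 'rV[R]_n.+1)
  (\row_i (if i == ord0 then 1 + 1 else c + 1)).
have /choice[L LP] j := (dP j).1.
have /choice[Lg LgP] j := (dPg j).1.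
pose ls := lA ++ lB ++ flatten [seq L j | j <- enum 'I_k] ++ flatten [seq Lg j | j <- enum 'I_k].
have subf (F : 'I_k -> seq ('rV[R]_n.+1 * R)) j : {subset F j <= flatten [seq F j | j <- enum 'I_k]}.
  by move=> l lF; apply/flattenP; exists (F j) => //; rewrite map_f // mem_enum.
have dA' : determined ls (cube_box 0 c).
  by apply: determined_sub dA => l ll; rewrite mem_cat ll.
have dB' : determined ls (cube_box 1 c).
  by apply: determined_sub dB => l ll; rewrite !mem_cat ll orbT.
have dP' j : determined ls (P j) /\ exists B, bounded_by B (P j).
  split; last exact: (dP j).2.
  by apply: determined_sub (LP j) => l /subf ll; rewrite !mem_cat ll !orbT.
have dPg' j : determined ls [set z + g j | z in P j] /\ exists B, bounded_by B [set z + g j | z in P j].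
  split; last exact: (dPg j).2.
  by apply: determined_sub (LgP j) => l /subf ll; rewrite !mem_cat ll !orbT.
have [x x0 x_gen] := exists_generic ls.
have E1 := orbit_sum_partition x_gen X0 dA' dP' part1.
have E2 := orbit_sum_partition x_gen X0 dB' dPg' part2.
have E : orbit_sum x (cube_box 0 c) = orbit_sum x (cube_box 1 c).
  by rewrite E1 E2; apply: eq_bigr => j _; rewrite orbit_sum_translate.
(* This is where the parity of 1 enters. *)
have Oy1 y : orbit_set x y -> y 0 ord0 != 1.
  by move=> /G_one; rewrite !mxE x0 subr0.
have le0 : orbit_sum x (cube_box 1 c) <= 0.
  apply: fsumr_le0 => y Oy; rewrite jump_box !mxE eqxx; last by lra.
  rewrite (negbTE (Oy1 y Oy)) sub0r mulrN oppr_le0.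
  by rewrite mulr_ge0.
have pos y : orbit_set x y -> 0 <= jump (cube_box 0 c) y.
  move=> Oy; rewrite jump_box !mxE eqxx; last by lra.
  by rewrite add0r (negbTE (Oy1 y Oy)) subr0 mulr_ge0.
(* [y0] is the point of the orbit on the face [y_0 = 0] of the first cube. *)
pose j0 : 'rV[int]_n.+1 := \row_i (if i == ord0 then 0 else - Num.floor (x 0 i - c)).
pose y0 := x + map_mx intr j0.
have Oy0 : orbit_set x y0.
  by rewrite /orbit_set /= addrC addKr; apply: G_int; rewrite mxE eqxx.
have Jy0 : jump (cube_box 0 c) y0 = 1.
  rewrite jump_box; last by rewrite !mxE eqxx; lra.
  rewrite asboolT; last first.
    move=> i i0; rewrite !mxE (negbTE i0) intrN.
    by have /andP[] := floor_itv (x 0 i - c); rewrite intrD => *; apply/andP; split; lra.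
  by rewrite !mxE eqxx x0 mulr0z !add0r eqxx eq_sym oner_eq0.
have fin : finite_set (orbit_set x `&` [set y | jump (cube_box 0 c) y != 0]).
  apply: (finite_jump x_gen dA'); have [_] := box_determined
    (\row_i (if i == ord0 then 0 else c) : 'rV[R]_n.+1) (\row_i (if i == ord0 then 0 + 1 else c + 1)).
  exact.
move: le0; rewrite -E leNgt => /negP; apply.
apply: (@lt_le_trans _ _ (jump (cube_box 0 c) y0)); first by rewrite Jy0.
rewrite /orbit_sum -(fsbig_widen (orbit_set x `&` [set y | jump (cube_box 0 c) y != 0])); last 2 first.
- by move=> y [].
- by move=> y [Oy /not_andP[|/negP/negPn/eqP]].
rewrite fsbig_finite // (big_rem y0) /=; last first.
  by rewrite in_fset_set // inE; split=> //=; rewrite Jy0.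
rewrite lerDl big_seq sumr_ge0 // => y /mem_rem.
by rewrite in_fset_set // inE => -[/pos].
Qed.
End Invariant.

(** * Dense windings *)

(** The join of two structures of the spaces of matrices, complete and normed,
   for the Baire category theorem. *)
HB.instance Definition _ (R : realType) (m n : nat) := Complete.on 'M[R]_(m, n).

Section Winding.
Variables (R : realType) (n : nat).

Lemma rV_ballE (x y : 'rV[R]_n.+1) (r : R) : ball x r y <-> forall i, `|x 0 i - y 0 i| < r.
Proof.
split=> [[_ h] i|h]; first exact: h.
split; first by have := h ord0; apply: le_lt_trans.
by move=> i j; rewrite (ord1 i); exact: h.
Qed.

Definition winding_dense (c : 'rV[R]_n.+1) : Prop :=
  forall (x : 'rV[R]_n.+1) (r : R), 0 < r -> exists (q : nat) (j : 'rV[int]_n.+1),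
  forall i, `|q%:R * c 0 i + (j 0 i)%:~R - x 0 i| < r.

(** A Baire category argument: the vectors having a multiple that approximates a
given target modulo 1 within a given precision form a dense open set. *)
Lemma exists_winding_dense : exists c, winding_dense c.
Proof.
pose good (x : 'rV[R]_n.+1) (r : R) : set 'rV[R]_n.+1 :=
  [set c | exists (q : nat) (j : 'rV[int]_n.+1), forall i, `|q%:R * c 0 i + (j 0 i)%:~R - x 0 i| < r].
pose tgt (k : nat) : 'rV[R]_n.+1 * R :=
  if choice.unpickle k is Some (xr, d) then
    (map_mx ratr (xr : 'rV[rat]_n.+1), (d : nat).+1%:R^-1) else (0, 1).
have tgt0 k : 0 < (tgt k).2 by rewrite /tgt; case: choice.unpickle => [[? ?]|] //=; rewrite invr_gt0 ltr0n.
have good_open x r : open (good x r).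
  rewrite openE => c [q [j cq]]; apply/nbhs_ballP.
  pose s := \big[Num.min/r]_i (r - `|q%:R * c 0 i + (j 0 i)%:~R - x 0 i|).
  have r0 : 0 < r by have := cq ord0; apply: le_lt_trans.
  have s0 : 0 < s.
    rewrite /s; elim/big_ind: _ => // [u v u0 v0|i _]; first by rewrite lt_min u0.
    by rewrite subr_gt0.
  have q1 : 0 < q%:R + 1 :> R by rewrite ltr_wpDl.
  exists (s / (q%:R + 1)); first by rewrite /= divr_gt0.
  move=> c' /rV_ballE cc'; exists q, j => i.
  have si : s <= r - `|q%:R * c 0 i + (j 0 i)%:~R - x 0 i|.
    by rewrite /s (bigD1 i) //= ge_min lexx.
  have := cc' i; rewrite ltr_pdivlMr // => ci.
  have -> : q%:R * c' 0 i + (j 0 i)%:~R - x 0 i =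
     (q%:R * c 0 i + (j 0 i)%:~R - x 0 i) - q%:R * (c 0 i - c' 0 i) by ring.
  apply: (le_lt_trans (ler_normB _ _)); rewrite normrM ger0_norm //.
  have := normr_ge0 (c 0 i - c' 0 i); have : 0 <= q%:R :> R by [].
  by move: si ci; move: (`|_ - x 0 i|) (`|c 0 i - _|) => A B; lra.
have good_dense x r : 0 < r -> dense (good x r).
  move=> r0 U [c0 Uc0] oU; have /nbhs_ballP[d /= d0 dU] : nbhs c0 U by exact: open_nbhs_nbhs.
  (* A change of [c0] by less than [1 / q < d] moves [q c0] onto [x] modulo 1. *)
  pose q := (Num.trunc d^-1).+1.
  have qd : d^-1 < q%:R by rewrite /q truncnS_gt.
  have q0 : 0 < q%:R :> R by rewrite ltr0n.
  pose j : 'rV[int]_n.+1 := \row_i Num.floor (x 0 i - q%:R * c0 0 i).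
  pose c : 'rV[R]_n.+1 := \row_i ((x 0 i - (j 0 i)%:~R) / q%:R).
  exists c; split; last first.
    exists q, j => i; rewrite mxE mulrC divfK ?gt_eqF // subrK subrr normr0 //.
  apply: dU; apply/rV_ballE => i; rewrite !mxE.
  set z := x 0 i - q%:R * c0 0 i.
  have -> : c0 0 i - (x 0 i - (Num.floor z)%:~R) / q%:R = - (z - (Num.floor z)%:~R) / q%:R.
    by rewrite /z; field; rewrite gt_eqF.
  have /andP[z1 z2] := floor_itv z; rewrite intrD in z2.
  rewrite normrM normrN (ger0_norm (_ : 0 <= z - _)) ?subr_ge0 // normfV (gtr0_norm q0).
  rewrite ltr_pdivrMr //; apply: (@lt_le_trans _ _ 1); first by lra.
  by rewrite -ler_pdivrMl // mulr1 ltW.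
have D := @Baire R _ (fun k => good (tgt k).1 (tgt k).2)
  (fun k => conj (good_open _ _) (good_dense _ _ (tgt0 k))).
have [c [_ cP]] : setT `&` \bigcap_k good (tgt k).1 (tgt k).2 !=set0.
  by apply: D; [exists 0|exact: openT].
exists c => x r r0.
have /choice[xr xrP] i : exists y : rat, `|ratr y - x 0 i| < r / 2.
  have lt : x 0 i - r / 2 < x 0 i + r / 2 by lra.
  have [y] := rat_in_itvoo lt; rewrite in_itv /= => /andP[h1 h2]; exists y.
  by rewrite ltr_norml; apply/andP; split; lra.
pose d := Num.trunc (r / 2)^-1.
have r2 : 0 < r / 2 by lra.
have dr : d.+1%:R^-1 < r / 2.
  by rewrite invf_plt ?posrE ?ltr0n // truncnS_gt.
have := cP (choice.pickle ((\row_i xr i : 'rV[rat]_n.+1), d)) I.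
rewrite /tgt choice.pickleK /= => -[q [j h]]; exists q, j => i.
have := h i; rewrite !mxE => hi.
apply: (le_lt_trans (ler_distD (ratr (xr i)) _ _)).
have -> : r = r / 2 + r / 2 by field.
by apply: ltrD (xrP i); exact: lt_trans hi dr.
Qed.

(** An integer relation [r] between the coordinates of [c] makes [r] take integer
values on all vectors [q c + j], which then stay away from the points where
[r] takes the value 1/2. *)
Lemma winding_independent (c : 'rV[R]_n.+1) (r : 'rV[int]_n.+1) : winding_dense c ->
  \sum_i c 0 i * (r 0 i)%:~R = 0 -> r = 0.
Proof.
move=> cd rel; apply/rowP => k; rewrite mxE; apply/eqP; apply: contraT => rk.
have rkR : (r 0 k)%:~R != 0 :> R by rewrite intr_eq0.
pose s := \sum_i `|(r 0 i)%:~R : R|.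
have s0 : 0 <= s by rewrite sumr_ge0.
(* A point where the relation takes the value 1/2. *)
pose x : 'rV[R]_n.+1 := \row_i (if i == k then (2 * (r 0 k)%:~R)^-1 else 0).
have e0 : 0 < (4 * (s + 1))^-1 :> R by rewrite invr_gt0 mulr_gt0 // ltr_wpDl.
have [q [j h]] := cd x _ e0.
have E : \sum_i (r 0 i)%:~R * (q%:R * c 0 i + (j 0 i)%:~R - x 0 i) =
   (\sum_i r 0 i * j 0 i)%:~R - 1 / 2.
  have -> : \sum_i (r 0 i)%:~R * (q%:R * c 0 i + (j 0 i)%:~R - x 0 i) =
     q%:R * (\sum_i c 0 i * (r 0 i)%:~R) + \sum_i (r 0 i * j 0 i)%:~R - \sum_i (r 0 i)%:~R * x 0 i.
    rewrite mulr_sumr -big_split -sumrB /=; apply: eq_bigr => i _.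
    by rewrite intrM; ring.
  rewrite rel mulr0 add0r rmorph_sum /=; congr (_ - _).
  rewrite (bigD1 k) //= big1 ?addr0; last by move=> i ik; rewrite mxE (negbTE ik) mulr0.
  by rewrite mxE eqxx; field; rewrite rkR.
have : `|(\sum_i r 0 i * j 0 i)%:~R - 1 / 2 : R| <= 1 / 4.
  rewrite -E; apply: (le_trans (ler_norm_sum _ _ _)).
  apply: (@le_trans _ _ (\sum_i `|(r 0 i)%:~R| * (4 * (s + 1))^-1)).
    by apply: ler_sum => i _; rewrite normrM ler_wpM2l // ltW.
  rewrite -mulr_suml -/s ler_pdivrMr ?mulr_gt0 ?ltr_wpDl //; lra.
move: (\sum_i _) => z; rewrite ler_norml => /andP[z1 z2].
have : (z <= 0) || (1 <= z) by clear; lia.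
by case/orP => hz; have : z%:~R <= 0 :> R \/ 1 <= z%:~R :> R by
  [rewrite -(ler_int R) in hz; auto]; lra.
Qed.
End Winding.

Section RankTwo.
Variables (R : realType) (e : R).
Hypotheses (e_gt : 2 / 5 < e) (e_lt : e < 1 / 2) (eE : e ^+ 3 = 1 - 2 * e).

(** Given a combination [s], the number 1 lies between two consecutive multiples of
[s], and one of its distances to them is at most [s / 2].  It does not vanish,
as [1] and [e] are independent. *)
Lemma small_combination (N : nat) : exists A B : int,
  0 < B%:~R + e * A%:~R < 1 /\ B%:~R + e * A%:~R <= (1 / 2) ^+ N.
Proof.
have [e0 eg el] := And3 (e_gt0 e_gt) e_gt e_lt.
elim: N => [|N [A [B [/andP[s0 s1] sN]]]].
  by exists 1, 0; rewrite mulr1 add0r expr0; split; [apply/andP; split|]; lra.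
(* The distances are [1 - m s] and [(m + 1) s - 1], of sum [s]. *)
set s := B%:~R + _ in s0 s1 sN; pose m := Num.floor s^-1.
have /andP[m1 m2] := floor_itv s^-1; rewrite -/m intrD in m1 m2.
have ms1 : m%:~R * s <= 1 by rewrite -ler_pdivlMr // mul1r.
have ms2 : 1 < (m%:~R + 1) * s by rewrite -ltr_pdivrMr // mul1r.
have rE : 1 - m%:~R * s = yval e (1 - m * B, - (m * A), 0).
  by rewrite /yval /= mulr0z intrB intrN !intrM /s; ring.
have rN0 : 1 - m%:~R * s != 0.
  rewrite rE; apply/eqP => /(yval_eq0 eE) [E1 /eqP E2].
  have mB : m * B = 1 by move: E1; clear; lia.
  have mN0 : m != 0 by apply/eqP => m0; move: mB; rewrite m0 mul0r.
  move: E2; rewrite oppr_eq0 mulf_eq0 (negbTE mN0) /= => /eqP A0.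
  have B1 : absz B = 1%N.
    by have /eqP := congr1 absz mB; rewrite abszM muln_eq1 => /andP[_ /eqP].
  move: s0 s1; rewrite /s A0 mulr0z mulr0 addr0 ltr0z ltrz1.
  by move: B1; clear; lia.
have hE : (1 / 2 : R) ^+ N.+1 = (1 / 2) ^+ N / 2 by rewrite exprSr; field.
have [rs|rs] := leP (1 - m%:~R * s) (s / 2).
  exists (- (m * A)), (1 - m * B).
  have -> : (1 - m * B)%:~R + e * (- (m * A))%:~R = 1 - m%:~R * s.
    by rewrite rE /yval /= mulr0z; ring.
  have r0 : 0 < 1 - m%:~R * s by rewrite lt_neqAle eq_sym rN0 subr_ge0.
  by rewrite hE; split; [apply/andP; split|]; lra.
exists (A + m * A), (B + m * B - 1).
have -> : (B + m * B - 1)%:~R + e * (A + m * A)%:~R = s - (1 - m%:~R * s).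
  by rewrite intrB !intrD !intrM /s; ring.
by rewrite hE; split; [apply/andP; split|]; lra.
Qed.

Lemma rank_two_dense (t r : R) : 0 < r -> exists A B : int, `|B%:~R + e * A%:~R - t| < r.
Proof.
move=> r0.
have [N hN] : exists N : nat, (1 / 2 : R) ^+ N < r.
  exists (Num.trunc r^-1).+1; rewrite expr_div_n expr1n div1r.
  rewrite invf_plt ?posrE ?exprn_gt0 //.
  apply: (lt_trans (truncnS_gt _)).
  by rewrite -natrX ltr_nat ltn_expl.
have [A [B [/andP[s0 s1] sN]]] := small_combination N.
set s := B%:~R + _ in s0 s1 sN; pose m := Num.floor (t / s).
exists (m * A), (m * B).
have -> : (m * B)%:~R + e * (m * A)%:~R = m%:~R * s by rewrite !intrM /s; ring.
have /andP[m1 m2] := floor_itv (t / s); rewrite -/m intrD in m1 m2.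
rewrite ler_pdivlMr // in m1; rewrite ltr_pdivrMr // in m2.
by rewrite ltr_norml; apply/andP; split; lra.
Qed.
End RankTwo.

(** * The lattice *)

Lemma sgn_pt_double (R : realType) (v : pt) (k : int) :
  v.1.1 + v.1.2 + v.2 = k + k -> sgn_pt R v = 1.
Proof.
move=> E; rewrite /sgn_pt E expfzDr ?oppr_eq0 ?oner_eq0 //.
by rewrite -expfzMl mulrNN mulr1 exp1rz.
Qed.

Section Lattice.
Variables (R : realType) (e : R) (m n : nat) (c : 'rV[R]_n.+1).
Hypotheses (e_gt : 2 / 5 < e) (e_lt : e < 1 / 2) (eE : e ^+ 3 = 1 - 2 * e).
Hypothesis c_dense : winding_dense c.

Definition i1 : 'I_m.+2 := lift ord0 ord0.

Definition proj2 (z : 'rV[R]_m.+2 * 'rV[R]_n.+1) : 'rV[R]_n.+1 :=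
  \row_i (if i == ord0 then z.2 0 ord0 + e * z.1 0 ord0 + e ^+ 2 * z.1 0 i1
          else z.2 0 i + c 0 i * z.1 0 i1).

(** The perturbation of the physical coordinates.  It is linear, hence bounded
over a bounded window, and it makes the physical coordinates of the
lattice vectors remember all the internal ones. *)
Definition shear (y : 'rV[R]_n.+1) : 'rV[R]_m.+2 :=
  \row_i (if i == ord0 then \sum_(j < n) c 0 (lift ord0 j) * y 0 (lift ord0 j)
          else if i == i1 then y 0 ord0 else 0).

Definition latmap (z : 'rV[R]_m.+2 * 'rV[R]_n.+1) : 'rV[R]_m.+2 * 'rV[R]_n.+1 :=
  (z.1 + shear (proj2 z), proj2 z).

Lemma proj2_is_linear : linear proj2.
Proof.
move=> k z w; apply/rowP => i; rewrite !mxE /=; case: ifP => _; ring.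
Qed.
HB.instance Definition _ := GRing.isLinear.Build R _ _ _ proj2 proj2_is_linear.

Lemma shear_is_linear : linear shear.
Proof.
move=> k z w; apply/rowP => i; rewrite !mxE; case: ifP => _.
  rewrite mulr_sumr -big_split; apply: eq_bigr => j _; rewrite !mxE /=; ring.
by case: ifP => _; rewrite ?mxE // mulr0 addr0.
Qed.
HB.instance Definition _ := GRing.isLinear.Build R _ _ _ shear shear_is_linear.

Lemma latmap_is_linear : linear latmap.
Proof.
move=> k z w; rewrite /latmap !linearP /=; congr (_, _).
change (k *: z.1 + w.1 + (k *: shear (proj2 z) + shear (proj2 w)) =
  k *: (z.1 + shear (proj2 z)) + (w.1 + shear (proj2 w))).
by rewrite scalerDr addrACA.
Qed.
HB.instance Definition _ := GRing.isLinear.Build R _ _ _ latmap latmap_is_linear.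

Lemma latmap_eq0 z : latmap z = 0 -> z = 0.
Proof.
case: z => u w [E1 E2].
have u0 : u = 0 by move: E1; rewrite /= E2 linear0 addr0.
rewrite u0; congr (_, _); apply/rowP => i; have := congr1 (fun x : 'rV[R]_n.+1 => x 0 i) E2.
rewrite !mxE /= u0; case: (i =P ord0) => [->|_]; rewrite !mxE ?mulr0 ?addr0 //.
Qed.

Notation zvec := ('rV[int]_m.+2 * 'rV[int]_n.+1)%type.

Definition emb (z : zvec) : 'rV[R]_m.+2 * 'rV[R]_n.+1 := (map_mx intr z.1, map_mx intr z.2).

Lemma embB z w : emb (z - w) = emb z - emb w.
Proof. by rewrite /emb /= !map_mxB. Qed.

(** The element of Z[e] carried by a lattice vector. *)
Definition zpt (z : zvec) : pt := (z.2 0 ord0, z.1 0 ord0, z.1 0 i1).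

Lemma zptB z w : zpt (z - w) = zpt z - zpt w.
Proof. by rewrite /zpt /= !mxE. Qed.

Definition even_vec (z : zvec) : Prop := sgn_pt R (zpt z) = 1.

Lemma even_vecB z w : even_vec z -> even_vec w -> even_vec (z - w).
Proof.
rewrite /even_vec zptB => ez ew.
by have := sgn_ptD R (zpt z - zpt w) (zpt w); rewrite subrK ez ew mulr1.
Qed.

Lemma even_vec0 : even_vec 0.
Proof. by apply: (@sgn_pt_double R _ 0); rewrite /= !mxE. Qed.

Definition Gamma : set ('rV[R]_m.+2 * 'rV[R]_n.+1) :=
  [set latmap (emb z) | z in even_vec].

Lemma Gamma0 : Gamma 0.
Proof.
exists 0; first exact: even_vec0.
have -> : emb 0 = 0 by rewrite /emb /= !map_mx0.
exact: linear0.
Qed.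

Lemma GammaB x y : Gamma x -> Gamma y -> Gamma (x - y).
Proof.
move=> [z ez <-] [w ew <-]; exists (z - w); first exact: even_vecB.
by rewrite embB linearB.
Qed.

Lemma proj2_0 z : proj2 (emb z) 0 ord0 = yval e (zpt z).
Proof. by rewrite !mxE. Qed.

Lemma proj2_S z i : i != ord0 -> proj2 (emb z) 0 i = (z.2 0 i)%:~R + c 0 i * (z.1 0 i1)%:~R.
Proof. by move=> i0; rewrite mxE (negbTE i0) !mxE. Qed.

Lemma int_small (k : int) : `|k%:~R : R| < 1 -> k = 0.
Proof. by rewrite -intr_norm ltrz1; lia. Qed.

(** The physical coordinate [i1] is an integer combination of [1, e, e^2]; once it
vanishes, the coordinate [ord0] is, up to an integer that vanishes too, an
integer combination of the coordinates of [c]. *)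
Lemma fst_latmap_eq0 z : (latmap (emb z)).1 = 0 -> z = 0.
Proof.
move=> E; have Ei i : (z.1 0 i)%:~R + shear (proj2 (emb z)) 0 i = 0.
  by have := congr1 (fun x : 'rV[R]_m.+2 => x 0 i) E; rewrite !mxE.
have /(yval_eq0 eE) [] : yval e (z.2 0 ord0 + z.1 0 i1, z.1 0 ord0, z.1 0 i1) = 0.
  rewrite -[RHS](Ei i1) mxE /= proj2_0 /yval /zpt /= intrD; ring.
move=> b0 a0 a1; rewrite a1 addr0 in b0.
have z1 : z.1 = 0.
  apply/rowP => i; rewrite mxE.
  have [->//|i0] := eqVneq i ord0; have [->//|ii1] := eqVneq i i1.
  have := Ei i; rewrite mxE (negbTE i0) (negbTE ii1) addr0 => /eqP.
  by rewrite intr_eq0 => /eqP.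
have rel : \sum_i c 0 i * ((\row_j (if j == ord0 then 0 else z.2 0 j) : 'rV[int]_n.+1) 0 i)%:~R = 0.
  rewrite big_ord_recl mxE eqxx mulr0z mulr0 add0r.
  have := Ei ord0; rewrite a0 mulr0z add0r mxE eqxx => S0; rewrite -[RHS]S0.
  apply: eq_bigr => j _; rewrite proj2_S // a1 mulr0z mulr0 addr0 mxE //.
have z2 := winding_independent c_dense rel.
apply/eqP; case: z z1 z2 b0 {E Ei a0 a1 rel} => u w /= -> z2 b0; apply/eqP.
congr (_, _); apply/rowP => j; rewrite mxE.
have [->//|j0] := eqVneq j ord0.
by have := congr1 (fun x : 'rV[int]_n.+1 => x 0 j) z2; rewrite !mxE (negbTE j0).
Qed.

Lemma Gamma_fst_inj : set_inj Gamma (fun g => g.1).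
Proof.
move=> _ _ /set_mem[z ez <-] /set_mem[w ew <-] E.
suff : z - w = 0 by move/eqP; rewrite subr_eq0 => /eqP ->.
have {}E : (latmap (emb z)).1 = (latmap (emb w)).1 := E.
apply: fst_latmap_eq0; rewrite embB linearB.
by change ((latmap (emb z)).1 - (latmap (emb w)).1 = 0); rewrite E subrr.
Qed.

Lemma latmap_emb_small z (r : R) : r <= 1 / 2 -> r * (1 + \sum_i `|c 0 i|) <= 1 / 2 ->
  (forall i, `|(latmap (emb z)).1 0 i| < r) -> (forall i, `|(latmap (emb z)).2 0 i| < r) -> z = 0.
Proof.
move=> r2 rc h1 h2; have r0 : 0 < r by have := h1 ord0; apply: le_lt_trans.
set S := \sum_i `|c 0 i| in rc.
have S0 : 0 <= S by rewrite sumr_ge0.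
have sh i : `|shear (proj2 (emb z)) 0 i| <= 1 / 2.
  rewrite mxE; case: ifP => _.
    apply: (@le_trans _ _ (S * r)); last by lra.
    apply: (le_trans (ler_norm_sum _ _ _)); rewrite /S mulr_suml big_ord_recl.
    rewrite -[leLHS]add0r; apply: lerD; first by rewrite mulr_ge0 // ltW.
    by apply: ler_sum => j _; rewrite normrM ler_wpM2l // ltW //; exact: h2.
  case: ifP => _; last by rewrite normr0; lra.
  by have := h2 ord0; rewrite /=; lra.
have z1 i : z.1 0 i = 0.
  apply: int_small.
  have -> : (z.1 0 i)%:~R = (latmap (emb z)).1 0 i - shear (proj2 (emb z)) 0 i.
    by rewrite mxE mxE addrK.
  apply: (le_lt_trans (ler_normB _ _)); have := h1 i; have := sh i; lra.
have z2 i : z.2 0 i = 0.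
  apply: int_small; have := h2 i; rewrite /=.
  have [->|i0] := eqVneq i ord0; last by rewrite proj2_S // z1 mulr0z mulr0 addr0; lra.
  by rewrite proj2_0 /yval /zpt /= !z1 !mulr0z !mulr0 !addr0; lra.
case: z z1 z2 {h1 h2 sh} => u w /= z1 z2.
by congr (_, _); apply/rowP => i; rewrite mxE.
Qed.

Lemma Gamma_discrete : Gamma `<=` isolated Gamma.
Proof.
move=> x Gx; split; first by rewrite inE.
pose S := \sum_i `|c 0 i|; have S0 : 0 <= S by rewrite sumr_ge0.
pose r := 1 / 2 / (1 + S).
have S1 : 0 < 1 + S by rewrite ltr_pwDl.
have r0 : 0 < r by rewrite !divr_gt0.
have r2 : r <= 1 / 2 by rewrite ler_pdivrMr //; lra.
exists [set y | ball x.1 r y.1 /\ ball x.2 r y.2].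
  by exists (ball x.1 r, ball x.2 r); [split; exact: nbhsx_ballx|case].
apply/seteqP; split=> [y [[/rV_ballE h1 /rV_ballE h2] Gy]|y ->].
  have [z ez zE] := GammaB Gx Gy.
  have z0 : z = 0.
    apply: (@latmap_emb_small z r) => // [|i|i]; first by rewrite divfK // gt_eqF.
      by rewrite zE; have := h1 i; rewrite !mxE.
    by rewrite zE; have := h2 i; rewrite !mxE.
  move: zE; rewrite z0 /emb /= !map_mx0 -[(0, 0)]/(0 : 'rV[R]_m.+2 * 'rV[R]_n.+1) linear0.
  by move=> /esym /eqP; rewrite subr_eq0 => /eqP ->.
by split=> //; split; exact: ballxx.
Qed.

(** The doubles of the vectors of the canonical basis are even. *)
Lemma Gamma_full : exists X : (m.+2 + n.+1).-tuple ('rV[R]_m.+2 * 'rV[R]_n.+1),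
  free X /\ [set` X] `<=` Gamma.
Proof.
pose bz (i : 'I_(m.+2 + n.+1)) : zvec :=
  match fintype.split i with inl j => (delta_mx 0 j *+ 2, 0) | inr j => (0, delta_mx 0 j *+ 2) end.
pose X := [tuple latmap (emb (bz i)) | i < m.+2 + n.+1].
exists X; split.
  apply/freeP => k; under eq_bigr do rewrite (nth_map ord0) ?size_enum_ord // nth_ord_enum.
  under eq_bigr do rewrite -linearZ; rewrite -linear_sum => /latmap_eq0.
  rewrite big_split_ord /= => E.
  have El (j : 'I_m.+2) : fintype.split (lshift n.+1 j) = inl j by have := unsplitK (inl j : 'I_m.+2 + 'I_n.+1).
  have Er (j : 'I_n.+1) : fintype.split (rshift m.+2 j) = inr j by have := unsplitK (inr j : 'I_m.+2 + 'I_n.+1).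
  have coord1 i (I : finType) (F : I -> 'rV[R]_m.+2 * 'rV[R]_n.+1) :
      (\sum_j F j).1 0 i = \sum_j (F j).1 0 i.
    by apply: (big_morph (fun x : 'rV[R]_m.+2 * 'rV[R]_n.+1 => x.1 0 i)) => [x y|];
      rewrite mxE.
  have coord2 i (I : finType) (F : I -> 'rV[R]_m.+2 * 'rV[R]_n.+1) :
      (\sum_j F j).2 0 i = \sum_j (F j).2 0 i.
    by apply: (big_morph (fun x : 'rV[R]_m.+2 * 'rV[R]_n.+1 => x.2 0 i)) => [x y|];
      rewrite mxE.
  have fstE (i : 'I_m.+2) : k (lshift n.+1 i) = 0.
    have := congr1 (fun x : 'rV[R]_m.+2 * 'rV[R]_n.+1 => x.1 0 i) E.
    rewrite [X in X = _]mxE coord1 coord1 (bigD1 i) //= big1 ?addr0; last first.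
      by move=> j ji; rewrite /bz El !mxE eq_sym (negbTE ji) ?andbF ?mul0rn ?addr0 mulr0z mulr0.
    rewrite big1 ?addr0; last by move=> j _; rewrite /bz Er !mxE mulr0z mulr0.
    rewrite /bz El !mxE !eqxx /= => /eqP; rewrite mulf_eq0 intr_eq0 orbF.
    by move/eqP.
  have sndE (i : 'I_n.+1) : k (rshift m.+2 i) = 0.
    have := congr1 (fun x : 'rV[R]_m.+2 * 'rV[R]_n.+1 => x.2 0 i) E.
    rewrite [X in X = _]mxE coord2 coord2 big1 ?add0r; last first.
      by move=> j _; rewrite /bz El !mxE mulr0z mulr0.
    rewrite (bigD1 i) //= big1 ?addr0; last first.
      by move=> j ji; rewrite /bz Er !mxE eq_sym (negbTE ji) ?andbF ?mul0rn ?addr0 mulr0z mulr0.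
    rewrite /bz Er !mxE !eqxx /= => /eqP; rewrite mulf_eq0 intr_eq0 orbF.
    by move/eqP.
  by move=> i; rewrite -(splitK i); case: (fintype.split i) => j; [exact: fstE|exact: sndE].
move=> x /mapP[i _ ->]; exists (bz i) => //.
rewrite /even_vec /zpt /bz; case: (fintype.split i) => j /=.
  apply: (@sgn_pt_double R _ ((delta_mx 0 j : 'rV[int]_m.+2) 0 ord0 + (delta_mx 0 j : 'rV[int]_m.+2) 0 i1)).
  by rewrite /= !mxE; ring.
apply: (@sgn_pt_double R _ ((delta_mx 0 j : 'rV[int]_n.+1) 0 ord0)).
by rewrite /= !mxE; ring.
Qed.

(** The winding, with [a1 = q], approximates the last coordinates.  The first one
is then corrected by [2 (B + e A)], which does not change the parity. *)
Lemma Gamma_snd_dense : dense [set g.2 | g in Gamma].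
Proof.
move=> U [x Ux] oU; have /nbhs_ballP[r /= r0 rU] : nbhs x U by exact: open_nbhs_nbhs.
have [q [j hq]] := c_dense x r0.
have r2 : 0 < r / 2 by lra.
have [A [B hAB]] := rank_two_dense e_gt e_lt eE ((x 0 ord0 - q%:R - e ^+ 2 * q%:R) / 2) r2.
pose z : zvec := (\row_i (if i == ord0 then 2 * A else if i == i1 then q%:Z else 0),
  \row_i (if i == ord0 then q%:Z + 2 * B else j 0 i)).
exists (proj2 (emb z)); split; last first.
  exists (latmap (emb z)) => //; exists z => //.
  by apply: (@sgn_pt_double R _ (q%:Z + A + B)); rewrite /= !mxE /=; ring.
apply: rU; apply/rV_ballE => i.
have [->|i0] := eqVneq i ord0.
  rewrite proj2_0 /yval /zpt /= !mxE /= intrD !intrM distrC.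
  have -> : q%:Z%:~R + 2%:~R * B%:~R + e * (2%:~R * A%:~R) + e ^+ 2 * q%:Z%:~R - x 0 ord0 =
     2 * (B%:~R + e * A%:~R - (x 0 ord0 - q%:R - e ^+ 2 * q%:R) / 2) by field.
  by rewrite normrM gtr0_norm //; lra.
rewrite proj2_S // !mxE (negbTE i0) /= distrC.
have := hq i; congr (`|_ - _| < r); rewrite addrC mulrC; congr (_ + _).
Qed.

Lemma Gamma_lattice : is_lattice Gamma.
Proof.
split; [exact: Gamma0|exact: GammaB|exact: Gamma_discrete|exact: Gamma_full].
Qed.

Definition G2 : set 'rV[R]_n.+1 := [set g.2 | g in Gamma].

Lemma G2E : G2 = [set proj2 (emb z) | z in even_vec].
Proof.
apply/seteqP; split=> [_ [_ [z ez <-] <-]|_ [z ez <-]]; first by exists z.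
by exists (latmap (emb z)) => //; exists z.
Qed.

Lemma G2_0 : G2 0. Proof. by exists 0 => //; exact: Gamma0. Qed.

Lemma G2B g h : G2 g -> G2 h -> G2 (g - h).
Proof. by move=> [x Gx <-] [y Gy <-]; exists (x - y) => //; exact: GammaB. Qed.

Lemma G2_countable : countable G2.
Proof.
rewrite G2E; apply: (@sub_countable _ _ _ [set: zvec]); last exact: countableP.
by apply: card_le_trans (card_image_le _ _) _; exact: card_leT.
Qed.

(** The element 1 of Z[e] is odd. *)
Lemma G2_one g : G2 g -> g 0 ord0 != 1.
Proof.
rewrite G2E => -[z ez <-]; rewrite proj2_0; apply/eqP => y1.
have /(yval_inj eE) zE : yval e (zpt z) = yval e (1, 0, 0).
  by rewrite y1 /yval /= !mulr0 !addr0.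
move: ez; rewrite /even_vec zE /sgn_pt /= !addr0 expr1z => h.
have : (0 : R) < 1 by []. by rewrite -h; lra.
Qed.

Lemma G2_int (j : 'rV[int]_n.+1) : j 0 ord0 = 0 -> G2 (map_mx intr j).
Proof.
move=> j0; rewrite G2E; exists (0, j).
  by apply: (@sgn_pt_double R _ 0); rewrite /= !mxE j0.
apply/rowP => i; have [->|i0] := eqVneq i ord0.
  by rewrite proj2_0 !mxE /zpt /yval /= !mxE j0 !mulr0z !mulr0 !addr0.
by rewrite proj2_S // !mxE mulr0z mulr0 addr0.
Qed.

Lemma finite_int_box (B : nat) : finite_set [set b : 'rV[int]_n.+1 | forall i, leq (absz (b 0 i)) B].
Proof.
pose f (k : {ffun 'I_n.+1 -> 'I_(2 * B).+1}) : 'rV[int]_n.+1 := \row_i ((k i)%:Z - B%:Z).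
apply: (@sub_finite_set _ _ (range f)); last by apply: finite_image; exact: finite_finset.
move=> b hb; exists [ffun i => inord (absz (b 0 i + B%:Z))] => //.
apply/rowP => i; rewrite mxE ffunE; have := hb i; move: (b 0 i) => x hx.
by rewrite inordK; move: hx; clear; lia.
Qed.

(** The first coordinate of an element determines [b0], [a0] and [a1]; the other
[b_i] are bounded integers. *)
Lemma G2_slice (t B : R) :
  finite_set [set g | G2 g /\ g 0 ord0 = t /\ forall i, `|g 0 i| <= B].
Proof.
have [[g0 [Gg0 g0t]]|no] := pselect (exists g, G2 g /\ g 0 ord0 = t); last first.
  rewrite (_ : [set g | _] = set0) //; apply/seteqP; split=> // g [Gg [gt _]].
  by apply: no; exists g.
move: Gg0; rewrite G2E => -[z0 ez0 z0E].
pose a := z0.1; pose M := (Num.trunc (`|B| + \sum_i `|c 0 i * (a 0 i1)%:~R| + `|(z0.2 0 ord0)%:~R|)).+1.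
apply: (@sub_finite_set _ _ [set proj2 (emb (a, b)) | b in [set b : 'rV[int]_n.+1 | forall i, leq (absz (b 0 i)) M]]); last first.
  by apply: finite_image; exact: finite_int_box.
move=> g [[z ez zE] [gt gB]].
have zz : zpt z = zpt z0.
  by apply: (yval_inj eE); rewrite -!proj2_0 zE z0E gt g0t.
have [e0 ea0 ea1] : [/\ z.2 0 ord0 = z0.2 0 ord0, z.1 0 ord0 = a 0 ord0 & z.1 0 i1 = a 0 i1].
  by move: zz => [].
exists z.2; last first.
  rewrite -zE; apply/rowP => i; have [->|i0] := eqVneq i ord0.
    by rewrite !proj2_0 /zpt /= ea0 ea1.
  by rewrite !proj2_S //= ea1.
move=> i; rewrite /= -(ler_nat R) /M.
have Mgt : `|B| + \sum_i `|c 0 i * (a 0 i1)%:~R| + `|(z0.2 0 ord0)%:~R| < M%:R by exact: truncnS_gt.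
rewrite -/M; apply: ltW; apply: le_lt_trans Mgt.
have -> : (absz (z.2 0 i))%:R = `|(z.2 0 i)%:~R| :> R by rewrite -intr_norm -abszE.
have S0 : 0 <= \sum_i `|c 0 i * (a 0 i1)%:~R| by rewrite sumr_ge0.
have [->|i0] := eqVneq i ord0.
  by rewrite e0 lerDr addr_ge0.
have -> : (z.2 0 i)%:~R = g 0 i - c 0 i * (a 0 i1)%:~R.
  by rewrite -zE proj2_S // ea1 addrK.
apply: (le_trans (ler_normB _ _)); rewrite -[leLHS]addr0; apply: lerD => //; apply: lerD.
  by apply: (le_trans (gB i)); exact: ler_norm.
by rewrite (bigD1 i) //= lerDl sumr_ge0.
Qed.
End Lattice.

(** * The two model sets *)

Lemma sgn_pt1 (R : realType) (v : pt) : sgn_pt R v = 1 \/ sgn_pt R v = -1.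
Proof.
have /eqP := sqr_sgn R v; rewrite -expr2 sqrf_eq1 => /orP[] /eqP ->; by [left|right].
Qed.

Lemma sgn_pt_unit (R : realType) : sgn_pt R (1, 0, 0) = -1.
Proof. by rewrite /sgn_pt /= !addr0 expr1z. Qed.

Section Lift.
Variables (R : realType) (e : R) (m n : nat) (c : 'rV[R]_n.+1) (beta : R).
Hypotheses (e_gt : 2 / 5 < e) (e_lt : e < 1 / 2) (eE : e ^+ 3 = 1 - 2 * e).
Hypothesis c_dense : winding_dense c.
Hypothesis beta_gen : forall i (k l : int), l%:~R + c 0 i * k%:~R != beta.

Notation zvec := ('rV[int]_m.+2 * 'rV[int]_n.+1)%type.
Notation lat z := (latmap e c (emb R z)).
Notation p2 z := (proj2 e c (emb R z)).

Definition fib (u : R) (z : zvec) : Prop := even_vec R z /\ @cube_box R n u beta (p2 z).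

(** The other coordinates of [a] are free, and are left in place by the
bijection. *)
Definition base_site (a : 'rV[int]_m.+2) : site := (a 0 ord0, a 0 (i1 m)).

Lemma cube_boxP (u : R) (y : 'rV[R]_n.+1) : @cube_box R n u beta y <->
  u <= y 0 ord0 <= u + 1 /\ forall i, i != ord0 -> beta <= y 0 i <= beta + 1.
Proof.
split=> [h|[h0 h] i].
  by split=> [|i i0]; [have := h ord0|have := h i]; rewrite !mxE ?eqxx ?(negbTE i0).
rewrite !mxE; have [->|i0] := eqVneq i ord0 => //; exact: h.
Qed.

Lemma even_vec_sgn (z : zvec) (v : pt) : even_vec R z -> yval e (zpt z) = yval e v ->
  sgn_pt R v = 1.
Proof. by move=> ez /(yval_inj eE) <-. Qed.

Lemma yval_nat (k : nat) : yval e (k%:Z, 0, 0) = k%:R.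
Proof. by rewrite /yval /= !mulr0z !mulr0 !addr0. Qed.

Lemma fib0_site z : fib 0 z -> sgn e (base_site z.1) == 1.
Proof.
move=> [ez /cube_boxP[/andP[y0 y1] _]]; rewrite proj2_0 in y0 y1.
have yN1 : yval e (zpt z) != 1.
  apply/eqP => y; have := even_vec_sgn (v := (1, 0, 0)) ez; rewrite (yval_nat 1) y.
  by move=> /(_ erefl); rewrite sgn_pt_unit; lra.
have L : lift_pt e (site_of (zpt z)) = zpt z.
  apply: lift_pt_unique; rewrite y0 lt_neqAle yN1 /=; lra.
by apply/eqP; rewrite /sgn -[base_site _]/(site_of (zpt z)) L.
Qed.

(** Subtracting 1 from an even element with value in [1, 2) gives an odd element
with value in [0, 1).  The value 2 is attained over the origin only. *)
Lemma fib1_site z : fib 1 z -> (sgn e (base_site z.1) != 1) || (base_site z.1 == 0).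
Proof.
move=> [ez /cube_boxP[/andP[y1 y2] _]]; rewrite proj2_0 in y1 y2.
have [y|yN2] := eqVneq (yval e (zpt z)) 2.
  have /(yval_inj eE) zE : yval e (zpt z) = yval e (2, 0, 0) by rewrite y (yval_nat 2).
  by rewrite -[base_site _]/(site_of (zpt z)) zE orbT.
have L : lift_pt e (site_of (zpt z - (1, 0, 0))) = zpt z - (1, 0, 0).
  apply: lift_pt_unique; rewrite yvalB (yval_nat 1).
  by apply/andP; split; [lra|rewrite ltrBlDr lt_neqAle yN2 /=; lra].
have -> : base_site z.1 = site_of (zpt z - (1, 0, 0)) by rewrite /site_of /= !subr0.
apply/orP; left; rewrite /sgn L; apply/eqP => s1.
have := sgn_ptD R (zpt z - (1, 0, 0)) (1, 0, 0).
by rewrite subrK s1 sgn_pt_unit ez; lra.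
Qed.

Lemma fib_exists (u : R) (a : 'rV[int]_m.+2) (b0 : int) :
  sgn_pt R (b0, a 0 ord0, a 0 (i1 m)) = 1 ->
  u <= yval e (b0, a 0 ord0, a 0 (i1 m)) <= u + 1 -> exists b, fib u (a, b).
Proof.
move=> s1 yu.
exists (\row_i (if i == ord0 then b0 else Num.ceil (beta - c 0 i * (a 0 (i1 m))%:~R))).
split; first by rewrite /even_vec /zpt /= mxE.
apply/cube_boxP; split=> [|i i0]; first by rewrite proj2_0 /zpt /= mxE.
rewrite proj2_S // mxE (negbTE i0) /=.
have /andP[h1 h2] := ceil_itv (beta - c 0 i * (a 0 (i1 m))%:~R).
rewrite intrB in h1; apply/andP; split; lra.
Qed.

Lemma fib0_exists (a : 'rV[int]_m.+2) : sgn e (base_site a) == 1 -> exists b, fib 0 (a, b).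
Proof.
move=> /eqP s1; apply: (@fib_exists 0 a (lift_pt e (base_site a)).1.1) => //.
have /andP[y0 y1] := ysite_itv e (base_site a).
by rewrite add0r; apply/andP; split=> //; exact: ltW.
Qed.

Lemma fib1_exists (a : 'rV[int]_m.+2) :
  (sgn e (base_site a) != 1) || (base_site a == 0) -> exists b, fib 1 (a, b).
Proof.
set s := base_site a; set v := lift_pt e s.
have [sN1 _|s1] /= := boolP (sgn e s != 1).
  have sm1 : sgn_pt R v = -1 by case: (sgn_pt1 R v) sN1 => // h; rewrite /sgn -/v h eqxx.
  have E : v + (1, 0, 0) = (v.1.1 + 1, a 0 ord0, a 0 (i1 m)).
    by rewrite /v /lift_pt /=; congr (_, _, _); rewrite /= addr0.
  apply: (@fib_exists 1 a (v.1.1 + 1)); rewrite -E.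
    by rewrite sgn_ptD sgn_pt_unit sm1 mulrNN mulr1.
  have /andP[y0 y1] := ysite_itv e s; rewrite yvalD (yval_nat 1) -[yval e v]/(ysite e s).
  by apply/andP; split; lra.
move=> /eqP s0.
have [a0 a1] : a 0 ord0 = 0 /\ a 0 (i1 m) = 0 by move: s0 => [].
apply: (@fib_exists 1 a 2); rewrite a0 a1.
  by apply: (@sgn_pt_double R _ 1).
by rewrite (yval_nat 2); apply/andP; split; lra.
Qed.

(** Two elements over the same site differ by an even integer in the first
coordinate; the other coordinates avoid the endpoints of their window. *)
Lemma fib_unique (u : R) (a : 'rV[int]_m.+2) b b' : fib u (a, b) -> fib u (a, b') -> b = b'.
Proof.
move=> [ez /cube_boxP[/andP[y1 y2] h]] [ew /cube_boxP[/andP[y1' y2'] h']].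
apply/rowP => i; have [->|i0] := eqVneq i ord0.
  have := even_vecB ez ew; rewrite /even_vec /zpt /= !mxE !subrr.
  rewrite !proj2_0 /yval /zpt /= in y1 y2 y1' y2'.
  have [d1 d2] : b 0 ord0 - b' 0 ord0 <= 1 /\ -1 <= b 0 ord0 - b' 0 ord0.
    by split; rewrite -(ler_int R) intrB ?intrN mulr1z; lra.
  set d := b 0 ord0 - b' 0 ord0 in d1 d2 *.
  have [d0 _|dN0] := eqVneq d 0; first by apply/eqP; rewrite -subr_eq0 -/d d0.
  have : d = 1 \/ d = -1 by move: d1 d2 dN0; clear; lia.
  have sN1 : sgn_pt R (-1, 0, 0) = -1 by rewrite /sgn_pt /= !addr0 exprN1 invrN1.
  have ne : (-1 : R) <> 1 by move=> E; have := @ltr01 R; lra.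
  by case=> ->; rewrite ?sN1 ?sgn_pt_unit => /ne.
have {}h := h i i0; have {}h' := h' i i0; rewrite !proj2_S //= in h h'.
have /andP[l1 l2] := h; have /andP[l1' l2'] := h'.
have ne x : (x%:~R + c 0 i * (a 0 (i1 m))%:~R != beta) by exact: beta_gen.
have lt1 : beta < (b 0 i)%:~R + c 0 i * (a 0 (i1 m))%:~R by rewrite lt_neqAle eq_sym ne.
have lt1' : beta < (b' 0 i)%:~R + c 0 i * (a 0 (i1 m))%:~R by rewrite lt_neqAle eq_sym ne.
have : b 0 i - b' 0 i < 1 by rewrite -(ltr_int R) intrB; lra.
have : -1 < b 0 i - b' 0 i by rewrite -(ltr_int R) intrB intrN; lra.
by clear; lia.
Qed.

Definition shear_bound : R := 2 + (\sum_i `|c 0 i|) * (`|beta| + 1).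

Lemma fib_dist (u : R) z i : 0 <= u <= 1 -> fib u z ->
  `|(lat z).1 0 i - (z.1 0 i)%:~R| <= shear_bound.
Proof.
move=> /andP[u0 u1] [_ /cube_boxP[/andP[y1 y2] h]].
rewrite mxE mxE addrAC subrr add0r mxE /shear_bound.
have S0 : 0 <= \sum_i `|c 0 i| by rewrite sumr_ge0.
have b0 : 0 <= `|beta| + 1 by rewrite addr_ge0.
have P0 := mulr_ge0 S0 b0.
case: ifP => _; last case: ifP => _.
- apply: (@le_trans _ _ ((\sum_i `|c 0 i|) * (`|beta| + 1))); last by rewrite lerDr.
  apply: (le_trans (ler_norm_sum _ _ _)); rewrite mulr_suml [leRHS]big_ord_recl.
  rewrite -[leLHS]add0r; apply: lerD; first by rewrite mulr_ge0.
  apply: ler_sum => j _; rewrite normrM ler_wpM2l //.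
  have /andP[h1 h2] := h (lift ord0 j) isT.
  rewrite ler_norml; have := ler_norm beta; have := ler_norm (- beta); rewrite normrN.
  by move=> *; apply/andP; split; lra.
- by rewrite ger0_norm; lra.
- by rewrite normr0; lra.
Qed.

Lemma model_setE (u : R) : model_set (@Gamma R e m n c) (@cube_box R n u beta) =
  [set (lat z).1 | z in fib u].
Proof.
apply/seteqP; split=> [_ [_ [[z ez <-] /= W] <-]|_ [z [ez W] <-]].
  by exists z.
by exists (lat z) => //; split=> //; exists z.
Qed.

Lemma euclidean_norm_le (d : nat) (x : 'rV[R]_d) (K : R) : 0 <= K ->
  (forall i, `|x 0 i| <= K) -> euclidean_norm x <= Num.sqrt (d%:R * K ^+ 2).
Proof.
move=> K0 xK; apply: ler_wsqrtr; rewrite mulr_natl -[d in leRHS]card_ord -sumr_const.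
apply: ler_sum => i _; rewrite -real_normK ?num_real //.
by rewrite lerXn2r // nnegrE.
Qed.

(** The bijection of the sites is carried to the model sets through the fibres;
physical coordinates and sites are at bounded distance. *)
Lemma bde_cubes : bounded_distance_equivalent
  (model_set (@Gamma R e m n c) (@cube_box R n 0 beta)) (model_set (@Gamma R e m n c) (@cube_box R n 1 beta)).
Proof.
have [K [h [[h1 h2 h3] hK]]] := even_odd_bijection e_gt e_lt eE.
pose F (a : 'rV[int]_m.+2) : 'rV[int]_m.+2 := \row_i
  (if i == ord0 then (h (base_site a)).1 else if i == i1 m then (h (base_site a)).2 else a 0 i).
have baseF a : base_site (F a) = h (base_site a).
  by rewrite [RHS]surjective_pairing /base_site !mxE.
pose rel x y := exists a b b', [/\ fib 0 (a, b), x = (lat (a, b)).1, fib 1 (F a, b') & y = (lat (F a, b')).1].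
have latI (z w : zvec) : even_vec R z -> even_vec R w -> (lat z).1 = (lat w).1 -> z = w.
  move=> ez ew E; apply/eqP; rewrite -subr_eq0; apply/eqP.
  apply: (fst_latmap_eq0 eE c_dense); rewrite embB linearB.
  by change ((lat z).1 - (lat w).1 = 0); rewrite E subrr.
have ex x : exists y, model_set (@Gamma R e m n c) (@cube_box R n 0 beta) x -> rel x y.
  have [[[a b] fz xE]|no] := pselect ([set (lat z).1 | z in fib 0] x); last first.
    by exists 0; rewrite model_setE.
  have [b' fb'] : exists b', fib 1 (F a, b').
    by apply: fib1_exists; rewrite baseF; apply: h1; exact: fib0_site fz.
  by exists (lat (F a, b')).1 => _; exists a, b, b'.
have /choice[chi chiP] := ex.
pose C := 2 * shear_bound + K%:R.
have sb0 : 0 <= shear_bound by rewrite addr_ge0 // mulr_ge0 ?addr_ge0 ?sumr_ge0.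
have C0 : 0 <= C by rewrite addr_ge0 // mulr_ge0.
exists (Num.sqrt (m.+2%:R * C ^+ 2) + 1), chi; split.
- by rewrite ltr_wpDl // sqrtr_ge0.
- split.
  + move=> x /chiP[a [b [b' [_ _ fb' ->]]]]; rewrite model_setE; exact: (ex_intro2 _ _ (F a, b')).
  + move=> x y /set_mem /chiP[a [b [b' [fb -> fb' ->]]]] /set_mem /chiP[a2 [b2 [b2' [fb2 -> fb2' ->]]]].
    move=> /(latI _ _ fb'.1 fb2'.1) [FE _].
    have hE : base_site a = base_site a2.
      apply: h2; rewrite ?inE; [exact: (fib0_site fb)|exact: (fib0_site fb2)|].
      by rewrite -!baseF FE.
    have aE : a = a2.
      apply/rowP => i; have [->|i0] := eqVneq i ord0; first by move: hE => [].
      have [->|ii] := eqVneq i (i1 m); first by move: hE => [].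
      by have := congr1 (fun x : 'rV[int]_m.+2 => x 0 i) FE; rewrite !mxE (negbTE i0) (negbTE ii).
    by rewrite aE in fb *; rewrite (fib_unique fb fb2).
  + move=> y; rewrite model_setE => -[[a' b'] fz' <-].
    have [s /= Ss hs] := h3 _ (fib1_site fz').
    pose a : 'rV[int]_m.+2 := \row_i (if i == ord0 then s.1 else if i == i1 m then s.2 else a' 0 i).
    have base_a : base_site a = s by rewrite [RHS]surjective_pairing /base_site !mxE.
    have FaE : F a = a'.
      apply/rowP => i; rewrite mxE base_a hs /=.
      have [->//|i0] := eqVneq i ord0; have [->//|ii] := eqVneq i (i1 m).
      by rewrite mxE (negbTE i0) (negbTE ii).
    have [b fb] : exists b, fib 0 (a, b) by apply: fib0_exists; rewrite base_a.
    have Lx : model_set (@Gamma R e m n c) (@cube_box R n 0 beta) (lat (a, b)).1.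
      by rewrite model_setE; exists (a, b).
    exists (lat (a, b)).1 => //.
    have [a2 [b2 [b2' [fb2 E2 fb2' ->]]]] := chiP _ Lx.
    have [aa _] := latI _ _ fb.1 fb2.1 E2.
    by rewrite -aa FaE in fb2' *; rewrite (fib_unique fb2' fz').
- move=> x /chiP[a [b [b' [fb -> fb' ->]]]].
  apply: (@le_trans _ _ (Num.sqrt (m.+2%:R * C ^+ 2))); last by rewrite lerDl.
  apply: euclidean_norm_le => // i; have -> : ((lat (F a, b')).1 - (lat (a, b)).1) 0 i =
      (lat (F a, b')).1 0 i - (lat (a, b)).1 0 i.
    by move: (lat _).1 (lat _).1 => p q; rewrite !mxE.
  have d1 := fib_dist i (_ : 0 <= 0 <= 1) fb; have d2 := fib_dist i (_ : 0 <= 1 <= 1) fb'.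
  have {}d1 := d1 (introT andP (conj (lexx 0) ler01)).
  have {}d2 := d2 (introT andP (conj ler01 (lexx 1))).
  have [k1 k2] := hK _ (fib0_site fb).
  have d3 : `|(F a 0 i)%:~R - (a 0 i)%:~R : R| <= K%:R.
    rewrite -intrB -intr_norm pmulrn ler_int mxE.
    case: (i =P ord0) => [->|_]; first exact: k1.
    by case: (i =P i1 m) => [->|_]; [exact: k2|rewrite subrr normr0].
  move: d1 d2 d3; rewrite /C /= !ler_norml => /andP[? ?] /andP[? ?] /andP[? ?].
  by apply/andP; split; lra.
Qed.

Lemma cube_box_parallelepiped (u : R) : is_parallelepiped (@cube_box R n u beta).
Proof.
pose v : 'rV[R]_n.+1 := \row_i (if i == ord0 then u else beta).
exists v, 1%:M; split; first exact: unitmx1.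
apply/seteqP; split=> [x xW|_ [t ht <-] i].
  exists (x - v) => [i|]; last by rewrite mulmx1 addrC subrK.
  have := xW i; rewrite !mxE; case: ifP => _ /andP[? ?]; apply/andP; split; lra.
rewrite mulmx1 !mxE; have /andP[t0 t1] := ht i.
by case: ifP => _; apply/andP; split; lra.
Qed.
End Lift.

(** Only countably many offsets put a lattice vector on the boundary of the
transverse window. *)
Lemma exists_offset (R : realType) (n : nat) (c : 'rV[R]_n.+1) :
  exists beta : R, forall i (k l : int), l%:~R + c 0 i * k%:~R != beta.
Proof.
pose A : set R := range (fun p : 'I_n.+1 * int * int => p.2%:~R + c 0 p.1.1 * p.1.2%:~R).
have [beta nA] : exists beta, ~ A beta.
  apply: countable_avoid.
  apply: (@sub_countable _ _ _ [set: 'I_n.+1 * int * int]); last exact: countableP.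
  exact: card_image_le.
exists beta => i k l; apply/eqP => E; apply: nA; by exists (i, k, l).
Qed.

Theorem theorem5p8 (R : realType) (m n : nat) (hm : (2 <= m)%N)
    (hn : (1 <= n)%N) :
  exists (Gamma : set ('rV[R]_m * 'rV[R]_n)) (W W' : set 'rV[R]_n),
    [/\ is_lattice Gamma,
        set_inj Gamma (fun gamma => gamma.1)
      & dense [set gamma.2 | gamma in Gamma]] /\
    [/\ is_parallelepiped W,
        is_parallelepiped W',
        bounded_distance_equivalent (model_set Gamma W) (model_set Gamma W')
      & ~ equidecomposable [set gamma.2 | gamma in Gamma] W W'].
Proof.
case: m hm => [|[|m]] // _; case: n hn => // n _.
have [e [/andP[e_gt e_lt] eE]] := exists_cubic_unit R.
have [c c_dense] := exists_winding_dense R n.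
have [beta beta_gen] := exists_offset c.
exists (@Gamma R e m n c), (@cube_box R n 0 beta), (@cube_box R n 1 beta); split; split.
- exact: Gamma_lattice.
- exact: Gamma_fst_inj.
- exact: Gamma_snd_dense.
- exact: cube_box_parallelepiped.
- exact: cube_box_parallelepiped.
- exact: bde_cubes.
- apply: not_equidecomposable.
  + exact: G2_0.
  + exact: G2B.
  + exact: G2_countable.
  + exact: G2_slice.
  + exact: G2_one.
  + exact: G2_int.
Qed.
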